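(* Let $\mathfrak g$ be a classical Lie superalgebra of type I and let $\mathfrak p$ be a reduced parabolic subalgebra. Then, for each $\lambda\in\Sigma^+_{\mathfrak p}$, $$\mathrm{pd}_{\mathcal O^{\mathfrak p}}I^{\mathfrak p}(\lambda)=\mathrm{pd}_{\mathcal O^{\mathfrak p}_{\bar 0}}I^{\mathfrak p}_{\bar 0}(\lambda).$$
   Context: A finite-dimensional complex Lie superalgebra $\mathfrak g=\mathfrak g_{\bar 0}\oplus\mathfrak g_{\bar 1}$ is classical if $\mathfrak g_{\bar 0}$ is reductive and $\mathfrak g_{\bar 1}$ is a completely reducible $\mathfrak g_{\bar 0}$-module; it is of type I if it has a compatible $\mathbb Z$-grading $\mathfrak g=\mathfrak g_{-1}\oplus\mathfrak g_0\oplus\mathfrak g_1$ with $\mathfrak g_0=\mathfrak g_{\bar 0}$, $\mathfrak g_{\bar 1}=\mathfrak g_1\oplus\mathfrak g_{-1}$, $\mathfrak g_{\pm1}$ being $\mathfrak g_{\bar 0}$-submodules with $[\mathfrak g_1,\mathfrak g_1]=[\mathfrak g_{-1},\mathfrak g_{-1}]=0$. Modules are supermodules and parities are not tracked. Fix a triangular decomposition $\mathfrak g=\mathfrak n\oplus\mathfrak h\oplus\mathfrak n^-$ with purely even Cartan subalgebra $\mathfrak h$ and Borel subalgebra $\mathfrak b=\mathfrak h\oplus\mathfrak n=\mathfrak b_{\bar 0}\oplus\mathfrak g_1$. A reduced parabolic subalgebra is (in type I, by convention) $\mathfrak p=\mathfrak p_{\bar 0}\oplus\mathfrak g_1$ with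 $\mathfrak p_{\bar 0}\supseteq\mathfrak b_{\bar 0}$ a parabolic subalgebra of $\mathfrak g_{\bar 0}$, with purely even Levi subalgebra $\mathfrak l\supseteq\mathfrak h$ (the Levi subalgebra of $\mathfrak p_{\bar 0}$). $\mathcal O^{\mathfrak p}$ (resp. $\mathcal O^{\mathfrak p}_{\bar 0}$) is the category of finitely generated $\mathfrak g$-modules (resp. $\mathfrak g_{\bar 0}$-modules) that are $\mathfrak h$-semisimple and on which $\mathfrak p$ (resp. $\mathfrak p_{\bar 0}$) acts locally finitely. $\Sigma^+_{\mathfrak p}=\{\lambda\in\mathfrak h^*:\langle\lambda,\alpha^\vee\rangle\in\mathbb Z_{\ge0}\text{ for all positive roots }\alpha\text{ of }\mathfrak l\}$ is the set of highest weights of simple objects. $I^{\mathfrak p}(\lambda)$ is the injective envelope in $\mathcal O^{\mathfrak p}$ of the simple module $L(\lambda)$ of $\mathfrak b$-highest weight $\lambda$, and $I^{\mathfrak p}_{\bar 0}(\lambda)$ is the injective envelope in $\mathcal O^{\mathfrak p}_{\bar 0}$ of the simple $\mathfrak g_{\bar 0}$-module $L_{\bar 0}(\lambda)$ of $\mathfrak b_{\bar 0}$-highest weight $\lambda$. $\mathrm{pd}_{\mathcal A}$ denotes projective dimension in $\mathcal A$. *)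

(* Defs.v *)
From mathcomp Require Import all_boot all_order all_algebra.
From mathcomp Require Import boolp reals.
From mathcomp.real_closed Require Export complex.

Set Implicit Arguments.
Unset Strict Implicit.
Unset Printing Implicit Defensive.

Import GRing.Theory.

Local Open Scope ring_scope.

(* Parities are booleans: false is even, true is odd, and (+) is addition. *)
Record lieSuperalgebra (K : fieldType) := LieSuperalgebra {
  lsa_car :> vectType K;
  lsa_br : lsa_car -> lsa_car -> lsa_car;
  lsa_par : bool -> {vspace lsa_car};
  lsa_brDl : forall y, linear (fun x => lsa_br x y);
  lsa_brDr : forall x, linear (lsa_br x);
  lsa_full : (lsa_par false + lsa_par true = fullv)%VS;
  lsa_direct : (lsa_par false :&: lsa_par true = 0)%VS;
  lsa_graded : forall (i j : bool) x y,
    x \in lsa_par i -> y \in lsa_par j -> lsa_br x y \in lsa_par (i (+) j);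
  lsa_skew : forall (i j : bool) x y,
    x \in lsa_par i -> y \in lsa_par j ->
    lsa_br x y = - ((-1) ^+ (i && j) *: lsa_br y x);
  lsa_jacobi : forall (i j : bool) x y z,
    x \in lsa_par i -> y \in lsa_par j ->
    lsa_br x (lsa_br y z) =
      lsa_br (lsa_br x y) z + (-1) ^+ (i && j) *: lsa_br y (lsa_br x z)
}.

Section Structure.

Variables (K : fieldType) (g : lieSuperalgebra K).
Implicit Types (U V W h p gp gm : {vspace g}).

Definition even_part : {vspace g} := lsa_par g false.
Definition odd_part : {vspace g} := lsa_par g true.

(* [U, V], the span of all brackets *)
Definition brv U V : {vspace g} :=
  <<[seq lsa_br u v | u <- vbasis U, v <- vbasis V]>>%VS.

Definition ad (x : g) : 'End(g) := linfun (lsa_br x).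

(* complete reducibility of V under the adjoint action of the even part *)
Definition completely_reducible V : Prop :=
  forall U, (U <= V)%VS -> (brv even_part U <= U)%VS ->
  exists W, [/\ (W <= V)%VS, (brv even_part W <= W)%VS,
                (U + W = V)%VS & (U :&: W = 0)%VS].

(* A Lie algebra is reductive when its adjoint module is completely
   reducible. *)
Definition classical : Prop :=
  completely_reducible even_part /\ completely_reducible odd_part.

(* gm, gp are the components of degree -1 and 1; the bracket [gp, gm] lands in
   the even part for parity reasons. *)
Definition type_I_grading gm gp : Prop :=
  [/\ (gp + gm = odd_part)%VS /\ (gp :&: gm = 0)%VS,
      (brv even_part gp <= gp)%VS,
      (brv even_part gm <= gm)%VS,
      brv gp gp = 0%VS
    & brv gm gm = 0%VS].

Definition lie_nilpotent U : Prop := exists k, iter k (brv U) U = 0%VS.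

Definition even_cartan h : Prop :=
  [/\ (h <= even_part)%VS, (brv h h <= h)%VS, lie_nilpotent h
    & forall x, x \in even_part ->
        (forall y, y \in h -> lsa_br x y \in h) -> x \in h].

Definition hdual h := 'Hom(subvs_of h, K^o).

Definition root_space h (al : hdual h) : {vspace g} :=
  (even_part :&:
   \bigcap_(t <- vbasis h) passmx.leigenspace (ad t) (al (vsproj h t)))%VS.

Definition is_root h (al : hdual h) : bool :=
  (al != 0) && (root_space al != 0%VS).

(* Phi lists the positive roots of the even part. *)
Definition positive_system h (Phi : seq (hdual h)) : Prop :=
  [/\ forall al, al \in Phi -> is_root al,
      forall al, is_root al -> (al \in Phi) (+) (- al \in Phi)
    & forall al be, al \in Phi -> be \in Phi -> is_root (al + be) ->
        al + be \in Phi].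

(* The sum of the positive root spaces of the even part. With gp as above, the
   positive part of the triangular decomposition of g is even_n Phi + gp. *)
Definition even_n h (Phi : seq (hdual h)) : {vspace g} :=
  (\sum_(al <- Phi) root_space al)%VS.

(* p0 is a subalgebra of the even part containing the Borel subalgebra given
   by Phi. *)
Definition even_parabolic h (Phi : seq (hdual h)) (p0 : {vspace g}) : Prop :=
  [/\ (h + even_n Phi <= p0)%VS, (p0 <= even_part)%VS & (brv p0 p0 <= p0)%VS].

(* the Levi subalgebra of p0 containing h *)
Definition levi h (Phi : seq (hdual h)) (p0 : {vspace g}) : {vspace g} :=
  (h + \sum_(al <- Phi | (root_space (- al) <= p0)%VS)
         (root_space al + root_space (- al)))%VS.

Definition is_coroot h (al : hdual h) (c : subvs_of h) : Prop :=
  vsval c \in brv (root_space al) (root_space (- al)) /\ al c = 2%:R.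

(* Sigma^+_p *)
Definition levi_dominant h (Phi : seq (hdual h)) (p0 : {vspace g})
    (la : hdual h) : Prop :=
  forall al c, al \in Phi -> (root_space al <= levi Phi p0)%VS ->
    is_coroot al c -> exists n : nat, la c = n%:R.

End Structure.

(* Supermodules over a graded subalgebra a of g; only a = g and a = the even
   part are used. *)
Record supermodule (K : fieldType) (g : lieSuperalgebra K) (a : {vspace g}) :=
Supermodule {
  smod_car :> lmodType K;
  smod_act : subvs_of a -> smod_car -> smod_car;
  smod_par : bool -> smod_car -> Prop;
  smod_actDl : forall v, linear (fun x => smod_act x v);
  smod_actDr : forall x, linear (smod_act x);
  smod_par0 : forall i, smod_par i 0;
  smod_parD : forall i (c : K) u v,
    smod_par i u -> smod_par i v -> smod_par i (c *: u + v);
  smod_full : forall v, exists v0 v1,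
    [/\ smod_par false v0, smod_par true v1 & v = v0 + v1];
  smod_direct : forall v, smod_par false v -> smod_par true v -> v = 0;
  smod_graded : forall (i j : bool) x v,
    vsval x \in lsa_par g i -> smod_par j v ->
    smod_par (i (+) j) (smod_act x v);
  smod_br : forall (i j : bool) x y v,
    vsval x \in lsa_par g i -> vsval y \in lsa_par g j ->
    smod_act (vsproj a (lsa_br (vsval x) (vsval y))) v =
      smod_act x (smod_act y v) - (-1) ^+ (i && j) *: smod_act y (smod_act x v)
}.

Section Modules.

Variables (K : fieldType) (g : lieSuperalgebra K) (a : {vspace g}).
Implicit Types (M N P L I : supermodule a) (A : supermodule a -> Prop).

(* the action of an element x of g that lies in a *)
Definition act M (x : g) (v : M) : M := smod_act (vsproj a x) v.

(* Morphisms are even. *)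
Definition smod_hom M N (f : M -> N) : Prop :=
  [/\ linear f,
      forall x v, f (smod_act x v) = smod_act x (f v)
    & forall i v, smod_par i v -> smod_par i (f v)].

Definition is_subsupermodule M (N : M -> Prop) : Prop :=
  [/\ N 0,
      forall (c : K) u v, N u -> N v -> N (c *: u + v),
      forall x v, N v -> N (smod_act x v)
    & forall v0 v1, smod_par false v0 -> smod_par true v1 ->
        N (v0 + v1) -> N v0 /\ N v1].

Definition simple_smod M : Prop :=
  (exists v : M, v <> 0) /\
  forall N : M -> Prop, is_subsupermodule N ->
    (forall v, N v -> v = 0) \/ (forall v, N v).

Definition finitely_generated M : Prop :=
  exists s : seq M, forall N : M -> Prop, is_subsupermodule N ->
    (forall v, v \in s -> N v) -> forall v, N v.

Definition is_weight_vector (h : {vspace g}) M (la : hdual h) (v : M) : Prop :=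
  forall t : subvs_of h, act (vsval t) v = (la t : K) *: v.

Definition h_semisimple (h : {vspace g}) M : Prop :=
  forall v : M, exists s : seq M,
    (forall w, w \in s -> exists la : hdual h, is_weight_vector la w) /\
    v = \sum_(w <- s) w.

Definition in_lspan M (s : seq M) (v : M) : Prop :=
  exists c : 'I_(size s) -> K, v = \sum_(i < size s) c i *: s`_i.

Definition locally_finite (p : {vspace g}) M : Prop :=
  forall v : M, exists s : seq M, in_lspan s v /\
    forall x w, x \in p -> in_lspan s w -> in_lspan s (act x w).

(* The parabolic category O, a full subcategory of supermodules over a; it is
   closed under subquotients, so its monomorphisms and epimorphisms are the
   injective and the surjective morphisms. *)
Definition catO (h p : {vspace g}) M : Prop :=
  [/\ finitely_generated M, h_semisimple h M & locally_finite p M].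

Definition simple_of_highest_weight (h n : {vspace g}) (la : hdual h) L : Prop :=
  simple_smod L /\
  exists v : L, [/\ v <> 0, is_weight_vector la v
                  & forall x, x \in n -> act x v = 0].

Definition projective A P : Prop :=
  A P /\
  forall M N (f : M -> N) (k : P -> N), A M -> A N ->
    smod_hom f -> (forall w, exists v, f v = w) -> smod_hom k ->
    exists k' : P -> M, smod_hom k' /\ forall v, f (k' v) = k v.

Definition injective_object A I : Prop :=
  A I /\
  forall M N (f : M -> N) (k : M -> I), A M -> A N ->
    smod_hom f -> injective f -> smod_hom k ->
    exists k' : N -> I, smod_hom k' /\ forall v, k' (f v) = k v.

(* I is injective in A and contains L as an essential subobject. *)
Definition injective_envelope A L I : Prop :=
  injective_object A I /\
  exists f : L -> I, [/\ smod_hom f, injective f &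
    forall N : I -> Prop, is_subsupermodule N -> (exists v, N v /\ v <> 0) ->
      exists w, N (f w) /\ f w <> 0].

(* M has a projective resolution P_n -> ... -> P_0 -> M in A, written with
   P_i = 0 for i > n. *)
Definition proj_resolution_le A M (n : nat) : Prop :=
  exists (P : nat -> supermodule a) (d : forall i, P i.+1 -> P i)
         (e : P 0%N -> M),
  [/\ forall i, projective A (P i),
      forall i, (n < i)%N -> forall v : P i, v = 0,
      smod_hom e /\ (forall i, smod_hom (d i)),
      forall w, exists v, e v = w
    & (forall v, e v = 0 <-> exists w, d 0%N w = v) /\
      (forall i v, d i v = 0 <-> exists w, d i.+1 w = v)].

(* the minimal length of a projective resolution; None stands for infinity *)
Definition pd A M : option nat :=
  match pselect (exists n, `[< proj_resolution_le A M n >]) with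
  | left ex => Some (ex_minn ex)
  | right _ => None
  end.

End Modules.

(* Main.v *)
Require Import Defs.
From HB Require Import structures.
From mathcomp Require Import all_boot all_order all_algebra.
From mathcomp Require Import boolp functions reals ring.
From mathcomp.real_closed Require Import complex.

(* Restriction from g to the even part has a right adjoint, coinduction, which
   is carried out here in two steps, even < even + gm < g, each adjoining an
   odd abelian summand.  Each step of coinduction is isomorphic to induction of
   a twist, so restriction and coinduction are exact and preserve projectives
   and injectives, hence do not increase projective dimension.

   L0 is isomorphic, up to parity, to the space of gp-invariants of L, which is
   a simple module for the even part.  Hence I embeds in the module coinduced
   from I0 and I0 embeds in the restriction of I; both embeddings split by
   injectivity, and projective dimension passes to direct summands.

   That the Cartan subalgebra acts diagonalizably on g, and that no nonempty
   sum of positive roots vanishes, is deduced from the complete reducibility of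
   the two parts of g through the trace form of its adjoint representation. *)

(** The odd part of [g] is not abelian, because [[gp, gm]] is in general a nonzero piece of the even
    part; this forces the splitting of coinduction. In a single step the adjoined space [q] is
    abelian, the enveloping algebra of [a] is free over that of [b] on the exterior algebra of [q],
    and the coinduced module becomes the space of alternating forms on [q] with values in [N], so no
    enveloping algebra has to be built. The forms of top degree generate it over [q] and carry [N]
    twisted by a character of the even part: this is why the same module is also induced, and it
    gives restriction an adjoint on either side.

    The envelopes are compared through retracts alone, with no decomposition of coinduced
    injectives. Retracts suffice because a syzygy of a direct summand is a retract of a syzygy plus
    a projective. Diagonalizability of [ad h] is what keeps coinduced modules [h]-semisimple, and
    the statement on sums of positive roots makes the highest weight space of a cyclic module a
    line. Morphisms are even, so a parity shift remains to be absorbed at the end. *)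

Set Implicit Arguments.
Unset Strict Implicit.
Unset Printing Implicit Defensive.

Import GRing.Theory Num.Theory.

Local Open Scope ring_scope.

#[local] Obligation Tactic := idtac.

(** * Linear combinations *)

(* Reflexive decision of equalities of linear combinations: both sides are
   brought to the form sum_i c_i *: v_i over the list of atoms v_i, and the
   equalities between the coefficients are left to ring. *)
Section LinearCombinations.

Variables (K : comPzRingType) (V : lmodType K).

Inductive lexp := LVar of nat | LAdd of lexp & lexp | LOpp of lexp | LZero
  | LScale of K & lexp.

Fixpoint lden (env : seq V) e : V :=
  match e with
  | LVar n => nth 0 env n
  | LAdd e1 e2 => lden env e1 + lden env e2
  | LOpp e1 => - lden env e1
  | LZero => 0
  | LScale c e1 => c *: lden env e1
  end.

(** [eqn] rather than [==] lets plain simplification evaluate the coefficients at closed indices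
    before [ring] sees them. *)
Fixpoint lcoef e i : K :=
  match e with
  | LVar n => if eqn n i then 1 else 0
  | LAdd e1 e2 => lcoef e1 i + lcoef e2 i
  | LOpp e1 => - lcoef e1 i
  | LZero => 0
  | LScale c e1 => c * lcoef e1 i
  end.

Lemma ldenE env e : lden env e = \sum_(i < size env) lcoef e i *: nth 0 env i.
Proof.
have lcoefV n i : lcoef (LVar n) i = (n == i)%:R by rewrite /lcoef eqnE; case: eqP.
elim: e => [n|e1 IH1 e2 IH2|e1 IH1||c e1 IH1].
- rewrite -[LHS]/(nth 0 env n); under eq_bigr do rewrite lcoefV.
  have [lt_n|le_n] := ltnP n (size env); last first.
    rewrite nth_default // big1 // => i _; rewrite gtn_eqF ?scale0r //.
    exact: leq_trans le_n.
  rewrite (bigD1 (Ordinal lt_n)) //= eqxx scale1r big1 ?addr0 // => i ni.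
  case: eqP => [e|]; last by rewrite scale0r.
  by case/eqP: ni; apply: val_inj.
- by rewrite /= IH1 IH2 -big_split /=; apply: eq_bigr => i _; rewrite scalerDl.
- by rewrite /= IH1 -sumrN; apply: eq_bigr => i _; rewrite scaleNr.
- by rewrite big1 // => i _; rewrite scale0r.
- by rewrite /= IH1 scaler_sumr; apply: eq_bigr => i _; rewrite scalerA.
Qed.

Fixpoint lcoef_eq n e1 e2 : Prop :=
  if n is m.+1 then lcoef e1 m = lcoef e2 m /\ lcoef_eq m e1 e2 else True.

Lemma lden_eq env e1 e2 : lcoef_eq (size env) e1 e2 -> lden env e1 = lden env e2.
Proof.
move=> h; rewrite !ldenE; apply: eq_bigr => i _; congr (_ *: _).
elim: (size env) h (nat_of_ord i) (ltn_ord i) => // n IH [e h] j.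
by rewrite ltnS leq_eqVlt => /orP[/eqP->|/(IH h)].
Qed.

End LinearCombinations.

Ltac lin_atom x env :=
  lazymatch env with
  | nil => constr:(0%N)
  | cons x _ => constr:(0%N)
  | cons _ ?env' => let n := lin_atom x env' in constr:(n.+1)
  end.
Ltac lin_insert x env :=
  lazymatch env with
  | nil => constr:(x :: nil)
  | cons x _ => env
  | cons ?y ?env' => let e := lin_insert x env' in constr:(y :: e)
  end.
Ltac lin_env t env :=
  lazymatch t with
  | (?x + ?y)%R => let e := lin_env x env in lin_env y e
  | (- ?x)%R => lin_env x env
  | (_ *: ?x)%R => lin_env x env
  | (0)%R => env
  | _ => lin_insert t env
  end.
Ltac lin_reify K t env :=
  lazymatch t with
  | (?x + ?y)%R => let a := lin_reify K x env in let b := lin_reify K y env in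
                   constr:(LAdd a b)
  | (- ?x)%R => let a := lin_reify K x env in constr:(LOpp a)
  | (?c *: ?x)%R => let a := lin_reify K x env in constr:(LScale c a)
  | (0)%R => constr:(@LZero K)
  | _ => let n := lin_atom t env in constr:(@LVar K n)
  end.
Ltac lin_coefs := repeat (split; first by [|ring]); exact: I.
Ltac lin K V :=
  match goal with
  | |- ?l = ?r :> ?T =>
    let env0 := lin_env l (@nil T) in let env := lin_env r env0 in
    let a := lin_reify K l env in let b := lin_reify K r env in
    apply: (@lden_eq K V env a b); rewrite /=; lin_coefs
  end.

Section LinearFunctions.

Variables (K : pzRingType) (V V' : lmodType K) (u : V -> V').
Hypothesis ul : linear u.

Lemma lin0f : u 0 = 0.
Proof. by have := ul (-1) 0 0; rewrite !scaleN1r !oppr0 !addr0 addNr. Qed.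
Lemma linDf v w : u (v + w) = u v + u w.
Proof. by rewrite -[v]scale1r ul !scale1r. Qed.
Lemma linZf c v : u (c *: v) = c *: u v.
Proof. by rewrite -[c *: v]addr0 ul lin0f addr0. Qed.
Lemma linNf v : u (- v) = - u v.
Proof. by rewrite -!scaleN1r linZf. Qed.

End LinearFunctions.

(** * Supermodules and projective dimension *)

Section SupermoduleBasics.

Variables (K : fieldType) (g : lieSuperalgebra K) (a : {vspace g}).
Implicit Types (M N P : supermodule a).

Lemma act_linear M x : linear (act (M := M) x).
Proof. exact: smod_actDr. Qed.

HB.instance Definition _ M (x : g) :=
  GRing.isLinear.Build K M M _ (act (M := M) x) (act_linear x).

Definition actr M (v : M) (x : g) : M := act x v.

Lemma actr_linear M (v : M) : linear (actr v).
Proof. by move=> c x y; rewrite /actr /act linearP smod_actDl. Qed.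

HB.instance Definition _ M (v : M) :=
  GRing.isLinear.Build K g M _ (actr v) (actr_linear v).

Lemma actDl M x y (v : M) : act (x + y) v = act x v + act y v.
Proof. exact: (linearD (actr v)). Qed.

Lemma actZl M c x (v : M) : act (c *: x) v = c *: act x v.
Proof. exact: (linearZ_LR (actr v)). Qed.

Lemma act0l M (v : M) : act 0 v = 0.
Proof. exact: (linear0 (actr v)). Qed.

Lemma act_suml M I r (P : pred I) (F : I -> g) (v : M) :
  act (\sum_(i <- r | P i) F i) v = \sum_(i <- r | P i) act (F i) v.
Proof. exact: (linear_sum (actr v)). Qed.

Lemma smod_actE M (x : subvs_of a) (v : M) : smod_act x v = act (vsval x) v.
Proof. by rewrite /act vsvalK. Qed.

Lemma act_graded M i j x (v : M) : x \in a -> x \in lsa_par g i ->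
  smod_par j v -> smod_par (i (+) j) (act x v).
Proof. by move=> xa xi vj; apply: smod_graded => //; rewrite vsprojK. Qed.

Lemma act_br M (i j : bool) x y (v : M) : x \in a -> y \in a ->
  x \in lsa_par g i -> y \in lsa_par g j ->
  act (lsa_br x y) v = act x (act y v) - (-1) ^+ (i && j) *: act y (act x v).
Proof.
move=> xa ya xi yj; have := @smod_br _ _ _ M i j (vsproj a x) (vsproj a y) v.
by rewrite !vsprojK // => /(_ xi yj).
Qed.

Lemma smod_parZ M i c (v : M) : smod_par i v -> smod_par i (c *: v).
Proof. by move=> vi; rewrite -[_ *: _]addr0; apply: smod_parD => //; apply: smod_par0. Qed.

Lemma smod_parA M i (u v : M) : smod_par i u -> smod_par i v -> smod_par i (u + v).
Proof. by move=> ui vi; rewrite -[u]scale1r; apply: smod_parD. Qed.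

Lemma smod_parN M i (v : M) : smod_par i v -> smod_par i (- v).
Proof. by rewrite -scaleN1r; apply: smod_parZ. Qed.

Lemma smod_parB M i (u v : M) : smod_par i u -> smod_par i v -> smod_par i (u - v).
Proof. by move=> ui /smod_parN; apply: smod_parA. Qed.

Lemma smod_par_uniq M b (u0 u1 v0 v1 : M) :
  smod_par b u0 -> smod_par (~~ b) u1 -> smod_par b v0 -> smod_par (~~ b) v1 ->
  u0 + u1 = v0 + v1 -> u0 = v0 /\ u1 = v1.
Proof.
move=> u0e u1o v0e v1o e.
have e' : u0 - v0 = v1 - u1.
  by apply/eqP; rewrite subr_eq addrAC eq_sym subr_eq addrC e addrC.
have z : u0 - v0 = 0.
  have h0 := smod_parB u0e v0e; have h1 := smod_parB v1o u1o.
  by case: b {u0e u1o v0e v1o} h0 h1 => h0 h1; apply: smod_direct => //; rewrite e'.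
split; first by apply/eqP; rewrite -subr_eq0 z.
by apply/esym/eqP; rewrite -subr_eq0 -e' z.
Qed.

Section Hom.
Variables (M N : supermodule a) (f : M -> N).
Hypothesis fh : smod_hom f.

Lemma homD : {morph f : u v / u + v}.
Proof. by case: fh => fl _ _ u v; rewrite -[u]scale1r fl !scale1r. Qed.

Lemma hom0 : f 0 = 0.
Proof. by apply: (addrI (f 0)); rewrite -homD !addr0. Qed.

Lemma homZ c : {morph f : u / c *: u}.
Proof. by case: fh => fl _ _ u; rewrite -[c *: u]addr0 fl hom0 addr0. Qed.

Lemma homN : {morph f : u / - u}.
Proof. by move=> u; rewrite -!scaleN1r homZ. Qed.

Lemma homB : {morph f : u v / u - v}.
Proof. by move=> u v; rewrite homD homN. Qed.

Lemma hom_sum I r (P : pred I) (F : I -> M) :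
  f (\sum_(i <- r | P i) F i) = \sum_(i <- r | P i) f (F i).
Proof. by apply: (big_morph f homD hom0). Qed.

Lemma hom_act x v : f (act x v) = act x (f v).
Proof. by case: fh => _ fx _; rewrite /act fx. Qed.

Lemma hom_par i v : smod_par i v -> smod_par i (f v).
Proof. by case: fh => _ _; apply. Qed.

Lemma hom_inj : (forall v, f v = 0 -> v = 0) -> injective f.
Proof. by move=> f0 u v e; apply/eqP; rewrite -subr_eq0; apply/eqP/f0; rewrite homB e subrr. Qed.

Lemma hom_preim (U : N -> Prop) :
  is_subsupermodule U -> is_subsupermodule (fun v => U (f v)).
Proof.
case=> U0 UD UA Ug; split; first by rewrite hom0.
- by move=> c u v; rewrite homD homZ; apply: UD.
- by move=> x v; rewrite smod_actE hom_act -smod_actE; apply: UA.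
- by move=> v0 v1 /hom_par p0 /hom_par p1; rewrite homD; apply: Ug.
Qed.

Lemma hom_img (U : M -> Prop) :
  is_subsupermodule U -> is_subsupermodule (fun w => exists2 v, U v & f v = w).
Proof.
case=> U0 UD UA Ug; split; first by exists 0; rewrite ?hom0.
- move=> c _ _ [u uU <-] [v vU <-]; exists (c *: u + v); first exact: UD.
  by rewrite homD homZ.
- by move=> x _ [v vU <-]; exists (smod_act x v); [exact: UA|rewrite !smod_actE hom_act].
- move=> w0 w1 w0e w1o [v vU e].
  have [v0 [v1 [v0e v1o ev]]] := smod_full v; rewrite ev in vU e.
  have [v0U v1U] := Ug _ _ v0e v1o vU.
  rewrite homD in e.
  have [e0 e1] := @smod_par_uniq _ false _ _ _ _ (hom_par v0e) (hom_par v1o) w0e w1o e.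
  by split; [exists v0|exists v1].
Qed.

End Hom.

Lemma hom_id M : smod_hom (@id M).
Proof. by []. Qed.

Lemma hom_comp M N P (f : M -> N) (k : N -> P) :
  smod_hom f -> smod_hom k -> smod_hom (fun v => k (f v)).
Proof.
move=> fh kh; split.
- by move=> c u v; rewrite (homD fh) (homZ fh) (homD kh) (homZ kh).
- by move=> x v; rewrite !smod_actE (hom_act fh) (hom_act kh).
- by move=> i v vi; apply/(hom_par kh)/(hom_par fh).
Qed.

Lemma hom_lin M N (f k : M -> N) c : smod_hom f -> smod_hom k ->
  smod_hom (fun v => c *: f v + k v).
Proof.
move=> fh kh; split.
- move=> d u v; rewrite !(homD fh, homD kh, homZ fh, homZ kh) !scalerDr !scalerA mulrC.
  by rewrite -!addrA; congr (_ + _); rewrite addrCA.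
- by move=> x v; rewrite !smod_actE (hom_act fh) (hom_act kh) linearP.
- by move=> i v vi; apply: smod_parD; apply: hom_par.
Qed.

Lemma smod_par_comp M i (v0 v1 : M) : smod_par false v0 -> smod_par true v1 ->
  smod_par i (v0 + v1) -> (if i then v0 else v1) = 0.
Proof.
move=> v0e v1o; have z j : smod_par j (0 : M) by exact: smod_par0.
case: i => vi.
  by apply: (proj1 (@smod_par_uniq M false v0 v1 0 (v0 + v1) v0e v1o _ vi _)); rewrite ?add0r.
by apply: (proj2 (@smod_par_uniq M false v0 v1 (v0 + v1) 0 v0e v1o vi _ _)); rewrite ?addr0.
Qed.

Lemma inj_hom_par M N (f : M -> N) i v : smod_hom f -> injective f ->
  smod_par i (f v) -> smod_par i v.
Proof.
move=> fh fi; have [v0 [v1 [v0e v1o ->]]] := smod_full v; rewrite (homD fh) => fv.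
have := smod_par_comp (hom_par fh v0e) (hom_par fh v1o) fv.
by case: i {fv} => e; [rewrite (fi v0 0)|rewrite (fi v1 0)]; rewrite ?add0r ?addr0 ?(hom0 fh).
Qed.

Lemma zero_subsupermodule M : is_subsupermodule (fun v : M => v = 0).
Proof.
split=> //.
- by move=> c u v -> ->; rewrite scaler0 addr0.
- by move=> x v ->; rewrite smod_actE linear0.
- move=> v0 v1 v0e v1o e.
  by apply: (@smod_par_uniq _ false _ _ 0 0) => //; rewrite ?addr0 //; apply: smod_par0.
Qed.

Lemma ker_subsupermodule M N (f : M -> N) : smod_hom f -> is_subsupermodule (fun v => f v = 0).
Proof. by move=> fh; apply: (hom_preim fh (zero_subsupermodule N)). Qed.

End SupermoduleBasics.

Section Submodule.

Variables (K : fieldType) (g : lieSuperalgebra K) (a : {vspace g}).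
Variables (M : supermodule a) (U : M -> Prop) (HU : is_subsupermodule U).

(** Carrying the closure proof as an argument attaches the submodule structure to this predicate,
    from which the subtype below inherits its module structure. *)
Definition sub_pred of is_subsupermodule U : {pred M} := fun v => `[< U v >].

Lemma sub_predE v : reflect (U v) (v \in sub_pred HU).
Proof. exact: asboolP. Qed.

Lemma sub_pred_closed : submod_closed (sub_pred HU).
Proof.
have [U0 UD _ _] := HU; split; first exact/sub_predE.
by move=> c u v /sub_predE uU /sub_predE vU; apply/sub_predE/UD.
Qed.

HB.instance Definition _ := GRing.isSubmodClosed.Build K M (sub_pred HU) sub_pred_closed.

Record sub_car := SubCar { sub_val : M; _ : sub_val \in sub_pred HU }.

HB.instance Definition _ := [isSub for sub_val].
HB.instance Definition _ := [Choice of sub_car by <:].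
HB.instance Definition _ := [SubChoice_isSubLmodule of sub_car by <:].

Lemma sub_valP (v : sub_car) : U (sub_val v).
Proof. by apply/sub_predE; case: v. Qed.

Definition subI v (Uv : U v) : sub_car := SubCar (introT (sub_predE v) Uv).

Lemma sub_act_subproof x (v : sub_car) : U (smod_act x (sub_val v)).
Proof. by have [_ _ UA _] := HU; apply/UA/sub_valP. Qed.

Definition sub_act x v := subI (sub_act_subproof x v).

Lemma sub_val_inj : injective sub_val. Proof. exact: val_inj. Qed.

Program Definition sub_smod : supermodule a :=
  @Supermodule K g a sub_car sub_act (fun i v => smod_par i (sub_val v))
   _ _ _ _ _ _ _ _.
Next Obligation. by move=> v c x y; apply: sub_val_inj; rewrite /= smod_actDl. Qed.
Next Obligation. by move=> x c u v; apply: sub_val_inj; rewrite /= smod_actDr. Qed.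
Next Obligation. by move=> i; apply: smod_par0. Qed.
Next Obligation. by move=> i c u v; apply: smod_parD. Qed.
Next Obligation.
move=> v; have [v0 [v1 [v0e v1o e]]] := smod_full (sub_val v).
have := sub_valP v; rewrite e => Uv.
have [_ _ _ Ug] := HU; have [U0 U1] := Ug _ _ v0e v1o Uv.
by exists (subI U0), (subI U1); split=> //; apply: sub_val_inj.
Qed.
Next Obligation. by move=> v v0 v1; apply: sub_val_inj; apply: smod_direct. Qed.
Next Obligation. by move=> i j x v xi vj; apply: smod_graded. Qed.
Next Obligation. by move=> i j x y v xi yj; apply: sub_val_inj; rewrite /= (smod_br _ xi yj). Qed.

Lemma sub_val_hom : smod_hom (sub_val : sub_smod -> M).
Proof. by []. Qed.

Lemma sub_val_act x (v : sub_smod) : sub_val (act x v) = act x (sub_val v).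
Proof. exact: hom_act sub_val_hom _ _. Qed.

Lemma sub_lift_hom (N : supermodule a) (f : N -> M) (fU : forall v, U (f v)) :
  smod_hom f -> smod_hom (fun v => subI (fU v) : sub_smod).
Proof.
case=> fl fa fp; split.
- by move=> c u v; apply: sub_val_inj; rewrite /= fl.
- by move=> x v; apply: sub_val_inj; rewrite /= fa.
- by move=> i v vi; apply: fp.
Qed.

End Submodule.

Section Product.

Variables (K : fieldType) (g : lieSuperalgebra K) (a : {vspace g}).
Variables (M N : supermodule a).

Program Definition prod_smod : supermodule a :=
  @Supermodule K g a (M * N)%type (fun x v => (smod_act x v.1, smod_act x v.2))
   (fun i v => smod_par i v.1 /\ smod_par i v.2) _ _ _ _ _ _ _ _.
Next Obligation. by move=> v c x y; rewrite !smod_actDl. Qed.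
Next Obligation. by move=> x c u v; rewrite !smod_actDr. Qed.
Next Obligation. by move=> i; split; apply: smod_par0. Qed.
Next Obligation. by move=> i c u v [u1 u2] [v1 v2]; split; apply: smod_parD. Qed.
Next Obligation.
move=> [u v]; have [u0 [u1 [u0e u1o eu]]] := smod_full u.
have [v0 [v1 [v0e v1o ev]]] := smod_full v.
by exists (u0, v0), (u1, v1); split=> //; rewrite eu ev.
Qed.
Next Obligation. by move=> [u v] /= [u0 v0] [u1 v1]; rewrite (smod_direct u0 u1) (smod_direct v0 v1). Qed.
Next Obligation. by move=> i j x [u v] xi /= [uj vj]; split; apply: smod_graded. Qed.
Next Obligation. by move=> i j x y [u v] xi yj; rewrite /= !(smod_br _ xi yj). Qed.

Lemma fst_hom : smod_hom (fun v : prod_smod => v.1).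
Proof. by split=> // i v []. Qed.
Lemma snd_hom : smod_hom (fun v : prod_smod => v.2).
Proof. by split=> // i v []. Qed.

Lemma pair_hom (P : supermodule a) (f : P -> M) (k : P -> N) :
  smod_hom f -> smod_hom k -> smod_hom (fun v => (f v, k v) : prod_smod).
Proof.
move=> fh kh; split.
- by move=> c u v; rewrite !(homD fh, homD kh, homZ fh, homZ kh).
- by move=> x v; rewrite !smod_actE /= (hom_act fh) (hom_act kh).
- by move=> i v vi; split; [apply: (hom_par fh)|apply: (hom_par kh)].
Qed.

End Product.

(** * Projective dimension by iterated syzygies *)

Section ProjectiveDimension.

Variables (K : fieldType) (g : lieSuperalgebra K) (a : {vspace g}).
Implicit Types (M N P Q X Y : supermodule a).

Definition ses M N P (i : M -> N) (p : N -> P) : Prop :=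
  [/\ smod_hom i, smod_hom p, injective i, forall w, exists v, p v = w
    & forall v, p v = 0 <-> exists w, i w = v].

Variable A : supermodule a -> Prop.

(** Takes one syzygy at a time, a form suited to induction; [proj_resolution_pdle] identifies it
    with the existence of a resolution. *)
Fixpoint pdle n M : Prop :=
  if n is n'.+1 then
    exists P N (i : N -> P) (p : P -> M), [/\ projective A P, ses i p & pdle n' N]
  else projective A M.

Hypothesis A_quo : forall M N (f : M -> N), A M -> smod_hom f ->
  (forall w, exists v, f v = w) -> A N.
Hypothesis A_prod : forall M N, A M -> A N -> A (prod_smod M N).

Lemma pdle_cat n M : pdle n M -> A M.
Proof.
case: n => [[]//|n [P [N [i [p [[AP _] [_ ph _ psurj _] _]]]]]].
exact: A_quo AP ph psurj.
Qed.

Lemma projective_retract P Q (i : Q -> P) (r : P -> Q) :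
  smod_hom i -> smod_hom r -> (forall v, r (i v) = v) ->
  projective A P -> projective A Q.
Proof.
move=> ih rh ri [AP lP]; split; first by apply: A_quo AP rh _ => w; exists (i w).
move=> M N f k AM AN fh fs kh.
have [k' [k'h e]] := lP M N f (fun v => k (r v)) AM AN fh fs (hom_comp rh kh).
exists (fun v => k' (i v)); split; first exact: hom_comp.
by move=> v; rewrite e ri.
Qed.

Lemma projective_prod P Q : projective A P -> projective A Q ->
  projective A (prod_smod P Q).
Proof.
move=> [AP lP] [AQ lQ]; split; first exact: A_prod.
move=> M N f k AM AN fh fs kh.
have z1 : smod_hom (fun v : P => (v, 0) : prod_smod P Q).
  apply: (@pair_hom _ _ _ P Q P id) => //; split=> //.
  + by move=> c u v; rewrite scaler0 addr0.
  + by move=> x v; rewrite smod_actE linear0.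
  + by move=> i v _; apply: smod_par0.
have z2 : smod_hom (fun v : Q => (0, v) : prod_smod P Q).
  apply: (@pair_hom _ _ _ P Q Q _ id) => //; split=> //.
  + by move=> c u v; rewrite scaler0 addr0.
  + by move=> x v; rewrite smod_actE linear0.
  + by move=> i v _; apply: smod_par0.
have [k1 [k1h e1]] := lP _ _ f (fun v => k (v, 0)) AM AN fh fs (hom_comp z1 kh).
have [k2 [k2h e2]] := lQ _ _ f (fun v => k (0, v)) AM AN fh fs (hom_comp z2 kh).
exists (fun v => k1 v.1 + k2 v.2); split.
  have := hom_lin 1 (hom_comp (fst_hom P Q) k1h) (hom_comp (snd_hom P Q) k2h).
  by congr smod_hom; apply/funext => v; rewrite scale1r.
move=> [u v] /=; rewrite (homD fh) e1 e2 -(homD kh); congr k.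
by rewrite -[LHS]/(u + 0, 0 + v) addr0 add0r.
Qed.

(** Adding [Q] to the projective cover as well leaves the syzygy unchanged. *)
Lemma pdle_prod_projective n M Q : pdle n M -> projective A Q ->
  pdle n (prod_smod M Q).
Proof.
case: n => [|n] /= pM pQ; first exact: projective_prod.
have [P [N [i [p [pP [ih ph iI ps ex] pN]]]]] := pM.
exists (prod_smod P Q), N, (fun v => (i v, 0)), (fun v => (p v.1, v.2)).
split=> //; first exact: projective_prod.
split.
- apply: pair_hom => //; split=> //.
  + by move=> c u v; rewrite scaler0 addr0.
  + by move=> x v; rewrite smod_actE linear0.
  + by move=> j v _; apply: smod_par0.
- by apply: (@pair_hom _ _ _ M Q (prod_smod P Q)); [exact: hom_comp (fst_hom P Q) ph|exact: snd_hom].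
- by move=> u v [/iI].
- by move=> [u v]; have [w <-] := ps u; exists (w, v).
- move=> [u v] /=; split.
    by case=> /ex [w <-] ->; exists w.
  by case=> w [<- <-]; congr pair; apply/ex; exists w.
Qed.

(** The cover [p] of [X] followed by [r] covers [M], and the new syzygy [KM] is a retract of [N]
    plus [P]. With [b] lifting [i \o q] through [p], the inclusion is [v |-> (b v, v)], where [b v]
    lies in [N] as [q v = 0], and the retraction is [(n, x) |-> n + (x - b x)]. *)
Lemma pdle_retract n M X (i : M -> X) (r : X -> M) :
  smod_hom i -> smod_hom r -> (forall v, r (i v) = v) -> pdle n X -> pdle n M.
Proof.
elim: n M X i r => [|n IHn] M X i r ih rh ri; first exact: projective_retract ih rh ri.
move=> /[dup] /pdle_cat AX [P [N [j [p [pP [jh ph jI ps ex] pN]]]]].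
have [AP lP] := pP.
have AM : A M by apply: (A_quo AX rh) => w; exists (i w).
pose q v := r (p v); have qh : smod_hom q by exact: hom_comp.
have qs w : exists v, q v = w.
  by have [v e] := ps (i w); exists v; rewrite /q e ri.
pose HK := ker_subsupermodule qh; pose KM := sub_smod HK.
have [b [bh eb]] := lP P X p (fun v => i (q v)) AP AX ph ps (hom_comp qh ih).
(* b covers the idempotent i \o r of X *)
have sbP (v : KM) : p (b (sub_val v)) = 0 by rewrite eb (sub_valP v) (hom0 ih).
pose s (v : KM) : N := projT1 (cid (proj1 (ex _) (sbP v))).
have sE v : j (s v) = b (sub_val v) := projT2 (cid (proj1 (ex _) (sbP v))).
have tP (z : prod_smod N P) : q (j z.1 + (z.2 - b z.2)) = 0.
  rewrite /q (homD ph) [p (j _)](proj2 (ex _)); last by exists z.1.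
  by rewrite add0r (homB ph) eb (homB rh) ri subrr.
exists P, KM, (fun v : KM => sub_val v), q; split=> //.
  split=> //.
    by move=> u v /(@sub_val_inj _ _ _ _ _ HK).
  move=> v; split; last by case=> w <-; apply: (sub_valP w).
  by move=> e; exists (subI HK e).
have sh : smod_hom s.
  split.
  - by move=> c u v; apply: jI; rewrite sE (homD jh) (homZ jh) !sE /= (homD bh) (homZ bh).
  - by move=> x v; apply: jI; rewrite sE smod_actE sub_val_act smod_actE (hom_act bh) (hom_act jh) sE.
  - by move=> e v ve; apply: (inj_hom_par jh jI); rewrite sE; apply: (hom_par bh).
apply: (IHn KM (prod_smod N P) (fun v => (s v, sub_val v)) (fun z => subI HK (tP z))).
- exact: pair_hom sh (sub_val_hom HK).
- apply: sub_lift_hom.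
  have h1 := hom_comp (fst_hom N P) jh.
  have h2 := hom_comp (snd_hom N P) bh.
  have h3 := hom_lin (-1) h2 (hom_lin 1 h1 (snd_hom N P)).
  congr smod_hom: h3; apply/funext => v.
  by rewrite scaleN1r scale1r addrC -addrA.
- by move=> v; apply: sub_val_inj; rewrite /= sE addrC subrK.
- exact: pdle_prod_projective.
Qed.

(** Supplies the zero terms of a finite resolution; the zero object lies in [A] as the image of [M]
    under multiplication by 0. *)
Lemma projective_zero M : A M -> projective A (sub_smod (zero_subsupermodule M)).
Proof.
move=> AM; pose Z := sub_smod (zero_subsupermodule M).
have zE (v : Z) : v = 0 by apply: sub_val_inj; rewrite (sub_valP v).
split.
  have z0 (v : M) : (fun v : M => v = 0) (0 *: v) by rewrite scale0r.
  apply: (@A_quo M Z (fun v => subI (zero_subsupermodule M) (z0 v)) AM).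
    apply: sub_lift_hom.
    have := hom_lin 0 (hom_id M) (hom_lin (-1) (hom_id M) (hom_id M)).
    by congr smod_hom; apply/funext => v; rewrite scaleN1r addNr addr0.
  by move=> w; exists 0; rewrite [w]zE; apply: sub_val_inj; rewrite /= scale0r.
move=> X Y f k AX AY fh fs kh; exists (fun=> 0); split.
  split; first by move=> c u v; rewrite scaler0 addr0.
    by move=> x v; rewrite smod_actE linear0.
  by move=> i v _; apply: smod_par0.
by move=> v; rewrite [v]zE (hom0 fh) (hom0 kh).
Qed.

(** A resolution of length 0 makes [e] bijective, so [M] is a retract of a projective; otherwise the
    resolution is cut at the kernel of [e], or spliced with a resolution of the syzygy. *)
Lemma proj_resolution_pdle M n : A M -> proj_resolution_le A M n <-> pdle n M.
Proof.
elim: n M => [|n IHn] M AM; split.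
- move=> [P [d [e [pP P0 [eh dh] es [ex0 _]]]]] /=.
  have eI v : e v = 0 -> v = 0.
    by case/ex0 => w <-; rewrite (P0 1%N isT w) (hom0 (dh 0%N)).
  have ei := hom_inj eh eI.
  pose r w := projT1 (cid (es w)).
  have er w : e (r w) = w := projT2 (cid (es w)).
  have re v : r (e v) = v by apply: ei; rewrite er.
  apply: (projective_retract (i := r) (r := e)) (pP 0%N) => //.
  split.
  - by move=> c u v; apply: ei; rewrite (homD eh) (homZ eh) !er.
  - by move=> x v; apply: ei; rewrite er !smod_actE (hom_act eh) er.
  - by move=> i v vi; apply: (inj_hom_par eh ei); rewrite er.
- move=> /= pM; pose Z := sub_smod (zero_subsupermodule M).
  have zE (v : Z) : v = 0 by apply: sub_val_inj; rewrite (sub_valP v).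
  pose P i : supermodule a := if i is 0%N then M else Z.
  have zh (N N' : supermodule a) : smod_hom (fun v : N => 0 : N').
    split; first by move=> c u v; rewrite scaler0 addr0.
      by move=> x v; rewrite smod_actE linear0.
    by move=> i v _; apply: smod_par0.
  exists P, (fun i => fun=> 0), id; split.
  + by case=> [|i] //=; apply: projective_zero.
  + by case.
  + by split=> // i; apply: zh.
  + by move=> w; exists w.
  + split; first by move=> v; split=> [->|[w]]; [exists 0|].
    by move=> i v; split=> // _; exists 0; rewrite [RHS]zE.
- move=> [P [d [e [pP P0 [eh dh] es [ex0 ex]]]]] /=.
  pose HK := ker_subsupermodule eh; pose N := sub_smod HK.
  exists (P 0%N), N, (fun v : N => sub_val v), e; split=> //.
    split=> //.
      by move=> u v /(@sub_val_inj _ _ _ _ _ HK).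
    move=> v; split; last by case=> w <-; apply: (sub_valP w).
    by move=> e0; exists (subI HK e0).
  have dK v : e (d 0%N v) = 0 by apply/ex0; exists v.
  have dKh := sub_lift_hom HK dK (dh 0%N).
  have dKs (w : N) : exists v, subI HK (dK v) = w.
    by have [v ev] := proj1 (ex0 _) (sub_valP w); exists v; apply: sub_val_inj.
  apply/IHn; first by apply: A_quo dKh dKs; case: (pP 1%N).
  exists (fun i => P i.+1), (fun i => d i.+1), (fun v => subI HK (dK v)); split=> //.
  + by move=> i lt_ni; apply: P0.
  + split=> //; move=> v; split=> [/(congr1 (@sub_val _ _ _ _ _ _))/ex //|h].
    by apply: sub_val_inj; apply/ex.
- move=> [P [N [i [p [pP [ih ph iI ps ex] pN]]]]].
  have [Q [d [e [pQ Q0 [eh dh] es [ex0 exd]]]]] := proj2 (IHn N (pdle_cat pN)) pN.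
  exists (fun j => if j is j'.+1 then Q j' else P).
  exists (fun j => if j is j'.+1 return (Q j -> (if j is j'.+1 then Q j' else P))
    then d j' else (fun v => i (e v))).
  exists p; split=> //.
  + by case.
  + by case=> // j; rewrite ltnS; apply: Q0.
  + by split=> //; case=> //; apply: (hom_comp eh ih).
  + split.
      move=> v; split; first by move/ex=> [w <-]; have [u <-] := es w; exists u.
      by move=> [w <-]; apply/ex; exists (e w).
    case=> // v; split; last by move/ex0=> e0; rewrite e0 (hom0 ih).
    by rewrite -[0](hom0 ih) => /iI/ex0.
Qed.

End ProjectiveDimension.

Lemma exact_functor_pdle (K : fieldType) (g g' : lieSuperalgebra K)
    (a : {vspace g}) (b : {vspace g'}) (A : supermodule a -> Prop)
    (B : supermodule b -> Prop) (F : supermodule a -> supermodule b) :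
  (forall P, projective A P -> projective B (F P)) ->
  (forall (M N P : supermodule a) (i : M -> N) (p : N -> P), ses i p ->
     exists (i' : F M -> F N) (p' : F N -> F P), ses i' p') ->
  forall n M, pdle A n M -> pdle B n (F M).
Proof.
move=> Fp Fe; elim=> [|n IHn] M /=; first exact: Fp.
move=> [P [N [i [p [pP ex pN]]]]]; have [i' [p' ex']] := Fe _ _ _ _ _ ex.
by exists (F P), (F N), i', p'; split; [exact: Fp|exact: ex'|exact: IHn].
Qed.

Lemma eq_pd (K : fieldType) (g g' : lieSuperalgebra K)
    (a : {vspace g}) (b : {vspace g'}) (A : supermodule a -> Prop)
    (B : supermodule b -> Prop) (M : supermodule a) (N : supermodule b) :
  (forall n, proj_resolution_le A M n <-> proj_resolution_le B N n) ->
  pd A M = pd B N.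
Proof.
move=> e; rewrite /pd; have -> // : proj_resolution_le A M = proj_resolution_le B N.
by apply/funext => n; apply/propext.
Qed.

(** * Alternating forms *)

Section AlternatingForms.

Variables (K : numFieldType) (Q : lmodType K) (V : lmodType K).
Implicit Types (f k : seq Q -> V).

Fact tr_key : unit. Proof. exact: tt. Qed.
(* locked because the unifier would otherwise see through function equalities *)
Definition tr (x : Q) f : seq Q -> V := locked_with tr_key (fun w => f (x :: w)).
Lemma trw x f w : tr x f w = f (x :: w). Proof. by rewrite /tr unlock. Qed.

Lemma trD x f k : tr x (f + k) = tr x f + tr x k.
Proof. by rewrite /tr !unlock. Qed.
Lemma trZ x c f : tr x (c *: f) = c *: tr x f.
Proof. by rewrite /tr !unlock. Qed.
Lemma trN x f : tr x (- f) = - tr x f.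
Proof. by rewrite /tr !unlock. Qed.
Definition trE := (trD, trZ, trN).

(** All degrees at once: a linear map from the exterior algebra of [Q] to [V], recorded by its
    values on products of letters. Antisymmetry under adjacent swaps is enough in characteristic
    zero. *)
Definition altf f : Prop :=
  (forall w c x y w', f (w ++ (c *: x + y) :: w') = c *: f (w ++ x :: w') + f (w ++ y :: w'))
  /\ (forall w x y w', f (w ++ x :: y :: w') = - f (w ++ y :: x :: w')).

Lemma altf_tr x f : altf f -> altf (tr x f).
Proof.
rewrite /tr unlock.
by case=> fl fa; split=> [w|w]; [exact: (fl (x :: w))|exact: (fa (x :: w))].
Qed.

Lemma altf_trP f c x y : altf f -> tr (c *: x + y) f = c *: tr x f + tr y f.
Proof. by case=> fl _; apply/funext => w; rewrite /tr !unlock; apply: (fl [::]). Qed.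

Lemma altf_trD f x y : altf f -> tr (x + y) f = tr x f + tr y f.
Proof. by move/altf_trP => e; rewrite -[x]scale1r e !scale1r. Qed.

Lemma altf_tr0 f : altf f -> tr 0 f = 0.
Proof. by move/altf_trD => e; apply: (addrI (tr 0 f)); rewrite -e !addr0. Qed.

Lemma altf_trZ f c x : altf f -> tr (c *: x) f = c *: tr x f.
Proof. by move=> af; rewrite -[c *: x]addr0 altf_trP // altf_tr0 // addr0. Qed.

Lemma altf_trN f x : altf f -> tr (- x) f = - tr x f.
Proof. by move=> af; rewrite -scaleN1r altf_trZ // scaleN1r. Qed.

Lemma altf_tr_sum f I r (P : pred I) (F : I -> Q) : altf f ->
  tr (\sum_(i <- r | P i) F i) f = \sum_(i <- r | P i) tr (F i) f.
Proof.
by move=> af; apply: (big_morph (fun x => tr x f)); [move=> x y; apply: altf_trD|apply: altf_tr0].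
Qed.

Lemma altf_trC f x y : altf f -> tr x (tr y f) = - tr y (tr x f).
Proof. by case=> _ fa; apply/funext => w; rewrite /tr !unlock; apply: (fa [::]). Qed.

Lemma altf_trxx f x : altf f -> tr x (tr x f) = 0.
Proof.
move=> af; apply/funext => w; have /(congr1 (fun k => k w)) := altf_trC x x af.
rewrite opprfctE => /eqP; rewrite -addr_eq0 -mulr2n -scaler_nat scaler_eq0.
by rewrite pnatr_eq0 /= => /eqP.
Qed.

(** In a class of functions stable under [tr], conditions on the first two letters propagate to
    every position. *)
Lemma altf_coind (P : (seq Q -> V) -> Prop) :
  (forall f, P f -> [/\ forall c x y, tr (c *: x + y) f = c *: tr x f + tr y f,
     forall x y, tr x (tr y f) = - tr y (tr x f) & forall x, P (tr x f)]) ->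
  forall f, P f -> altf f.
Proof.
move=> HP f Pf; split.
  move=> w; elim: w f Pf => [|u w IH] f /HP[fl _ fP] c x y w' /=.
    by have := congr1 (fun k => k w') (fl c x y); rewrite /tr !unlock.
  by have := IH _ (fP u) c x y w'; rewrite /tr !unlock.
move=> w; elim: w f Pf => [|u w IH] f /HP[_ fa fP] x y w' /=.
  by have := congr1 (fun k => k w') (fa y x); rewrite /tr !unlock.
by have := IH _ (fP u) x y w'; rewrite /tr !unlock.
Qed.

Lemma altf_lin c f k : altf f -> altf k -> altf (c *: f + k).
Proof.
move=> af ak; apply: (@altf_coind (fun k => exists f1 f2,
   [/\ altf f1, altf f2 & k = c *: f1 + f2])); last by exists f, k.
move=> _ [f1 [f2 [a1 a2 ->]]]; split.
- move=> d x y; rewrite !trE !altf_trP //; lin K (seq Q -> V).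
- move=> x y; rewrite !trE [tr x (tr y f1)]altf_trC // [tr x (tr y f2)]altf_trC //.
  lin K (seq Q -> V).
- by move=> x; exists (tr x f1), (tr x f2); split; rewrite ?trE //; exact: altf_tr.
Qed.

Lemma altf0 : altf 0.
Proof. by split=> *; rewrite ?scaler0 ?addr0 ?oppr0. Qed.

Lemma altfZ c f : altf f -> altf (c *: f).
Proof. by move=> af; rewrite -[_ *: _]addr0; apply: altf_lin => //; apply: altf0. Qed.

Lemma altfD f k : altf f -> altf k -> altf (f + k).
Proof. by move=> af ak; rewrite -[f]scale1r; apply: altf_lin. Qed.

Lemma altfN f : altf f -> altf (- f).
Proof. by rewrite -scaleN1r; apply: altfZ. Qed.

Lemma altfB f k : altf f -> altf k -> altf (f - k).
Proof. by move=> af /altfN; apply: altfD. Qed.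

(* All operators below are given by their commutation rule with [tr x]. *)
Fixpoint wrec (base : (seq Q -> V) -> V) (s : K)
  (C : Q -> (seq Q -> V) -> seq Q -> V) f w : V :=
  if w is x :: w' then s *: wrec base s C (tr x f) w' + C x f w' else base f.

Lemma tr_wrec base s C f x :
  tr x (wrec base s C f) = s *: wrec base s C (tr x f) + C x f.
Proof. by rewrite {1}/tr unlock. Qed.

Lemma wrec_linear base s C : (forall c f k, base (c *: f + k) = c *: base f + base k) ->
  (forall x, linear (C x)) -> linear (wrec base s C).
Proof.
move=> bl Cl c f k; apply/funext => w; elim: w f k => [|x w IH] f k /=.
  by rewrite bl.
rewrite !trE IH Cl !(addrfctE, scalrfctE) /=; lin K V.
Qed.

Lemma linear0fun (F : (seq Q -> V) -> seq Q -> V) : linear F -> F 0 = 0.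
Proof. by move=> Fl; have := Fl (-1) 0 0; rewrite !scaleN1r !oppr0 !addr0 addNr. Qed.
Lemma linearEfun (F : (seq Q -> V) -> seq Q -> V) : linear F ->
  [/\ forall f k, F (f + k) = F f + F k, forall c f, F (c *: f) = c *: F f
    & forall f, F (- f) = - F f].
Proof.
move=> Fl; have F0 := linear0fun Fl; split.
- by move=> f k; rewrite -[f]scale1r Fl !scale1r.
- by move=> c f; rewrite -[c *: f]addr0 Fl F0 addr0.
- by move=> f; rewrite -!scaleN1r -[-1 *: f]addr0 Fl F0 addr0.
Qed.

(** The last hypothesis is what antisymmetry in the first two letters demands: the terms in [s ^+ 2]
    are antisymmetric because [f] is, and it covers the remaining ones. *)
Lemma altf_wrec base s C :
  linear (wrec base s C) ->
  (forall x f, altf f -> altf (C x f)) ->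
  (forall f c x y, altf f -> C (c *: x + y) f = c *: C x f + C y f) ->
  (forall f x y, altf f -> s *: C x (tr y f) + tr x (C y f) =
     - (s *: C y (tr x f) + tr y (C x f))) ->
  forall f, altf f -> altf (wrec base s C f).
Proof.
move=> wl Ca Cl Cx f af.
(* Applying [tr x] to [wrec base s C f] leaves the extra alternating term [C x f], so a class stable
   under [tr] has to admit such a summand. *)
pose P F := exists d f1 f2, [/\ altf f1, altf f2 & F = d *: wrec base s C f1 + f2].
apply: (@altf_coind P); last first.
  by exists 1, f, 0; split; rewrite ?scale1r ?addr0 //; apply: altf0.
have [_ _ wN] := linearEfun wl.
move=> _ [d [f1 [f2 [a1 a2 ->]]]]; split.
- move=> c x y; rewrite !trE !tr_wrec !altf_trP // wl Cl //.
  lin K (seq Q -> V).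
- move=> x y; rewrite !(trE, tr_wrec).
  rewrite [tr x (tr y f1)]altf_trC // [tr x (tr y f2)]altf_trC // wN.
  have e : tr x (C y f1) = - (s *: C x (tr y f1)) - (s *: C y (tr x f1) + tr y (C x f1)).
    by rewrite -Cx // addrA addNr add0r.
  rewrite e; lin K (seq Q -> V).
- move=> x; exists (d * s), (tr x f1), (d *: C x f1 + tr x f2); split.
  + exact: altf_tr.
  + by apply: altf_lin; [apply: Ca|apply: altf_tr].
  + by rewrite !(trE, tr_wrec) scalerDr scalerA -addrA.
Qed.

(** The working principle for operator identities: applied to the difference of two sides, it leaves
    the empty word and the commutation with [tr x] to check. *)
Lemma op_ext (s : K) (H : (seq Q -> V) -> seq Q -> V) :
  (forall f, altf f -> H f [::] = 0) ->
  (forall f x, altf f -> tr x (H f) = s *: H (tr x f)) ->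
  forall f, altf f -> H f = 0.
Proof.
move=> H0 Hx f af; apply/funext => w; elim: w f af => [|x w IH] f af; first exact: H0.
have := congr1 (fun k => k w) (Hx f x af); rewrite trw => ->.
by rewrite scalrfctE IH ?scaler0 //; apply: altf_tr.
Qed.

(** Exterior multiplication by the linear form [phi], defined through its Leibniz rule with
    contractions. *)
Definition ext (phi : Q -> K) := wrec (fun=> 0) (-1) (fun x f => phi x *: f).

Lemma ext_linear phi : linear (ext phi).
Proof.
apply: wrec_linear => [*|x c f k]; first by rewrite scaler0 addr0.
by rewrite scalerDr !scalerA mulrC.
Qed.

Lemma extD phi f k : ext phi (f + k) = ext phi f + ext phi k.
Proof. by have [-> _ _] := linearEfun (ext_linear phi). Qed.
Lemma extZ phi c f : ext phi (c *: f) = c *: ext phi f.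
Proof. by have [_ -> _] := linearEfun (ext_linear phi). Qed.
Lemma extN phi f : ext phi (- f) = - ext phi f.
Proof. by have [_ _ ->] := linearEfun (ext_linear phi). Qed.
Definition extE := (extD, extZ, extN).

Lemma tr_ext phi x f : tr x (ext phi f) = phi x *: f - ext phi (tr x f).
Proof. by rewrite tr_wrec scaleN1r addrC. Qed.

Lemma ext_cons phi x f w : ext phi f (x :: w) = phi x *: f w - ext phi (tr x f) w.
Proof. by rewrite -trw tr_ext. Qed.

Lemma altf_ext (phi : {scalar Q}) f : altf f -> altf (ext phi f).
Proof.
apply: altf_wrec.
- exact: ext_linear.
- by move=> x k; apply: altfZ.
- by move=> k c x y ak; rewrite linearP /= scalerDl scalerA.
- by move=> k x y ak; rewrite !trE; lin K (seq Q -> V).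
Qed.

Lemma extC (phi psi : {scalar Q}) f : altf f -> ext phi (ext psi f) = - ext psi (ext phi f).
Proof.
move=> af; apply/eqP; rewrite -addr_eq0; apply/eqP.
apply: (@op_ext 1 (fun f => ext phi (ext psi f) + ext psi (ext phi f))) af => {}f.
  by move=> _; rewrite addrfctE /= add0r.
move=> x af; rewrite !(trE, tr_ext, extE).
lin K (seq Q -> V).
Qed.

End AlternatingForms.

Section PostComposition.

Variables (K : numFieldType) (Q V V' : lmodType K) (u : V -> V').
Hypothesis ul : linear u.

Implicit Type f : seq Q -> V.

Definition post f : seq Q -> V' := fun w => u (f w).

Lemma tr_post x f : tr x (post f) = post (tr x f).
Proof. by apply/funext => w; rewrite /post !trw. Qed.

Lemma altf_post f : altf f -> altf (post f).
Proof.
by case=> fl fa; split=> *; rewrite /post ?fl ?ul // fa (linNf ul).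
Qed.

Lemma ext_post phi f : ext phi (post f) = post (ext phi f).
Proof.
apply/funext => w; elim: w f => [|x w IH] f; first by rewrite /post /= (lin0f ul).
by rewrite /post !ext_cons tr_post IH /post (linDf ul) (linNf ul) (linZf ul).
Qed.

End PostComposition.

(** * Annihilation and creation operators on alternating forms *)

Section Fock.

Variables (K : numFieldType) (Q : vectType K) (V : lmodType K).
Implicit Types (f k : seq Q -> V) (n : V).

Notation m := (\dim {:Q}).
Implicit Types (i j : 'I_m) (l : seq 'I_m).

Definition mode i : Q := (vbasis {:Q})`_i.
(** Contraction with a basis vector; [cre] multiplies by the dual coordinate, and [ann_cre] is their
    canonical anticommutation relation. *)
Definition ann i f := tr (mode i) f.
Definition cre i f := ext (coord (vbasis {:Q}) i) f.

Lemma coord_mode i j : coord (vbasis {:Q}) i (mode j) = (i == j)%:R.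
Proof. by rewrite /mode coord_free ?(basis_free (vbasisP _)) // eq_sym. Qed.

Lemma sum_mode x : x = \sum_i coord (vbasis {:Q}) i x *: mode i.
Proof. by rewrite {1}(coord_vbasis (memvf x)). Qed.

Lemma annC i j f : altf f -> ann i (ann j f) = - ann j (ann i f).
Proof. exact: altf_trC. Qed.
Lemma annK i f : altf f -> ann i (ann i f) = 0.
Proof. exact: altf_trxx. Qed.
Lemma creC i j f : altf f -> cre i (cre j f) = - cre j (cre i f).
Proof. exact: extC. Qed.
Lemma creK i f : altf f -> cre i (cre i f) = 0.
Proof.
move=> af; apply/funext => w; have /(congr1 (fun k => k w)) := creC i i af.
rewrite opprfctE => /eqP; rewrite -addr_eq0 -mulr2n -scaler_nat scaler_eq0.
by rewrite pnatr_eq0 /= => /eqP.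
Qed.
Lemma ann_cre i j f : ann i (cre j f) = (i == j)%:R *: f - cre j (ann i f).
Proof. by rewrite /ann /cre tr_ext coord_mode eq_sym. Qed.
Lemma altf_ann i f : altf f -> altf (ann i f). Proof. exact: altf_tr. Qed.
Lemma altf_cre i f : altf f -> altf (cre i f). Proof. exact: altf_ext. Qed.
Hint Resolve altf_ann altf_cre : core.
Lemma ann0 i : ann i 0 = 0.
Proof. by rewrite /ann -[X in tr _ X](scale0r 0) trZ scale0r. Qed.
Lemma creN i f : cre i (- f) = - cre i f. Proof. exact: extN. Qed.
Lemma cre0 i : cre i 0 = 0. Proof. by rewrite /cre (linear0fun (ext_linear _)). Qed.

Lemma ann_cre_split i f : f = cre i (ann i f) + ann i (cre i f).
Proof. by rewrite ann_cre eqxx scale1r addrC subrK. Qed.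

Definition vac n : seq Q -> V := fun w => if w is [::] then n else 0.

Lemma tr_vac x n : tr x (vac n) = 0.
Proof. by apply/funext => w; rewrite trw. Qed.

Lemma altf_vac n : altf (vac n).
Proof. by split=> [[|? ?] *|[|? ?] *]; rewrite /= ?scaler0 ?addr0 ?oppr0. Qed.
Hint Resolve altf_vac : core.

Lemma altf_vacE f : altf f -> (forall i, ann i f = 0) -> f = vac (f [::]).
Proof.
move=> af f0; apply/funext => -[|x w] //=; rewrite -trw [x]sum_mode altf_tr_sum //.
rewrite big1 // => i _; rewrite altf_trZ //.
by rewrite -[tr _ f]/(ann i f) f0 scaler0.
Qed.

(** Every form arises from degree 0 by creation. The list [l] holds the modes that may still occur
    in [f]; [ann_cre_split] removes one of them, since both [ann i f] and [ann i (cre i f)] are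
    killed by [ann i]. *)
Lemma fock_vac_ind (Z : (seq Q -> V) -> Prop) :
  (forall f k, Z f -> Z k -> Z (f + k)) -> (forall n, Z (vac n)) ->
  (forall i f, altf f -> Z f -> Z (cre i f)) -> forall f, altf f -> Z f.
Proof.
move=> ZD Zv Zc f af.
suff H l : forall f, altf f -> (forall i, i \notin l -> ann i f = 0) -> Z f.
  by apply: (H (enum 'I_m)) => // i; rewrite mem_enum.
elim: l => [|i l IH] {af}f af f0; first by rewrite (altf_vacE af) // => i; apply: f0.
rewrite (ann_cre_split i f); apply: ZD; [apply: Zc; first by auto|].
- apply: IH; auto => j jl; have [->|ji] := eqVneq j i; first exact: annK.
  by rewrite annC // f0 ?ann0 ?oppr0 // inE negb_or ji.
- apply: IH; auto => j jl; have [->|ji] := eqVneq j i; first by rewrite annK; auto.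
  by rewrite annC; auto; rewrite ann_cre (negPf ji) scale0r sub0r f0 ?cre0 ?oppr0 ?ann0 ?oppr0 // inE negb_or ji.
Qed.

(* [topf n] is the form of top degree with coefficient [n], and [topv] reads off
   the top coefficient. *)
Definition topf_rec l n := foldr cre (vac n) l.
Definition topf n := topf_rec (enum 'I_m) n.

Fixpoint topv_rec l f : V := if l is i :: l' then topv_rec l' (ann i f) else f [::].
Definition topv f := topv_rec (enum 'I_m) f.

Lemma altf_topf_rec l n : altf (topf_rec l n).
Proof. by elim: l => //= i l; auto. Qed.
Lemma altf_topf n : altf (topf n). Proof. exact: altf_topf_rec. Qed.
Hint Resolve altf_topf : core.

Lemma ann_topf_rec i l n : i \notin l -> ann i (topf_rec l n) = 0.
Proof.
elim: l => [|j l IH] /=; first by move=> _; rewrite /ann tr_vac.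
by rewrite inE negb_or => /andP[/negPf ij /IH e]; rewrite ann_cre ij scale0r e cre0 subrr.
Qed.

Lemma topfK : cancel topf topv.
Proof.
move=> n; rewrite /topv /topf; elim: (enum 'I_m) (enum_uniq 'I_m) => //= i l IH /andP[il /IH e].
by rewrite ann_cre eqxx scale1r ann_topf_rec // cre0 subr0.
Qed.

Definition homog d f := forall w, size w != d -> f w = 0.

Lemma homog_cre i d f : homog d f -> homog d.+1 (cre i f).
Proof.
move=> fd w; rewrite /cre; elim: w d f fd => [|x w IH] d f fd //= sw.
rewrite ext_cons [f w]fd // scaler0 sub0r.
case: d fd sw => [|d] fd sw.
  have -> : tr x f = 0 by apply/funext => w'; rewrite trw fd.
  by rewrite (linear0fun (ext_linear _)) oppr0.
by rewrite (IH d) ?oppr0 // => w' sw'; rewrite trw fd.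
Qed.

Lemma homog_topf n : homog m (topf n).
Proof.
have : homog (size (enum 'I_m)) (topf n).
  rewrite /topf; elim: (enum 'I_m) => [|i l IH] /=; first by case.
  exact: homog_cre.
by rewrite size_enum_ord.
Qed.

(** From [cre i f = 0] follows [f = cre i (ann i f)], so the modes of [l] can be peeled off one
    after the other. *)
Lemma topf_recE l f : altf f -> uniq l -> (forall i, i \in l -> cre i f = 0) ->
  (forall i, i \notin l -> ann i f = 0) -> f = topf_rec l (topv_rec l f).
Proof.
elim: l f => [|i l IH] f af /=; first by move=> _ _ f0; apply: altf_vacE => // i; apply: f0.
move=> /andP[il lu] fc fa; rewrite -IH //; auto.
- by rewrite {1}(ann_cre_split i f) (fc i) ?mem_head // ann0 addr0.
- move=> j jl; have ji : i != j by apply: contraNneq il => ->.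
  have := ann_cre i j f; rewrite (negPf ji) fc ?inE ?jl ?orbT // ann0 scale0r sub0r.
  by move/esym/eqP; rewrite oppr_eq0 => /eqP.
- move=> j jl; have [->|ji] := eqVneq j i; first exact: annK.
  by rewrite annC // fa ?ann0 ?oppr0 // inE negb_or ji.
Qed.

(** The dual of [fock_vac_ind] with the two kinds of operators exchanged, possible because [Q] has
    finite dimension. Generation from the top forms by contraction is what makes a coinduced module
    induced. *)
Lemma fock_top_ind (Z : (seq Q -> V) -> Prop) :
  (forall f k, Z f -> Z k -> Z (f + k)) -> (forall n, Z (topf n)) ->
  (forall i f, altf f -> Z f -> Z (ann i f)) -> forall f, altf f -> Z f.
Proof.
move=> ZD Zv Za f af.
suff H l : forall f, altf f -> (forall i, i \notin l -> cre i f = 0) -> Z f.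
  by apply: (H (enum 'I_m)) => // i; rewrite mem_enum.
elim: l => [|i l IH] {af}f af f0.
  have -> : f = topf (topv f); last exact: Zv.
  apply: topf_recE; rewrite ?enum_uniq // => i; last by rewrite mem_enum.
  by move=> _; apply: f0.
rewrite (ann_cre_split i f) addrC; apply: ZD; [apply: Za; first by auto|].
- apply: IH; auto => j jl; have [->|ji] := eqVneq j i; first exact: creK.
  by rewrite creC // f0 ?cre0 ?oppr0 // inE negb_or ji.
- apply: IH; auto => j jl; have [->|ji] := eqVneq j i; first by rewrite creK; auto.
  rewrite creC; auto; have := ann_cre i j f.
  rewrite eq_sym (negPf ji) scale0r sub0r f0 ?inE ?negb_or ?ji // ann0 => /esym/eqP.
  by rewrite oppr_eq0 => /eqP->; rewrite cre0 oppr0.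
Qed.

(** Top forms are concentrated in degree [m], and contraction lowers the degree. *)
Lemma altf_long f w : altf f -> (m < size w)%N -> f w = 0.
Proof.
move=> af; move: f af w; apply: fock_top_ind.
- by move=> f k Zf Zk w sw; rewrite addrfctE Zf ?Zk ?addr0.
- by move=> n w sw; rewrite homog_topf // gtn_eqF.
- by move=> i f af Zf w sw; rewrite /ann trw Zf //=; apply: ltnW.
Qed.

Lemma cre_homog_top i f : altf f -> homog m f -> cre i f = 0.
Proof.
move=> af fm; apply/funext => w; have [e|ne] := eqVneq (size w) m.+1.
  by rewrite altf_long ?e //; auto.
by rewrite (homog_cre _ fm).
Qed.

Lemma homog_topE f : altf f -> homog m f -> f = topf (topv f).
Proof.
move=> af fm; apply: topf_recE; rewrite ?enum_uniq //.
  by move=> i _; apply: cre_homog_top.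
by move=> i; rewrite mem_enum.
Qed.

Lemma cre_topf i n : cre i (topf n) = 0.
Proof. by apply: cre_homog_top; [auto|exact: homog_topf]. Qed.

Lemma cre_ann_topf i n : cre i (ann i (topf n)) = topf n.
Proof. by rewrite [RHS](ann_cre_split i) cre_topf ann0 addr0. Qed.

Section Integration.

Variables (X : lmodType K) (y : 'I_m -> X -> X) (phi : V -> X).
Hypotheses (yl : forall i, linear (y i)) (pl : linear phi).
Hypothesis yC : forall i j x, y i (y j x) = - y j (y i x).

(* the linear map given by [phi] on top forms and intertwining [ann i] with
   [y i] *)
Fixpoint fint_rec l f : X :=
  if l is i :: l' then fint_rec l' (cre i (ann i f)) + y i (fint_rec l' (cre i f))
  else phi (topv f).
Definition fint f := fint_rec (enum 'I_m) f.

Lemma yK i x : y i (y i x) = 0.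
Proof.
have /eqP := yC i i x; rewrite -addr_eq0 -mulr2n -scaler_nat scaler_eq0.
by rewrite pnatr_eq0 /= => /eqP.
Qed.

Lemma topv_linear c f k : topv (c *: f + k) = c *: topv f + topv k.
Proof.
rewrite /topv; elim: (enum 'I_m) f k => //= i l IH f k.
by rewrite /ann !trE IH.
Qed.

Lemma fint_linear : linear fint.
Proof.
move=> c f k; rewrite /fint; elim: (enum 'I_m) f k => [|i l IH] f k /=.
  by rewrite topv_linear pl.
rewrite /ann /cre !(trE, extE) !IH !yl.
by lin K X.
Qed.

Lemma fint_topf n : fint (topf n) = phi n.
Proof.
rewrite /fint; elim: (enum 'I_m) => /= [|i l IH]; first by rewrite topfK.
have f0 l' : fint_rec l' 0 = 0.
  elim: l' => /= [|j l' IH']; last by rewrite ann0 cre0 IH' (lin0f (yl j)) addr0.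
  by rewrite (lin0f topv_linear) (lin0f pl).
by rewrite cre_topf f0 (lin0f (yl i)) addr0 cre_ann_topf.
Qed.

(** At the mode [i] itself both sides collapse because [ann i] and [y i] have square zero; at the
    other modes the signs from the two anticommutations cancel. *)
Lemma fint_ann i f : altf f -> fint (ann i f) = y i (fint f).
Proof.
rewrite /fint; have := mem_enum 'I_m i; rewrite inE.
elim: (enum 'I_m) (enum_uniq 'I_m) f => //= j l IH /andP[jl lu] f + af.
have fl l' c f1 f2 : fint_rec l' (c *: f1 + f2) = c *: fint_rec l' f1 + fint_rec l' f2.
  elim: l' f1 f2 => [|k l' IH'] f1 f2 /=; first by rewrite topv_linear pl.
  by rewrite /ann /cre !(trE, extE) !IH' !yl; lin K X.
have f0 l' : fint_rec l' 0 = 0 := lin0f (fl l').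
have fN l' f1 : fint_rec l' (- f1) = - fint_rec l' f1 := linNf (fl l') f1.
rewrite inE; have [->|ij] /= := eqVneq i j => [_|il].
  rewrite annK // cre0 f0 add0r (linDf (yl j)) yK addr0.
  by [].
have e1 : cre j (ann j (ann i f)) = ann i (cre j (ann j f)).
  rewrite ann_cre (negPf ij) scale0r sub0r annC // creN.
  by [].
have e2 : cre j (ann i f) = - ann i (cre j f).
  by rewrite ann_cre (negPf ij) scale0r sub0r opprK.
rewrite e1 e2 fN !IH; auto.
by rewrite (linNf (yl j)) yC opprK (linDf (yl i)).
Qed.

End Integration.

End Fock.

(** * Brackets, restriction and twisting *)

Section LieSuperalgebras.

Variables (K : fieldType) (g : lieSuperalgebra K).
Implicit Types (x y z : g) (U V W : {vspace g}).
Local Notation br := (@lsa_br K g).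

Lemma br_linl y : linear (br^~ y). Proof. exact: lsa_brDl. Qed.
Lemma br_linr x : linear (br x). Proof. exact: lsa_brDr. Qed.
Lemma brDl x y z : br (x + y) z = br x z + br y z.
Proof. exact: (linDf (br_linl z)). Qed.
Lemma brDr x y z : br x (y + z) = br x y + br x z.
Proof. exact: (linDf (br_linr x)). Qed.
Lemma brZl c x y : br (c *: x) y = c *: br x y.
Proof. exact: (linZf (br_linl y)). Qed.
Lemma brZr c x y : br x (c *: y) = c *: br x y.
Proof. exact: (linZf (br_linr x)). Qed.
Lemma brNl x y : br (- x) y = - br x y.
Proof. exact: (linNf (br_linl y)). Qed.
Lemma brNr x y : br x (- y) = - br x y.
Proof. exact: (linNf (br_linr x)). Qed.
Lemma br0l y : br 0 y = 0. Proof. exact: (lin0f (br_linl y)). Qed.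
Lemma br0r x : br x 0 = 0. Proof. exact: (lin0f (br_linr x)). Qed.
Lemma br_suml I r (P : pred I) (F : I -> g) y :
  br (\sum_(i <- r | P i) F i) y = \sum_(i <- r | P i) br (F i) y.
Proof. by apply: (big_morph (br^~ y)); [move=> u v; apply: brDl|apply: br0l]. Qed.
Lemma br_sumr I r (P : pred I) (F : I -> g) x :
  br x (\sum_(i <- r | P i) F i) = \sum_(i <- r | P i) br x (F i).
Proof. by apply: (big_morph (br x)); [move=> u v; apply: brDr|apply: br0r]. Qed.
Definition brE := (brDl, brDr, brZl, brZr, brNl, brNr, br0l, br0r).

Lemma adE x y : ad x y = br x y.
Proof.
pose f : {linear g -> g} := HB.pack (br x) (GRing.isLinear.Build K g g _ (br x) (br_linr x)).
exact: (lfunE f).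
Qed.

Lemma brvP U V W :
  (brv U V <= W)%VS <-> (forall x y, x \in U -> y \in V -> br x y \in W).
Proof.
split=> [/subvP h x y xU yV|h].
  rewrite (coord_vbasis xU) (coord_vbasis yV) br_suml.
  apply: memv_suml => i _; rewrite br_sumr; apply: memv_suml => j _.
  rewrite brZl brZr !memvZ //; apply/h/memv_span/allpairsP.
  by exists ((vbasis U)`_i, (vbasis V)`_j); split=> //; apply: mem_nth; rewrite size_tuple.
apply/span_subvP => _ /allpairsP[[x y] /= [xU yV ->]].
by apply: h; apply: vbasis_mem.
Qed.

Lemma mem_brv U V x y : x \in U -> y \in V -> br x y \in brv U V.
Proof. by move: x y; apply/brvP. Qed.

Lemma evenI x : exists x0 x1, [/\ x0 \in even_part g, x1 \in odd_part g & x = x0 + x1].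
Proof.
have : x \in (even_part g + odd_part g)%VS by rewrite /even_part /odd_part lsa_full memvf.
by case/memv_addP => x0 x0e [x1 x1o ->]; exists x0, x1.
Qed.

Lemma even_der x y z : x \in even_part g -> br x (br y z) = br (br x y) z + br y (br x z).
Proof.
move=> xe; have [y0 [y1 [y0e y1o ->]]] := evenI y.
rewrite !brE (lsa_jacobi z xe y0e) (lsa_jacobi z xe y1o) !expr0 !scale1r.
by lin K g.
Qed.

Lemma br_even_skew x y : x \in even_part g -> br x y = - br y x.
Proof.
move=> xe; have [y0 [y1 [y0e y1o ->]]] := evenI y.
by rewrite !brE (lsa_skew xe y0e) (lsa_skew xe y1o) !expr0 !scale1r opprD.
Qed.

Lemma br_odd_sym x y : x \in odd_part g -> y \in odd_part g -> br x y = br y x.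
Proof. by move=> xo yo; rewrite (lsa_skew xo yo) expr1 scaleN1r opprK. Qed.

Lemma odd_jacobi x y z : x \in odd_part g -> y \in odd_part g ->
  br x (br y z) = br (br x y) z - br y (br x z).
Proof. by move=> xo yo; rewrite (lsa_jacobi z xo yo) expr1 scaleN1r. Qed.

Lemma br_ee x y : x \in even_part g -> y \in even_part g -> br x y \in even_part g.
Proof. exact: lsa_graded. Qed.
Lemma br_eo x y : x \in even_part g -> y \in odd_part g -> br x y \in odd_part g.
Proof. exact: lsa_graded. Qed.
Lemma br_oo x y : x \in odd_part g -> y \in odd_part g -> br x y \in even_part g.
Proof. exact: lsa_graded. Qed.

Lemma even_odd0 x : x \in even_part g -> x \in odd_part g -> x = 0.
Proof.
move=> xe xo; have : x \in (even_part g :&: odd_part g)%VS by rewrite memv_cap xe.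
by rewrite /even_part /odd_part lsa_direct memv0 => /eqP.
Qed.

Lemma daddv_pi0 (vT : vectType K) (U V : {vspace vT}) (x : vT) : (U :&: V = 0)%VS -> x \in V -> daddv_pi U V x = 0.
Proof.
move=> UV xV; have xUV : x \in (U + V)%VS by apply: (subvP (addvSr U V)).
have := daddv_pi_add UV xUV; rewrite (daddv_pi_id _ xV) 1?capvC //.
by move=> e; apply: (addIr x); rewrite e add0r.
Qed.

Definition pr0 : 'End(g) := daddv_pi (even_part g) (odd_part g).
Definition pro : 'End(g) := daddv_pi (odd_part g) (even_part g).

Lemma pr0_mem x : pr0 x \in even_part g. Proof. exact: memv_pi. Qed.
Lemma pro_mem x : pro x \in odd_part g. Proof. exact: memv_pi. Qed.
Lemma pr0_even x : x \in even_part g -> pr0 x = x.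
Proof. by apply: daddv_pi_id; apply: lsa_direct. Qed.
Lemma pr0_odd x : x \in odd_part g -> pr0 x = 0.
Proof. by apply: daddv_pi0; apply: lsa_direct. Qed.
Lemma pro_odd x : x \in odd_part g -> pro x = x.
Proof. by apply: daddv_pi_id; rewrite capvC; apply: lsa_direct. Qed.
Lemma pro_even x : x \in even_part g -> pro x = 0.
Proof. by apply: daddv_pi0; rewrite capvC; apply: lsa_direct. Qed.
Lemma pr0_pro x : x = pr0 x + pro x.
Proof.
have [x0 [x1 [e o {1 2 3}->]]] := evenI x; rewrite !linearD /=.
by rewrite pr0_even // pr0_odd // pro_even // pro_odd // addr0 add0r.
Qed.

End LieSuperalgebras.

Section RestrictionTwist.

Variables (K : fieldType) (g : lieSuperalgebra K).
Implicit Types (a b : {vspace g}).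
Local Notation br := (@lsa_br K g).
Local Notation pr0 := (pr0 g).
Local Notation pro := (pro g).

Definition subalgebra b := forall x y, x \in b -> y \in b -> br x y \in b.
Definition graded b := forall x, x \in b -> pr0 x \in b.

(** A graded subalgebra contains the even and the odd component of each of its elements, so these
    may be treated apart. *)
Lemma hom_homog a (M N : supermodule a) (f : M -> N) : graded a -> linear f ->
  (forall i v, smod_par i v -> smod_par i (f v)) ->
  (forall x v, x \in a -> x \in even_part g -> f (act x v) = act x (f v)) ->
  (forall x v, x \in a -> x \in odd_part g -> f (act x v) = act x (f v)) ->
  smod_hom f.
Proof.
move=> ga fl fp fe fo; split=> // x v; rewrite !smod_actE.
have xa : vsval x \in a by exact: subvsP.
have p0 := ga _ xa; have po : pro (vsval x) \in a.
  have -> : pro (vsval x) = vsval x - pr0 (vsval x).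
    by rewrite [X in X - _]pr0_pro addrAC subrr add0r.
  exact: memvB.
rewrite (pr0_pro (vsval x)) !actDl (linDf fl) fe ?pr0_mem // fo ?pro_mem //.
Qed.

Section Restriction.

Variables (a b : {vspace g}) (bs : subalgebra b) (ba : (b <= a)%VS).
Variable M : supermodule a.

Let bI (x : subvs_of b) : vsval x \in a. Proof. exact: subvP ba _ (subvsP x). Qed.

Program Definition res_smod : supermodule b :=
  @Supermodule K g b M (fun x v => act (vsval x) v) (@smod_par K g a M)
   _ _ _ _ _ _ _ _.
Next Obligation. by move=> v c x y; rewrite linearP actDl actZl. Qed.
Next Obligation. by move=> x c u v; rewrite linearP. Qed.
Next Obligation. by move=> i; apply: smod_par0. Qed.
Next Obligation. by move=> i c u v; apply: smod_parD. Qed.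
Next Obligation. exact: smod_full. Qed.
Next Obligation. by move=> v; apply: smod_direct. Qed.
Next Obligation. by move=> i j x v xi vj; apply: act_graded. Qed.
Next Obligation.
by move=> i j x y v xi yj /=; rewrite vsprojK ?(act_br _ _ _ xi yj) //; apply: bs; apply: subvsP.
Qed.

Lemma res_act x (v : M) : x \in b -> act x (v : res_smod) = act x v.
Proof. by move=> xb; rewrite {1}/act /= vsprojK. Qed.

End Restriction.

Section Twist.

Variables (a : {vspace g}) (chi : g -> K) (e : K) (d : bool).
Hypothesis chil : forall c x y, chi (c *: x + y) = c * chi x + chi y.
Hypothesis chi0 : forall i x y, x \in a -> y \in a ->
  x \in lsa_par g i -> y \in lsa_par g i -> chi (br x y) = 0.
Hypothesis ee : e * e = 1.
Hypothesis sa : subalgebra a.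
Variable M : supermodule a.

(** Tensoring with a one-dimensional module: a character on the even part and a sign on the odd
    part. The sign [e] and the parity [d] are kept independent, so that the plain parity shift is
    included. *)
Definition tw_act x (v : M) : M := act (pr0 x + e *: pro x) v + chi (pr0 x) *: v.

Lemma chi_0 : chi 0 = 0.
Proof. by have := chil (-1) 0 0; rewrite scaler0 addr0 mulN1r addNr. Qed.

Lemma tw_even x v : x \in even_part g -> tw_act x v = act x v + chi x *: v.
Proof. by move=> xe; rewrite /tw_act pr0_even // pro_even // scaler0 addr0. Qed.
Lemma tw_odd x v : x \in odd_part g -> tw_act x v = e *: act x v.
Proof.
by move=> xo; rewrite /tw_act pr0_odd // pro_odd // chi_0 scale0r addr0 add0r actZl.
Qed.

Lemma tw_linl v : linear (fun x => tw_act x v).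
Proof.
move=> c x y; rewrite /tw_act [pr0 _]linearP [pro _]linearP.
rewrite chil.
by rewrite /= !(actDl, actZl); lin K M.
Qed.

Program Definition twist_smod : supermodule a :=
  @Supermodule K g a M (fun x v => tw_act (vsval x) v) (fun i v => smod_par (i (+) d) v)
   _ _ _ _ _ _ _ _.
Next Obligation. by move=> v c x y; rewrite linearP tw_linl. Qed.
Next Obligation. by move=> x c u v; rewrite /tw_act linearP /=; lin K M. Qed.
Next Obligation. by move=> i; apply: smod_par0. Qed.
Next Obligation. by move=> i c u v; apply: smod_parD. Qed.
Next Obligation.
move=> v; have [v0 [v1 [e0 e1 ->]]] := smod_full v.
by case: d; [exists v1, v0; rewrite addrC|exists v0, v1].
Qed.
Next Obligation.
by move=> v; case: d => h1 h2; apply: smod_direct.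
Qed.
Next Obligation.
move=> i j x v xi vj; have := act_graded (subvsP x) xi vj; rewrite addbA.
case: i xi => xi h; first by rewrite tw_odd //; apply: smod_parZ.
by rewrite tw_even //; apply: smod_parA; last exact: smod_parZ.
Qed.
Next Obligation.
move=> i j x y v xi yj /=.
have xa := subvsP x; have ya := subvsP y.
have := act_br v xa ya xi yj; rewrite vsprojK ?sa //.
have := chi0 xa ya; case: i xi => xi; case: j yj => yj c0 h.
- rewrite (tw_even _ (br_oo xi yj)) h (c0 true) // scale0r addr0.
  rewrite !(tw_odd _ xi, tw_odd _ yj) !linearZ /=.
  have eE (u : M) : e *: (e *: u) = u by rewrite scalerA ee scale1r.
  by rewrite !eE.
- rewrite (tw_odd _ (lsa_graded xi yj : br _ _ \in lsa_par g true)) h.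
  by rewrite !(tw_odd _ xi, tw_even _ yj) !(linearD, linearZ) /= expr0; lin K M.
- rewrite (tw_odd _ (br_eo xi yj)) h.
  by rewrite !(tw_odd _ yj, tw_even _ xi) !(linearD, linearZ) /= expr0; lin K M.
- rewrite (tw_even _ (br_ee xi yj)) h (c0 false) // scale0r addr0.
  by rewrite !(tw_even _ xi, tw_even _ yj) !(linearD, linearZ) /= expr0; lin K M.
Qed.

Lemma twist_even x (v : M) : x \in a -> x \in even_part g ->
  act x (v : twist_smod) = act x v + chi x *: v.
Proof. by move=> xa xe; rewrite {1}/act /= vsprojK // tw_even. Qed.
Lemma twist_odd x (v : M) : x \in a -> x \in odd_part g ->
  act x (v : twist_smod) = e *: act x v.
Proof. by move=> xa xo; rewrite {1}/act /= vsprojK // tw_odd. Qed.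

End Twist.
End RestrictionTwist.

Section ParityProjection.

Variables (K : fieldType) (g : lieSuperalgebra K) (a : {vspace g}).
Variables (M : supermodule a).

Definition ppr0 (v : M) : M := projT1 (cid (smod_full v)).
Definition ppr (i : bool) (v : M) : M := if i then v - ppr0 v else ppr0 v.

Lemma ppr_spec (v : M) : [/\ smod_par false (ppr0 v), smod_par true (v - ppr0 v)
  & v = ppr0 v + (v - ppr0 v)].
Proof.
rewrite /ppr0; case: cid => v0 /= [v1 [e0 e1 ->]].
by have -> : v0 + v1 - v0 = v1 by rewrite addrAC subrr add0r.
Qed.

Lemma ppr_par i v : smod_par i (ppr i v).
Proof. by have [] := ppr_spec v; case: i. Qed.

Lemma ppr_add v : v = ppr false v + ppr true v.
Proof. by have [] := ppr_spec v. Qed.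

Lemma ppr_uniq v v0 v1 : smod_par false v0 -> smod_par true v1 -> v = v0 + v1 ->
  forall i, ppr i v = if i then v1 else v0.
Proof.
move=> e0 e1 e; have [] := smod_par_uniq (ppr_par false v) (ppr_par true v) e0 e1.
  by rewrite -ppr_add.
by move=> f0 f1; case.
Qed.

Lemma ppr_linear i : linear (ppr i).
Proof.
move=> c u v; rewrite (@ppr_uniq _ (c *: ppr false u + ppr false v) (c *: ppr true u + ppr true v)).
- by case: i.
- by apply: smod_parD; apply: ppr_par.
- by apply: smod_parD; apply: ppr_par.
- by rewrite {1}(ppr_add u) {1}(ppr_add v); lin K M.
Qed.

Lemma ppr_id i v : smod_par i v -> forall j, ppr j v = if i == j then v else 0.
Proof.
move=> vi j; case: i vi => vi.
  by rewrite (@ppr_uniq v 0 v) ?add0r //; do ?[exact: smod_par0|by case: j].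
by rewrite (@ppr_uniq v v 0) ?addr0 //; do ?[exact: smod_par0|by case: j].
Qed.

End ParityProjection.

Section DerivationOnForms.

Variables (K : numFieldType) (g : lieSuperalgebra K) (q : {vspace g}).
Hypothesis eq_q : forall x y, x \in even_part g -> y \in q -> lsa_br x y \in q.

Local Notation br := (@lsa_br K g).
Local Notation Q := (subvs_of q).

Definition adq (z : g) (x : Q) : Q := vsproj q (br z (vsval x)).

Lemma adq_linr z : linear (adq z).
Proof. by move=> c x y; rewrite /adq linearP !brE linearP. Qed.
Lemma adq_linl x : linear (adq^~ x).
Proof. by move=> c z z'; rewrite /adq !brE linearP. Qed.
Lemma adqE z x : z \in even_part g -> vsval (adq z x) = br z (vsval x).
Proof. by move=> ze; rewrite /adq vsprojK // eq_q // subvsP. Qed.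
Lemma adq_br z z' x : z \in even_part g -> z' \in even_part g ->
  adq (br z z') x = adq z (adq z' x) - adq z' (adq z x).
Proof.
move=> ze z'e; apply: subvs_inj; rewrite linearB /= !adqE ?br_ee //.
by rewrite [in RHS](even_der _ _ ze) addrK.
Qed.

Section Values.

Variable V : lmodType K.
Implicit Type f : seq Q -> V.

(** The sum over all positions of the value of [f] with that letter replaced by its bracket with
    [z]. *)
Definition dform z f := wrec (fun=> 0) 1 (fun x f => tr (adq z x) f) f.

Lemma dform_linear z : linear (dform z).
Proof.
apply: wrec_linear => [*|x c f k]; first by rewrite scaler0 addr0.
by rewrite !trE.
Qed.

Lemma tr_dform x z f : tr x (dform z f) = dform z (tr x f) + tr (adq z x) f.
Proof. by rewrite tr_wrec scale1r. Qed.

Lemma dform_cons z x w f : dform z f (x :: w) = dform z (tr x f) w + f (adq z x :: w).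
Proof. by rewrite /dform /= scale1r trw. Qed.

Lemma altf_dform z f : altf f -> altf (dform z f).
Proof.
apply: altf_wrec.
- exact: dform_linear.
- by move=> x k; apply: altf_tr.
- by move=> k c x y ak; rewrite (adq_linr z) altf_trP.
- move=> k x y ak; rewrite !scale1r [tr x (tr (adq z y) k)]altf_trC //.
  by rewrite [tr (adq z x) (tr y k)]altf_trC // opprD addrC.
Qed.

Lemma dform_linl c z z' f : altf f -> dform (c *: z + z') f = c *: dform z f + dform z' f.
Proof.
have [D1 Z1 N1] := linearEfun (dform_linear (c *: z + z')).
have [D2 Z2 N2] := linearEfun (dform_linear z).
have [D3 Z3 N3] := linearEfun (dform_linear z').
move=> af; apply/eqP; rewrite -subr_eq0; apply/eqP.
apply: (@op_ext _ _ _ 1 (fun f => dform (c *: z + z') f - (c *: dform z f + dform z' f))) af => {}f.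
  by move=> _; rewrite !(addrfctE, opprfctE, scalrfctE) /= scaler0 addr0 subrr.
move=> x af; rewrite !(trE, tr_dform) adq_linl altf_trP //.
by lin K (seq Q -> V).
Qed.

Lemma homog_dform d z f : homog d f -> homog d (dform z f).
Proof.
move=> fd w; elim: w d f fd => [|x w IH] d f fd //= sw.
rewrite dform_cons [f _]fd // addr0; case: d fd sw => [|d] fd sw.
  have -> : tr x f = 0 by apply/funext => w'; rewrite trw fd.
  by rewrite (linear0fun (dform_linear z)).
by apply: (IH d) => // w' sw'; rewrite trw fd.
Qed.

End Values.

Lemma dform_post (V V' : lmodType K) (u : V -> V') z (f : seq Q -> V) : linear u ->
  dform z (post u f) = post u (dform z f).
Proof.
move=> ul; apply/funext => w; elim: w f => [|x w IH] f; first by rewrite /post /= (lin0f ul).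
by rewrite {2}/post !dform_cons tr_post IH /post (linDf ul).
Qed.

End DerivationOnForms.

(** Covers both enlargements: [b1 = 0], [q = gm] over the even part, then [b1 = gm], [q = gp]. The
    brackets of [b1] with [q] are even for parity reasons and need no condition. *)
Record stage (K : fieldType) (g : lieSuperalgebra K) (b1 q b a : {vspace g}) : Prop :=
Stage {
  st_b : b = (even_part g + b1)%VS;
  st_a : a = (b + q)%VS;
  st_b1 : (b1 <= odd_part g)%VS;
  st_q : (q <= odd_part g)%VS;
  st_cap : (b1 :&: q = 0)%VS;
  st_eb1 : forall x y, x \in even_part g -> y \in b1 -> lsa_br x y \in b1;
  st_eq : forall x y, x \in even_part g -> y \in q -> lsa_br x y \in q;
  st_bb : forall x y, x \in b1 -> y \in b1 -> lsa_br x y = 0;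
  st_qq : forall x y, x \in q -> y \in q -> lsa_br x y = 0
}.

(** * The operators by which [b] acts on alternating forms on [q] *)

Section Coinduction.

Variables (K : numFieldType) (g : lieSuperalgebra K) (b1 q b a : {vspace g}).
Hypothesis S : stage b1 q b a.

Local Notation br := (@lsa_br K g).
Local Notation Q := (subvs_of q).

Let b1o x : x \in b1 -> x \in odd_part g. Proof. exact: (subvP (st_b1 S)). Qed.
Let qo x : x \in q -> x \in odd_part g. Proof. exact: (subvP (st_q S)). Qed.
Let vq (x : Q) : vsval x \in q. Proof. exact: subvsP. Qed.
Let eq_q := st_eq S.
Lemma even_b x : x \in even_part g -> x \in b.
Proof. by rewrite (st_b S); apply: (subvP (addvSl _ _)). Qed.
Lemma b1_b x : x \in b1 -> x \in b.
Proof. by rewrite (st_b S); apply: (subvP (addvSr _ _)). Qed.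
Lemma b_a x : x \in b -> x \in a.
Proof. by rewrite (st_a S); apply: (subvP (addvSl _ _)). Qed.
Lemma q_a x : x \in q -> x \in a.
Proof. by rewrite (st_a S); apply: (subvP (addvSr _ _)). Qed.
Hint Resolve even_b b1_b b_a q_a b1o qo vq : core.

Local Notation pr0 := (pr0 g).
Local Notation pro := (pro g).
Definition pr1 : 'End(g) := (daddv_pi b1 q \o pro)%VF.
Definition prq : 'End(g) := (daddv_pi q b1 \o pro)%VF.

Let eo0 : (even_part g :&: odd_part g = 0)%VS. Proof. exact: lsa_direct. Qed.
Let oe0 : (odd_part g :&: even_part g = 0)%VS. Proof. by rewrite capvC. Qed.
Let qb0 : (q :&: b1 = 0)%VS. Proof. by rewrite capvC (st_cap S). Qed.

Lemma pr_even x : x \in even_part g -> [/\ pr0 x = x, pr1 x = 0 & prq x = 0].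
Proof.
move=> xe; have e : pro x = 0 by exact: daddv_pi0.
by rewrite /pr1 /prq !comp_lfunE e !linear0 /pr0 daddv_pi_id.
Qed.
Lemma pr_b1 x : x \in b1 -> [/\ pr0 x = 0, pr1 x = x & prq x = 0].
Proof.
move=> xb; have e : pro x = x by apply: daddv_pi_id; auto.
rewrite /pr1 /prq !comp_lfunE e /pr0; split.
- by apply: daddv_pi0; auto.
- by apply: daddv_pi_id => //; apply: st_cap S.
- by apply: daddv_pi0.
Qed.
Lemma pr_q x : x \in q -> [/\ pr0 x = 0, pr1 x = 0 & prq x = x].
Proof.
move=> xq; have e : pro x = x by apply: daddv_pi_id; auto.
rewrite /pr1 /prq !comp_lfunE e /pr0; split.
- by apply: daddv_pi0; auto.
- by apply: daddv_pi0 => //; apply: st_cap S.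
- by apply: daddv_pi_id.
Qed.
Lemma pr1_mem x : pr1 x \in b1. Proof. by rewrite comp_lfunE; apply: memv_pi. Qed.
Lemma prq_mem x : prq x \in q. Proof. by rewrite comp_lfunE; apply: memv_pi. Qed.
Hint Resolve pr0_mem pr1_mem prq_mem : core.

Lemma pr_sum x : x \in a -> x = pr0 x + pr1 x + prq x.
Proof.
rewrite (st_a S) (st_b S) => /memv_addP[_ /memv_addP[x0 x0e [x1 x1b ->]] [xq xqq ->]].
have [e1 e2 e3] := pr_even x0e; have [f1 f2 f3] := pr_b1 x1b; have [h1 h2 h3] := pr_q xqq.
by rewrite !linearD /= e1 e2 e3 f1 f2 f3 h1 h2 h3; lin K g.
Qed.

Lemma pr_odd x : x \in a -> x \in odd_part g -> x = pr1 x + prq x.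
Proof.
move=> xa xo; rewrite {1}(pr_sum xa) [pr0 x](_ : _ = 0) ?add0r //.
by rewrite /pr0 daddv_pi0.
Qed.

Section Module.

Variable N : supermodule b.
Implicit Type f : seq Q -> N.

(** The natural action of an even element on maps: its action on values minus its action on
    arguments. *)
Definition evact z f : seq Q -> N :=
  locked_with tr_key (post (act z) f - dform z f).
Lemma evact_def z f : evact z f = post (act z) f - dform z f.
Proof. by rewrite /evact unlock. Qed.
(* y f is forced by x (y f) = [x, y] f - y (x f) for x in q. *)
Definition odact y f := wrec (fun f => act y (f [::])) (-1)
  (fun x f => evact (br (vsval x) y) f) f.

Lemma tr_evact x z f : tr x (evact z f) = evact z (tr x f) - tr (adq z x) f.
Proof. by rewrite !evact_def !trE tr_post tr_dform opprD addrA. Qed.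

Lemma evact_linear z : linear (evact z).
Proof.
move=> c f k; rewrite !evact_def (dform_linear z).
have -> : post (act z) (c *: f + k) = c *: post (act z) f + post (act z) k.
  by apply/funext => w; rewrite /post linearP.
by lin K (seq Q -> N).
Qed.
Lemma evactD z f k : evact z (f + k) = evact z f + evact z k.
Proof. by have [-> _ _] := linearEfun (evact_linear z). Qed.
Lemma evactZ z c f : evact z (c *: f) = c *: evact z f.
Proof. by have [_ -> _] := linearEfun (evact_linear z). Qed.
Lemma evactN z f : evact z (- f) = - evact z f.
Proof. by have [_ _ ->] := linearEfun (evact_linear z). Qed.
Definition evactE := (evactD, evactZ, evactN).

Lemma evact_linl c z z' f : altf f -> evact (c *: z + z') f = c *: evact z f + evact z' f.
Proof.
move=> af; rewrite !evact_def dform_linl //.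
have -> : post (act (c *: z + z')) f = c *: post (act z) f + post (act z') f.
  by apply/funext => w; rewrite !(addrfctE, scalrfctE) /post /= actDl actZl.
by lin K (seq Q -> N).
Qed.

Lemma altf_evact z f : altf f -> altf (evact z f).
Proof.
by move=> af; rewrite evact_def; apply: altfB; [apply: altf_post => //; apply: linearP|apply: altf_dform].
Qed.

Lemma evactDl z z' f : altf f -> evact (z + z') f = evact z f + evact z' f.
Proof. by move=> af; rewrite -[z]scale1r evact_linl // !scale1r. Qed.
Lemma evact0l f : altf f -> evact 0 f = 0.
Proof. by move=> af; apply: (addrI (evact 0 f)); rewrite -evactDl // !addr0. Qed.
Lemma evactNl z f : altf f -> evact (- z) f = - evact z f.
Proof.
by move=> af; rewrite -scaleN1r -[_ *: z]addr0 evact_linl // evact0l // addr0 scaleN1r.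
Qed.

Lemma evact_br z z' f : z \in even_part g -> z' \in even_part g -> altf f ->
  evact (br z z') f = evact z (evact z' f) - evact z' (evact z f).
Proof.
move=> ze z'e af; apply/eqP; rewrite -subr_eq0; apply/eqP.
apply: (@op_ext _ _ _ 1 (fun f => evact (br z z') f - (evact z (evact z' f) - evact z' (evact z f)))) af => {}f.
  move=> _; rewrite !evact_def /post !(addrfctE, opprfctE) /= !subr0.
  by rewrite (act_br (i := false) (j := false)) ?scale1r ?subrr //; auto.
move=> x af; rewrite !(trE, tr_evact, evactE) (adq_br eq_q) //.
rewrite altf_trD // altf_trN //.
by lin K (seq Q -> N).
Qed.

Lemma odact_linear y : linear (odact y).
Proof.
apply: wrec_linear => [c f k|x]; last exact: evact_linear.
by rewrite !(addrfctE, scalrfctE) linearP.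
Qed.
Lemma odactD z f k : odact z (f + k) = odact z f + odact z k.
Proof. by have [-> _ _] := linearEfun (odact_linear z). Qed.
Lemma odactZ z c f : odact z (c *: f) = c *: odact z f.
Proof. by have [_ -> _] := linearEfun (odact_linear z). Qed.
Lemma odactN z f : odact z (- f) = - odact z f.
Proof. by have [_ _ ->] := linearEfun (odact_linear z). Qed.
Definition odactE := (odactD, odactZ, odactN).

Lemma tr_odact x y f : tr x (odact y f) = evact (br (vsval x) y) f - odact y (tr x f).
Proof. by rewrite tr_wrec scaleN1r addrC. Qed.

Lemma odact_linl c y y' f : altf f -> odact (c *: y + y') f = c *: odact y f + odact y' f.
Proof.
move=> af; apply/eqP; rewrite -subr_eq0; apply/eqP.
apply: (@op_ext _ _ _ (-1) (fun f => odact (c *: y + y') f - (c *: odact y f + odact y' f))) af => {}f.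
  by move=> _; rewrite !(addrfctE, opprfctE, scalrfctE) /odact /= actDl actZl subrr.
move=> x af; rewrite !(trE, tr_odact) !brE evact_linl //.
by lin K (seq Q -> N).
Qed.
Lemma odactDl z z' f : altf f -> odact (z + z') f = odact z f + odact z' f.
Proof. by move=> af; rewrite -[z]scale1r odact_linl // !scale1r. Qed.
Lemma odact0l f : altf f -> odact 0 f = 0.
Proof. by move=> af; apply: (addrI (odact 0 f)); rewrite -odactDl // !addr0. Qed.

Lemma odactNl z f : altf f -> odact (- z) f = - odact z f.
Proof.
by move=> af; rewrite -scaleN1r -[_ *: z]addr0 odact_linl // odact0l // addr0 scaleN1r.
Qed.

Lemma altf_odact y f : y \in b1 -> altf f -> altf (odact y f).
Proof.
move=> yb; apply: altf_wrec.
- exact: odact_linear.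
- by move=> x k; apply: altf_evact.
- by move=> k c x x' ak; rewrite linearP !brE evact_linl.
- move=> k x x' ak; rewrite !tr_evact.
  (* The Jacobi identity for [x'], [x] and [y], with [[x', x] = 0] because [q] is abelian. *)
  have e : adq (br (vsval x) y) x' = - adq (br (vsval x') y) x.
    apply: subvs_inj; rewrite linearN /= !adqE ?br_oo; auto.
    rewrite [LHS]br_even_skew ?br_oo; auto; congr (- _).
    rewrite [RHS]br_even_skew ?br_oo; auto.
    by rewrite odd_jacobi; auto; rewrite (st_qq S (vq x') (vq x)) br0l sub0r.
  by rewrite e altf_trN //; lin K (seq Q -> N).
Qed.

Lemma evact_odact z y f : z \in even_part g -> y \in b1 -> altf f ->
  odact (br z y) f = evact z (odact y f) - odact y (evact z f).
Proof.
move=> ze yb af; apply/eqP; rewrite -subr_eq0; apply/eqP.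
apply: (@op_ext _ _ _ (-1) (fun f => odact (br z y) f - (evact z (odact y f) - odact y (evact z f)))) af => {}f.
  move=> _; rewrite /odact /= !evact_def /post !(addrfctE, opprfctE) /= !subr0.
  by rewrite (act_br (i := false) (j := true)) ?scale1r ?subrr //; auto; apply: b1o.
move=> x af; rewrite !(trE, tr_odact, tr_evact, evactE, odactE).
rewrite adqE //.
have e : br (vsval x) (br z y) = br z (br (vsval x) y) - br (br z (vsval x)) y.
  by rewrite (even_der (vsval x) y ze) addrAC subrr add0r.
rewrite e evactDl ?evactNl // (evact_br ze (br_oo (qo (vq x)) (b1o yb)) af).
by lin K (seq Q -> N).
Qed.

Lemma odact_odact y y' f : y \in b1 -> y' \in b1 -> altf f ->
  odact y (odact y' f) = - odact y' (odact y f).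
Proof.
move=> yb y'b af; apply/eqP; rewrite -addr_eq0; apply/eqP.
apply: (@op_ext _ _ _ 1 (fun f => odact y (odact y' f) + odact y' (odact y f))) af => {}f.
  move=> _; rewrite /odact !(addrfctE, opprfctE) /=.
  have := act_br (f [::]) (b1_b yb) (b1_b y'b) (b1o yb) (b1o y'b).
  by rewrite (st_bb S yb y'b) act0l expr1 scaleN1r opprK.
move=> x af; rewrite !(trE, tr_odact, evactE, odactE).
have e z y1 : z \in even_part g -> y1 \in b1 ->
    evact z (odact y1 f) = odact (br z y1) f + odact y1 (evact z f).
  by move=> ze yb1; rewrite evact_odact // subrK.
rewrite !e ?br_oo; auto.
(* The Jacobi identity again, now with [[y, y'] = 0] because [b1] is abelian. *)
have -> : br (br (vsval x) y) y' = - br (br (vsval x) y') y.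
  have := @odd_jacobi _ _ (vsval x) y y' (qo (vq x)) (b1o yb).
  rewrite (st_bb S yb y'b) br0r => /esym/eqP; rewrite subr_eq0 => /eqP->.
  by rewrite [in RHS]br_even_skew ?br_oo ?opprK //; auto.
rewrite odactNl //.
by lin K (seq Q -> N).
Qed.

End Module.
End Coinduction.

(** * Coinduction *)

Section AlternatingFormModule.

Variables (K : numFieldType) (Q : lmodType K).

Definition alt_pred (N : lmodType K) : {pred seq Q -> N} := fun f => `[< altf f >].
Lemma alt_predE (N : lmodType K) (f : seq Q -> N) : reflect (altf f) (f \in alt_pred (N := N)).
Proof. exact: asboolP. Qed.
Lemma alt_pred_closed N : submod_closed (alt_pred (N := N)).
Proof.
split; first exact/alt_predE/altf0.
by move=> c u v /alt_predE ? /alt_predE ?; apply/alt_predE/altf_lin.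
Qed.
HB.instance Definition _ (N : lmodType K) :=
  GRing.isSubmodClosed.Build K (seq Q -> N) (alt_pred (N := N)) (alt_pred_closed N).

Record coind_car (N : lmodType K) := CoindCar { cval : seq Q -> N; _ : cval \in alt_pred (N := N) }.
HB.instance Definition _ N := [isSub for @cval N].
HB.instance Definition _ N := [Choice of coind_car N by <:].
HB.instance Definition _ N := [SubChoice_isSubLmodule of coind_car N by <:].

Lemma cvalP N (F : coind_car N) : altf (cval F).
Proof. by apply/alt_predE; case: F. Qed.
Definition coindI (N : lmodType K) (f : seq Q -> N) (af : altf f) : coind_car N :=
  CoindCar (introT (alt_predE f) af).
Lemma cval_inj N : injective (@cval N). Proof. exact: val_inj. Qed.

End AlternatingFormModule.

Section CoinducedModule.

Variables (K : numFieldType) (g : lieSuperalgebra K) (b1 q b a : {vspace g}).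
Hypothesis S : stage b1 q b a.

Local Notation br := (@lsa_br K g).
Local Notation Q := (subvs_of q).
Local Notation pr0 := (pr0 g).
Local Notation pro := (pro g).
Local Notation pr1 := (pr1 b1 q).
Local Notation prq := (prq b1 q).
Local Notation m := (\dim {:Q}).

Let b1o x : x \in b1 -> x \in odd_part g. Proof. exact: (subvP (st_b1 S)). Qed.
Let qo x : x \in q -> x \in odd_part g. Proof. exact: (subvP (st_q S)). Qed.
Let vq (x : Q) : vsval x \in q. Proof. exact: subvsP. Qed.
Let eb := even_b S.
Let b1b := b1_b S.
Let ba := b_a S.
Let qa := q_a S.
Hint Resolve b1o qo vq eb b1b ba qa : core.
Hint Resolve pr0_mem pro_mem pr1_mem prq_mem : core.

Lemma stage_ba : (b <= a)%VS. Proof. exact/subvP. Qed.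

Lemma b_dec x : x \in b -> exists x0 x1, [/\ x0 \in even_part g, x1 \in b1 & x = x0 + x1].
Proof. by rewrite (st_b S) => /memv_addP[x0 x0e [x1 x1b ->]]; exists x0, x1. Qed.

Lemma stage_bs : subalgebra b.
Proof.
move=> _ _ /b_dec[x0 [x1 [x0e x1b ->]]] /b_dec[y0 [y1 [y0e y1b ->]]].
rewrite !brE (st_bb S x1b y1b) addr0 -addrA memvD //; first exact/eb/br_ee.
rewrite memvD //; first exact/b1b/(st_eb1 S).
by rewrite -memvN -br_even_skew // b1b // (st_eb1 S).
Qed.

Lemma stage_as : subalgebra a.
Proof.
have bq x y : x \in b -> y \in q -> br x y \in a.
  move=> /b_dec[x0 [x1 [x0e x1b ->]]] yq; rewrite !brE memvD //.
    exact/qa/(st_eq S).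
  by apply/ba/eb/br_oo; auto.
have qb x y : x \in q -> y \in b -> br x y \in a.
  move=> xq /b_dec[x0 [x1 [x0e x1b ->]]]; rewrite !brE memvD //.
    by rewrite -memvN -br_even_skew // qa // (st_eq S).
  by apply/ba/eb/br_oo; auto.
move=> x y; rewrite (st_a S) => /memv_addP[x0 x0b [x1 x1q ->]] /memv_addP[y0 y0b [y1 y1q ->]].
rewrite -(st_a S) !brE (st_qq S x1q y1q) addr0 -addrA memvD //.
  exact/ba/stage_bs.
by apply: memvD; [apply: bq|apply: qb].
Qed.

Lemma stage_bg : graded b.
Proof. by move=> x _; apply/eb/pr0_mem. Qed.
Lemma stage_ag : graded a.
Proof. by move=> x _; apply/ba/eb/pr0_mem. Qed.

Hint Resolve cvalP : core.

Section Module.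

Variable N : supermodule b.
Implicit Type f : seq Q -> N.

(* The coinduced module consists of the alternating forms on q with values in N:
   a form records the map w |-> f w from words in q, and q acts by prepending
   a letter. *)
Definition gact u f : seq Q -> N :=
  tr (vsproj q (prq u)) f + evact (pr0 u) f + odact (pr1 u) f.

Lemma gact_even u f : altf f -> u \in even_part g -> gact u f = evact u f.
Proof.
move=> af ue; have [e1 e2 e3] := pr_even b1 q ue.
by rewrite /gact e1 e2 e3 linear0 altf_tr0 // odact0l // add0r addr0.
Qed.
Lemma gact_b1 u f : altf f -> u \in b1 -> gact u f = odact u f.
Proof.
move=> af ue; have [e1 e2 e3] := pr_b1 S ue.
by rewrite /gact e1 e2 e3 linear0 altf_tr0 // evact0l // !add0r.
Qed.
Lemma gact_q u f : altf f -> u \in q -> gact u f = tr (vsproj q u) f.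
Proof.
move=> af ue; have [e1 e2 e3] := pr_q S ue.
by rewrite /gact e1 e2 e3 evact0l // odact0l // !addr0.
Qed.
Lemma gact_mode (x : Q) f : altf f -> gact (vsval x) f = tr x f.
Proof. by move=> af; rewrite gact_q // vsvalK. Qed.

Lemma altf_gact u f : altf f -> altf (gact u f).
Proof.
move=> af; apply: altfD; last exact: (altf_odact S (pr1_mem b1 q u) af).
by apply: altfD; [apply: altf_tr|apply: altf_evact].
Qed.

Hint Resolve altf_gact altf_evact altf_tr : core.

Lemma gact_linear u : linear (gact u).
Proof.
move=> c f k; rewrite /gact !(trE, evactE, odactE).
by lin K (seq Q -> N).
Qed.

Lemma gact_linl c u v f : altf f -> gact (c *: u + v) f = c *: gact u f + gact v f.
Proof.
move=> af; rewrite /gact !linearP /= altf_trP // evact_linl // odact_linl //.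
by lin K (seq Q -> N).
Qed.
Lemma gactDl u v f : altf f -> gact (u + v) f = gact u f + gact v f.
Proof. by move=> af; rewrite -[u]scale1r gact_linl // !scale1r. Qed.

Lemma gactNl u f : altf f -> gact (- u) f = - gact u f.
Proof.
move=> af; have := gactDl (- u) u af; rewrite addNr.
have -> : gact 0 f = 0 by apply: (addrI (gact 0 f)); rewrite -gactDl // !addr0.
by move/esym/eqP; rewrite addr_eq0 => /eqP.
Qed.

Lemma gact_odd x f : altf f -> x \in odd_part g ->
  gact x f = tr (vsproj q (prq x)) f + odact (pr1 x) f.
Proof. by move=> af xo; rewrite /gact pr0_odd // evact0l // addr0. Qed.

Let gact_eo z w f : z \in even_part g -> w \in a -> w \in odd_part g -> altf f ->
  gact (br z w) f = gact z (gact w f) - gact w (gact z f).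
Proof.
move=> ze wa wo af.
have w1 := pr1_mem b1 q w; have wq := prq_mem b1 q w.
have z1 := st_eb1 S ze w1; have zq := st_eq S ze wq.
rewrite {1}(pr_odd S wa wo) [br z _]brDr gactDl // (gact_b1 af z1) (gact_q af zq).
rewrite !(gact_even _ ze) ?altf_gact // !gact_odd ?altf_evact //.
- rewrite (evactD z) (evact_odact S ze w1 af) tr_evact /adq vsprojK //.
  by lin K (seq Q -> N).
- exact: altf_evact.
- by rewrite -gact_odd //; apply: altf_gact.
Qed.

Let gact_oo x y f : x \in a -> x \in odd_part g -> y \in a -> y \in odd_part g ->
  altf f -> gact (br x y) f = gact x (gact y f) + gact y (gact x f).
Proof.
move=> xa xo ya yo af.
have x1 := pr1_mem b1 q x; have xq := prq_mem b1 q x.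
have y1 := pr1_mem b1 q y; have yq := prq_mem b1 q y.
rewrite (gact_even af (br_oo xo yo)).
have -> : br x y = br (prq x) (pr1 y) + br (prq y) (pr1 x).
  rewrite {1}(pr_odd S xa xo) {1}(pr_odd S ya yo) !brE (st_bb S x1 y1) (st_qq S xq yq).
  by rewrite add0r addr0 addrC [in RHS](br_odd_sym (qo yq) (b1o x1)).
rewrite evactDl // !(gact_odd _ xo, gact_odd _ yo) ?altf_gact //.
- rewrite !trE !odactD !tr_odact !vsprojK // (altf_trC (vsproj q (prq x))) //.
  rewrite (odact_odact S x1 y1 af).
  by lin K (seq Q -> N).
- by rewrite -gact_odd //; apply: altf_gact.
- by rewrite -gact_odd //; apply: altf_gact.
Qed.

Lemma gact_br i j x y f : x \in a -> y \in a -> x \in lsa_par g i -> y \in lsa_par g j ->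
  altf f ->
  gact (br x y) f = gact x (gact y f) - (-1) ^+ (i && j) *: gact y (gact x f).
Proof.
move=> xa ya; case: i; case: j => xi yj af.
- by rewrite expr1 scaleN1r opprK gact_oo.
- have xo : x \in odd_part g by [].
  have -> : br x y = - br y x by rewrite [br y x](br_even_skew _ yj) opprK.
  rewrite gactNl // gact_eo // expr0 scale1r opprB.
  by [].
- by rewrite expr0 scale1r gact_eo.
- rewrite expr0 scale1r (gact_even af (br_ee xi yj)) (evact_br S xi yj af).
  by rewrite (gact_even af xi) (gact_even af yj) !gact_even //; apply: altf_evact.
Qed.

(** Every letter is odd, whence the correction by the length of the word. *)
Definition fpar i f := forall w, smod_par (i (+) odd (size w)) (f w).

Lemma fparD i f k : fpar i f -> fpar i k -> fpar i (f + k).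
Proof. by move=> fi ki w; rewrite addrfctE; apply: smod_parA. Qed.
Lemma fparN i f : fpar i f -> fpar i (- f).
Proof. by move=> fi w; rewrite opprfctE; apply: smod_parN. Qed.
Lemma fpar_tr i x f : fpar i f -> fpar (~~ i) (tr x f).
Proof. by move=> fi w; have := fi (x :: w); rewrite trw /=; case: i {fi}; case: odd. Qed.
Lemma fpar_evact i z f : z \in even_part g -> fpar i f -> fpar i (evact z f).
Proof.
move=> ze fi; rewrite evact_def; apply: fparD.
  by move=> w; apply: (act_graded (i := false) _ _ (fi w)); auto.
apply: fparN => w; elim: w i f fi => [|x w IH] i f fi; first exact: smod_par0.
rewrite dform_cons; apply: smod_parA; last exact: (fi (adq z x :: w)).
by have := IH _ _ (fpar_tr x fi); rewrite /=; case: i {fi}; case: odd.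
Qed.
Lemma fpar_odact i y f : y \in b1 -> fpar i f -> fpar (~~ i) (odact y f).
Proof.
move=> yb fi w; elim: w i f fi => [|x w IH] i f fi.
  have := act_graded (b1b yb) (b1o yb) (fi [::]).
  by rewrite /odact; case: i {fi}.
rewrite -trw tr_odact; apply: smod_parB.
  have := fpar_evact (br_oo (qo (vq x)) (b1o yb)) fi w.
  by rewrite /=; case: i {fi}; case: odd.
by have := IH _ _ (fpar_tr x fi); rewrite /=; case: i {fi}; case: odd.
Qed.
Lemma fpar_gact i j u f : u \in a -> u \in lsa_par g i -> altf f -> fpar j f ->
  fpar (i (+) j) (gact u f).
Proof.
case: i => ua ui af fj; last by rewrite gact_even //; apply: fpar_evact.
by rewrite addTb gact_odd //; apply: fparD; [apply: fpar_tr|exact: (fpar_odact (pr1_mem _ _ _))].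
Qed.

Definition ppart i f : seq Q -> N := fun w => ppr (i (+) odd (size w)) (f w).

Lemma altf_ppart i f : altf f -> altf (ppart i f).
Proof.
have pN j := linNf (@ppr_linear _ _ _ N j).
case=> fl fa; split=> [w c x y w'|w x y w'].
  by rewrite /ppart !size_cat /= fl ppr_linear.
by rewrite /ppart !size_cat /= fa pN.
Qed.
Lemma ppart_par i f : fpar i (ppart i f).
Proof. by move=> w; apply: ppr_par. Qed.
Lemma ppart_add f : f = ppart false f + ppart true f.
Proof.
apply/funext => w; rewrite addrfctE /ppart {1}(ppr_add (f w)).
by case: odd => //=; rewrite addrC.
Qed.
Lemma ppart_id i f : fpar i f -> forall j, ppart j f = if i == j then f else 0.
Proof.
move=> fi j; apply/funext => w; rewrite /ppart (ppr_id (fi w)).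
by case: i j {fi} => -[]; case: odd.
Qed.

End Module.
End CoinducedModule.

Section Coind.

Variables (K : numFieldType) (g : lieSuperalgebra K) (b1 q b a : {vspace g}).
Hypothesis S : stage b1 q b a.
Variable N : supermodule b.

Local Notation Q := (subvs_of q).
Local Notation gact := (gact b1).

Program Definition coind : supermodule a :=
  @Supermodule K g a (coind_car Q N)
   (fun u F => coindI (altf_gact S (vsval u) (cvalP F)))
   (fun i F => fpar i (cval F)) _ _ _ _ _ _ _ _.
Next Obligation. move=> F c u v; apply: cval_inj.
by rewrite -[LHS]/(gact (vsval (c *: u + v)) (cval F)) linearP gact_linl //; apply: cvalP. Qed.
Next Obligation. by move=> u c F G; apply: cval_inj; rewrite /= gact_linear. Qed.
Next Obligation. by move=> i w; apply: smod_par0. Qed.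
Next Obligation. by move=> i c F G Fi Gi w; apply: smod_parD; [apply: Fi|apply: Gi]. Qed.
Next Obligation.
move=> F; exists (coindI (altf_ppart false (cvalP F))), (coindI (altf_ppart true (cvalP F))).
by split; [exact: ppart_par|exact: ppart_par|apply: cval_inj; rewrite /= -ppart_add].
Qed.
Next Obligation.
move=> F F0 F1; apply: cval_inj; apply/funext => w /=.
have := F0 w; have := F1 w; rewrite addTb addFb.
by case: odd => h1 h2; apply: smod_direct.
Qed.
Next Obligation. by move=> i j u F ui Fj; apply: (fpar_gact S) => //; [apply: subvsP|apply: cvalP]. Qed.
Next Obligation.
move=> i j u v F ui vj; apply: cval_inj => /=.
have ua := subvsP u; have va := subvsP v.
by rewrite vsprojK ?(stage_as S) // (gact_br S ua va ui vj (cvalP F)).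
Qed.

Lemma coind_act u (F : coind) : u \in a -> cval (act u F) = gact u (cval F).
Proof. by move=> ua; rewrite /act /= vsprojK. Qed.

End Coind.

Section CoinductionFunctor.

Variables (K : numFieldType) (g : lieSuperalgebra K) (b1 q b a : {vspace g}).
Hypothesis S : stage b1 q b a.

Local Notation br := (@lsa_br K g).
Local Notation Q := (subvs_of q).
Local Notation pr0 := (pr0 g).
Local Notation pro := (pro g).
Local Notation pr1 := (pr1 b1 q).
Local Notation prq := (prq b1 q).
Local Notation m := (\dim {:Q}).
Local Notation C N := (coind S N).
Local Notation Res M := (res_smod (stage_bs S) (stage_ba S) M).

Let b1o x : x \in b1 -> x \in odd_part g. Proof. exact: (subvP (st_b1 S)). Qed.
Let qo x : x \in q -> x \in odd_part g. Proof. exact: (subvP (st_q S)). Qed.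
Let vq (x : Q) : vsval x \in q. Proof. exact: subvsP. Qed.
Let eb := even_b S.
Let b1b := b1_b S.
Let ba := b_a S.
Let qa := q_a S.
Hint Resolve b1o qo vq eb b1b ba qa cvalP : core.

Lemma odd_b1 x : x \in b -> x \in odd_part g -> x \in b1.
Proof.
move=> xb xo; have := pr_odd S (ba xb) xo; have [x0 [x1 [x0e x1b e]]] := b_dec S xb.
move=> _; rewrite e addrC; have -> : x0 = 0; last by rewrite addr0.
apply: even_odd0 => //; have -> : x0 = x - x1 by rewrite e addrK.
by apply: memvB => //; auto.
Qed.

Section Map.

Variables (N N' : supermodule b) (u : N -> N').
Hypothesis uh : smod_hom u.
Let ul : linear u. Proof. by case: uh. Qed.

Lemma evact_post z (f : seq Q -> N) : evact z (post u f) = post u (evact z f).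
Proof.
rewrite !evact_def dform_post //; apply/funext => w.
by rewrite /post !(addrfctE, opprfctE) /= (homB uh) (hom_act uh).
Qed.

Lemma odact_post y (f : seq Q -> N) : odact y (post u f) = post u (odact y f).
Proof.
apply/funext => w; elim: w f => [|x w IH] f; first by rewrite /odact /post /= (hom_act uh).
rewrite /post -![odact _ _ (x :: w)]trw !tr_odact tr_post evact_post.
by rewrite !(addrfctE, opprfctE) IH /post (homB uh).
Qed.

Lemma gact_post x (f : seq Q -> N) : gact b1 x (post u f) = post u (gact b1 x f).
Proof.
rewrite /gact tr_post evact_post odact_post.
by apply/funext => w; rewrite /post !addrfctE !(homD uh).
Qed.

Definition coind_map (F : C N) : C N' := coindI (altf_post ul (cvalP F)).

Lemma coind_map_hom : smod_hom coind_map.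
Proof.
split.
- move=> c F G; apply: cval_inj; apply/funext => w.
  by rewrite /= /post !(addrfctE, scalrfctE) ul.
- by move=> x F; apply: cval_inj; rewrite /= gact_post.
- by move=> i F Fi w; apply: (hom_par uh); apply: Fi.
Qed.

Lemma coind_map_inj : injective u -> injective coind_map.
Proof.
move=> ui F G e; apply: cval_inj; apply/funext => w; apply: ui.
exact: (congr1 (fun F : C N' => cval F w) e).
Qed.

(** Preimages are built along [fock_vac_ind]: creation operators concern the arguments only, hence
    commute with [post u]. *)
Lemma coind_map_surj : (forall w, exists v, u v = w) -> forall G, exists F, coind_map F = G.
Proof.
move=> us G; suff [f af e] : exists2 f : seq Q -> N, altf f & post u f = cval G.
  by exists (coindI af); apply: cval_inj.
move: (cval G) (cvalP G); apply: fock_vac_ind.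
- move=> _ _ [f1 a1 <-] [f2 a2 <-]; exists (f1 + f2); first exact: altfD.
  by apply/funext => w; rewrite /post !addrfctE (homD uh).
- move=> n; have [v <-] := us n; exists (vac v); first exact: altf_vac.
  by apply/funext => -[|x w] //=; rewrite /post /= (hom0 uh).
- by move=> i _ _ [f af <-]; exists (cre i f); [exact: altf_cre|rewrite /cre ext_post].
Qed.

End Map.

Lemma coind_exact (M N P : supermodule b) (i : M -> N) (p : N -> P) (e : ses i p) :
  exists (i' : C M -> C N) (p' : C N -> C P), ses i' p'.
Proof.
case: (e) => ih ph iI ps ex; exists (coind_map ih), (coind_map ph); split.
- exact: coind_map_hom.
- exact: coind_map_hom.
- exact: coind_map_inj.
- exact: coind_map_surj.
- move=> F; split; last first.
    case=> G <-; apply: cval_inj; apply/funext => w /=; rewrite /post.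
    by apply/ex; exists (cval G w).
  move=> pF; have pFw w : p (cval F w) = 0 := congr1 (fun F : C P => cval F w) pF.
  (* Preimages under the injective [i] are unique, so choosing them word by word yields an
     alternating form. *)
  pose f w := projT1 (cid (proj1 (ex _) (pFw w))).
  have fE w : i (f w) = cval F w := projT2 (cid (proj1 (ex _) (pFw w))).
  have [Fl Fa] := cvalP F.
  have af : altf f.
    split=> *; apply: iI; first by rewrite (homD ih) (homZ ih) !fE Fl.
    by rewrite (homN ih) !fE Fa.
  by exists (coindI af); apply: cval_inj; apply/funext => w; rewrite /= /post fE.
Qed.

(** The counit of the adjunction between restriction and coinduction. *)
Definition coind_eps (N : supermodule b) (F : C N) : N := cval F [::].

Lemma coind_eps_hom (N : supermodule b) : smod_hom (coind_eps (N := N) : Res (C N) -> N).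
Proof.
apply: hom_homog; first exact: stage_bg S.
- by [].
- by move=> i F /(_ [::]); rewrite addbF.
- move=> x F xb xe; rewrite res_act // /coind_eps coind_act; last by auto.
  rewrite (gact_even b1) //.
  by rewrite evact_def addrfctE opprfctE /= subr0.
- move=> x F xb xo; rewrite res_act // /coind_eps coind_act; last by auto.
  by rewrite (gact_b1 S) //; apply: odd_b1.
Qed.

Section Lift.

Variables (M : supermodule a) (N : supermodule b) (phi : M -> N).
Hypothesis phih : smod_hom (phi : Res M -> N).

Let phil : linear phi. Proof. by case: phih. Qed.
Let phi_act x v : x \in b -> phi (act x v) = act x (phi v).
Proof. by move=> xb; rewrite -(hom_act phih) res_act. Qed.

(** The first letter acts first, so that contracting the form of [v] with [x] gives the form of
    [act x v]. *)
Fixpoint wact (w : seq Q) (v : M) : M := if w is x :: w' then wact w' (act (vsval x) v) else v.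

Lemma wact_linear w : linear (wact w).
Proof. by elim: w => //= x w IH c u v; rewrite linearP IH. Qed.

Definition lift_form v : seq Q -> N := fun w => phi (wact w v).

Lemma lift_form_linear : linear lift_form.
Proof. by move=> c u v; apply/funext => w; rewrite /lift_form wact_linear phil. Qed.
Lemma tr_lift x v : tr x (lift_form v) = lift_form (act (vsval x) v).
Proof. by apply/funext => w; rewrite trw. Qed.

Lemma qact_anti (x y : Q) (v : M) : act (vsval x) (act (vsval y) v) = - act (vsval y) (act (vsval x) v).
Proof.
have := act_br v (qa (vq x)) (qa (vq y)) (qo (vq x)) (qo (vq y)).
rewrite (st_qq S) // act0l expr1 scaleN1r opprK => /esym/eqP.
by rewrite addr_eq0 => /eqP.
Qed.

Lemma altf_lift v : altf (lift_form v).
Proof.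
apply: (@altf_coind _ _ _ (fun f => exists v, f = lift_form v)); last by exists v.
move=> _ [{}v ->]; split.
- by move=> c x y; rewrite !tr_lift linearP actDl actZl lift_form_linear.
- move=> x y; rewrite !tr_lift qact_anti.
  by rewrite (linNf lift_form_linear).
- by move=> x; exists (act (vsval x) v); rewrite tr_lift.
Qed.

Lemma evact_lift z v : z \in even_part g -> evact z (lift_form v) = lift_form (act z v).
Proof.
move=> ze; apply/funext => w; elim: w v => [|x w IH] v.
  by rewrite evact_def addrfctE opprfctE /= subr0 /post /lift_form /= phi_act //; auto.
rewrite -!(trw x) tr_evact !tr_lift addrfctE opprfctE IH adqE ?(st_eq S) //; last first.
  by move=> *; apply: (st_eq S).
rewrite -[_ - _]/((lift_form (act z (act (vsval x) v)) - lift_form (act (br z (vsval x)) v)) w).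
congr (_ w); rewrite -(linNf lift_form_linear) -(linDf lift_form_linear); congr lift_form.
by rewrite (act_br (i := false) (j := true)) ?scale1r ?opprB ?addrNK //; auto; rewrite addrC subrK.
Qed.

Lemma odact_lift y v : y \in b1 -> odact y (lift_form v) = lift_form (act y v).
Proof.
move=> yb; apply/funext => w; elim: w v => [|x w IH] v.
  by rewrite /odact /lift_form /= phi_act //; auto.
rewrite -!(trw x) tr_odact !tr_lift addrfctE opprfctE IH evact_lift ?br_oo //; auto.
rewrite -[_ - _]/((lift_form (act (br (vsval x) y) v) - lift_form (act y (act (vsval x) v))) w).
congr (_ w); rewrite -(linNf lift_form_linear) -(linDf lift_form_linear); congr lift_form.
rewrite (act_br (i := true) (j := true)) ?expr1 ?scaleN1r ?opprK ?addrK //; auto.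
Qed.

Definition coind_lift (v : M) : C N := coindI (altf_lift v).

Lemma coind_lift_hom : smod_hom coind_lift.
Proof.
apply: hom_homog; first exact: stage_ag S.
- by move=> c u v; apply: cval_inj; rewrite /= lift_form_linear.
- move=> i v vi w; apply: (hom_par phih) => /=.
  elim: w i v vi => [|x w IH] i v vi /=; first by rewrite addbF.
  have := IH _ _ (act_graded (qa (vq x)) (qo (vq x)) vi).
  by case: i {vi}; case: odd.
- move=> x v xa xe; apply: cval_inj; rewrite coind_act //.
  by rewrite (gact_even b1 (altf_lift v) xe) evact_lift.
- move=> x v xa xo; apply: cval_inj; rewrite coind_act //.
  rewrite (gact_odd b1 (altf_lift v) xo).
  have xq := prq_mem b1 q x; have x1 := pr1_mem b1 q x.
  rewrite odact_lift // tr_lift vsprojK // -(linDf lift_form_linear) -actDl.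
  by rewrite addrC -(pr_odd S xa xo).
Qed.

Lemma coind_lift_eps v : coind_eps (coind_lift v) = phi v.
Proof. by []. Qed.

End Lift.

(** Prepending [x] to a word is the action of [x] on the form, which a morphism moves onto [v]; by
    recursion only the empty word matters. *)
Lemma coind_hom_uniq (M : supermodule a) (N : supermodule b) (f k : M -> C N) :
  smod_hom f -> smod_hom k -> (forall v, coind_eps (f v) = coind_eps (k v)) ->
  forall v, f v = k v.
Proof.
move=> fh kh e v; apply: cval_inj; apply/funext => w; elim: w v => [|x w IH] v.
  exact: e.
have h (j : M -> C N) : smod_hom j -> cval (j v) (x :: w) = cval (j (act (vsval x) v)) w.
  by move=> jh; rewrite (hom_act jh) coind_act //; auto; rewrite (gact_mode S) // trw.
by rewrite !h.
Qed.

End CoinductionFunctor.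

(** * Induction *)

Section TwistPair.

Variables (K : fieldType) (g : lieSuperalgebra K) (a : {vspace g}).
Variables (chi chi' : g -> K) (e : K) (d : bool).
Hypothesis chil : forall c x y, chi (c *: x + y) = c * chi x + chi y.
Hypothesis chil' : forall c x y, chi' (c *: x + y) = c * chi' x + chi' y.
Hypothesis chi0 : forall i x y, x \in a -> y \in a ->
  x \in lsa_par g i -> y \in lsa_par g i -> chi (lsa_br x y) = 0.
Hypothesis chi0' : forall i x y, x \in a -> y \in a ->
  x \in lsa_par g i -> y \in lsa_par g i -> chi' (lsa_br x y) = 0.
Hypothesis chiN : forall x, chi' x = - chi x.
Hypothesis ee : e * e = 1.
Hypotheses (sa : subalgebra a) (ga : graded a).

Local Notation T M := (twist_smod d chil chi0 ee sa M).
Local Notation T' M := (twist_smod d chil' chi0' ee sa M).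

Lemma twist_hom (M N : supermodule a) (f : M -> N) :
  smod_hom f -> smod_hom (f : T M -> T N).
Proof.
move=> fh; apply: hom_homog => //.
- by case: fh.
- by move=> i v; apply: (hom_par fh).
- by move=> x v xa xe; rewrite !twist_even // (homD fh) (homZ fh) (hom_act fh).
- by move=> x v xa xo; rewrite !twist_odd // (homZ fh) (hom_act fh).
Qed.

(** The twists by [chi] and [- chi], with the same sign and parity, are mutually inverse, so each is
    adjoint to the other on both sides. *)
Lemma twist_adjr (M N : supermodule a) (f : M -> N) :
  smod_hom (f : T M -> N) -> smod_hom (f : M -> T' N).
Proof.
move=> fh; apply: hom_homog => //.
- by case: fh.
- move=> i v vi; have /= := @hom_par _ _ _ _ _ _ fh (i (+) d) v.
  by apply; rewrite /= -addbA addbb addbF.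
- move=> x v xa xe; have := hom_act fh x v; rewrite twist_even // (homD fh) (homZ fh).
  by rewrite twist_even // chiN scaleNr => <-; rewrite addrK.
- move=> x v xa xo; have := hom_act fh x v; rewrite twist_odd // (homZ fh).
  by rewrite twist_odd // => <-; rewrite scalerA ee scale1r.
Qed.

Lemma twist_adjl (M N : supermodule a) (f : M -> N) :
  smod_hom (f : M -> T' N) -> smod_hom (f : T M -> N).
Proof.
move=> fh; apply: hom_homog => //.
- by case: fh.
- by move=> i v vi; have /= := hom_par fh vi; rewrite -addbA addbb addbF.
- move=> x v xa xe; have := hom_act fh x v; rewrite [in RHS]twist_even // twist_even //.
  by rewrite chiN scaleNr (linDf (_ : linear f)) ?(linZf (_ : linear f)); try (by case: fh); move=> ->; rewrite subrK.
- move=> x v xa xo; have := hom_act fh x v; rewrite !twist_odd // => e1.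
  by rewrite (linZf (_ : linear f)); try (by case: fh); rewrite e1 scalerA ee scale1r.
Qed.

End TwistPair.

Section Induction.

Variables (K : numFieldType) (g : lieSuperalgebra K) (b1 q b a : {vspace g}).
Hypothesis S : stage b1 q b a.

Local Notation br := (@lsa_br K g).
Local Notation Q := (subvs_of q).
Local Notation m := (\dim {:Q}).
Local Notation C N := (coind S N).
Local Notation Res M := (res_smod (stage_bs S) (stage_ba S) M).

Let b1o x : x \in b1 -> x \in odd_part g. Proof. exact: (subvP (st_b1 S)). Qed.
Let qo x : x \in q -> x \in odd_part g. Proof. exact: (subvP (st_q S)). Qed.
Let vq (x : Q) : vsval x \in q. Proof. exact: subvsP. Qed.
Let eb := even_b S.
Let b1b := b1_b S.
Let ba := b_a S.
Let qa := q_a S.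
Let eq_q := st_eq S.
Hint Resolve b1o qo vq eb b1b ba qa cvalP : core.

Section Top.

Variables (V V' : lmodType K).

Lemma topf_linear : linear (@topf K Q V).
Proof.
rewrite /topf => c v w; elim: (enum 'I_m) => /= [|i l ->]; last by rewrite /cre !extE.
by apply/funext => -[|x u] //=; rewrite addrfctE scalrfctE /= scaler0 addr0.
Qed.

Lemma topf_post (u : V -> V') v : linear u -> topf (u v) = post u (topf v) :> (seq Q -> V').
Proof.
move=> ul; rewrite /topf; elim: (enum 'I_m) => /= [|i l ->]; last by rewrite /cre ext_post.
by apply/funext => -[|x w] //=; rewrite /post /= (lin0f ul).
Qed.

Lemma topv_post (u : V -> V') (f : seq Q -> V) : linear u -> topv (post u f) = u (topv f).
Proof.
by move=> ul; rewrite /topv; elim: (enum 'I_m) f => //= i l IH f; rewrite /ann tr_post IH.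
Qed.

Lemma dform_br z z' (f : seq Q -> V) : z \in even_part g -> z' \in even_part g -> altf f ->
  dform (br z z') f = dform z' (dform z f) - dform z (dform z' f).
Proof.
move=> ze z'e af; apply/eqP; rewrite -subr_eq0; apply/eqP.
have [D Z N] := linearEfun (@dform_linear _ _ q V z).
have [D' Z' N'] := linearEfun (@dform_linear _ _ q V z').
apply: (@op_ext _ _ _ 1 (fun f => dform (br z z') f - (dform z' (dform z f) - dform z (dform z' f)))) af => {}f.
  by move=> _; rewrite !(addrfctE, opprfctE) /= subr0 subr0.
move=> x af; rewrite !(trE, tr_dform, D, D') (adq_br eq_q) //.
rewrite altf_trD // altf_trN //.
by lin K (seq Q -> V).
Qed.

End Top.

Local Notation delta := (@topf K Q K^o 1).

(* the character of the even part on the top exterior power of the dual of q *)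
Definition top_char (z : g) : K := topv (dform z delta).

Lemma top_char_lin c x y : top_char (c *: x + y) = c * top_char x + top_char y.
Proof. by rewrite /top_char dform_linl ?topv_linear //; apply: altf_topf. Qed.

(** [dform z] preserves degree and top forms are determined by one coefficient; composing with
    [k |-> k *: v] reduces general values to the scalar form [delta]. *)
Lemma dform_topf (V : lmodType K) z (v : V) : dform z (topf v) = topf (top_char z *: v) :> (seq Q -> V).
Proof.
have ul : linear (fun k : K^o => k *: v) by move=> c k k'; rewrite scalerDl scalerA.
have e : topf v = post (fun k : K^o => k *: v) delta :> (seq Q -> V).
  by rewrite -topf_post // scale1r.
rewrite [LHS]homog_topE; last 2 first.
- by apply: altf_dform; apply: altf_topf.
- by apply: homog_dform; apply: homog_topf.
by rewrite e dform_post // topv_post.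
Qed.

Lemma top_char_br i x y : x \in b -> y \in b -> x \in lsa_par g i -> y \in lsa_par g i ->
  top_char (br x y) = 0.
Proof.
move=> xb yb; case: i => xi yi.
  rewrite (st_bb S (odd_b1 S xb xi) (odd_b1 S yb yi)).
  by have := top_char_lin (-1) 0 0; rewrite scaler0 addr0 mulN1r addNr.
rewrite /top_char dform_br //; last exact: altf_topf.
rewrite !dform_topf !scalerA [top_char y * _]mulrC subrr.
exact: (@lin0f _ _ _ (@topv K Q K^o) (@topv_linear K Q K^o)).
Qed.

Definition top_charN (z : g) : K := - top_char z.
Lemma top_charN_lin c x y : top_charN (c *: x + y) = c * top_charN x + top_charN y.
Proof. by rewrite /top_charN top_char_lin opprD mulrN. Qed.
Lemma top_charN_br i x y : x \in b -> y \in b -> x \in lsa_par g i -> y \in lsa_par g i ->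
  top_charN (br x y) = 0.
Proof. by move=> xb yb xi yi; rewrite /top_charN (top_char_br xb yb xi yi) oppr0. Qed.

Definition top_sign : K := (-1) ^+ m.
Lemma top_signK : top_sign * top_sign = 1.
Proof. by rewrite /top_sign -exprD addnn -signr_odd odd_double. Qed.

(** [twn N] is the module from which [C N] is induced, and [twp] is the inverse twist. *)
Definition twp N := twist_smod (odd m) top_char_lin top_char_br top_signK (stage_bs S) N.
Definition twn N := twist_smod (odd m) top_charN_lin top_charN_br top_signK (stage_bs S) N.

Section Module.

Variable N : supermodule b.

Lemma evact_topf z (n : N) : evact z (topf n) = topf (act z n - top_char z *: n) :> (seq Q -> N).
Proof.
rewrite evact_def dform_topf -topf_post; last exact: linearP.
by rewrite -(linNf (@topf_linear _)) -(linDf (@topf_linear _)).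
Qed.

Lemma homog_evact d z (f : seq Q -> N) : homog d f -> homog d (evact z f).
Proof.
move=> fd w sw; rewrite evact_def addrfctE opprfctE /post fd // linear0.
by rewrite (homog_dform _ fd sw) subr0.
Qed.

(** Passing a letter costs a sign, and the even correction vanishes because it evaluates a form of
    degree [d] on a shorter word. In top degree this is the origin of [top_sign]. *)
Lemma odact_homog d y (f : seq Q -> N) w : homog d f -> (size w <= d)%N ->
  odact y f w = if size w == d then (-1) ^+ d *: act y (f w) else 0.
Proof.
elim: w d f => [|x w IH] d f fd.
  case: d fd => [|d] fd _ /=; first by rewrite scale1r.
  by rewrite /odact /= fd // linear0.
case: d fd => [|d] fd //; rewrite /= ltnS => sw.
rewrite -trw tr_odact addrfctE opprfctE [evact _ _ w](homog_evact _ fd) ?sub0r; last first.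
  by rewrite ltn_eqF.
rewrite (IH d) //; last by move=> w' sw'; rewrite trw fd.
by rewrite eqSS; case: eqP => _; rewrite ?oppr0 // trw exprS mulN1r scaleNr.
Qed.

Lemma odact_topf y (n : N) : y \in b1 ->
  odact y (topf n) = topf (top_sign *: act y n) :> (seq Q -> N).
Proof.
move=> yb; have at_ := @altf_topf K Q N; apply/funext => w.
have [lt_m|] := ltnP m (size w); first by rewrite !altf_long //; apply: (altf_odact S).
move=> le_m; rewrite (odact_homog y (@homog_topf K Q N n) le_m).
have ul : linear (fun v : N => top_sign *: act y v).
  by move=> c u v; rewrite linearP /= scalerDr !scalerA mulrC.
rewrite (topf_post n ul) /post; case: eqP => // /eqP sw.
by rewrite homog_topf // linear0 scaler0.
Qed.

Definition ind_unit (n : N) : C N := coindI (@altf_topf K Q N n).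

Lemma ind_unit_hom : smod_hom (ind_unit : twn N -> Res (C N)).
Proof.
apply: hom_homog; first exact: stage_bg S.
- by move=> c u v; apply: cval_inj; rewrite /= topf_linear.
- move=> i n /= ni w; have ul : linear (fun k : K^o => k *: n).
    by move=> c k k'; rewrite scalerDl scalerA.
  rewrite -[n]scale1r (topf_post (1 : K^o) ul) /post.
  have [e|ne] := eqVneq (size w) m; first by rewrite e; apply: smod_parZ.
  by rewrite homog_topf // scale0r; apply: smod_par0.
- move=> x n xb xe; apply: cval_inj; rewrite res_act // coind_act; auto.
  by rewrite (gact_even b1 (@altf_topf K Q N n) xe) evact_topf twist_even // scaleNr.
- move=> x n xb xo; apply: cval_inj; rewrite res_act // coind_act; auto.
  have x1 := odd_b1 S xb xo.
  by rewrite (gact_b1 S (@altf_topf K Q N n) x1) odact_topf // twist_odd.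
Qed.

Section Extend.

Variables (X : supermodule a) (phi : N -> X).
Hypothesis phih : smod_hom (phi : twn N -> Res X).

Let phil : linear phi. Proof. by case: phih. Qed.
Let y (i : 'I_m) (v : X) : X := act (vsval (mode i)) v.
Let yl i : linear (y i). Proof. exact: linearP. Qed.
Let yC i j v : y i (y j v) = - y j (y i v). Proof. exact: (qact_anti S). Qed.

(** Together with [ind_unit] and [ind_hom_uniq], this gives [C N] the universal property of the
    module induced from [twn N]. *)
Definition ind_ext (F : C N) : X := fint y phi (cval F).

Let L : linear (fint y phi) := fint_linear yl phil.

Lemma ind_ext_unit n : ind_ext (ind_unit n) = phi n.
Proof. exact: fint_topf. Qed.

Lemma ind_ext_tr x (f : seq Q -> N) : altf f -> fint y phi (tr x f) = act (vsval x) (fint y phi f).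
Proof.
move=> af; rewrite [x]sum_mode altf_tr_sum // linear_sum act_suml.
rewrite (big_morph (fint y phi) (linDf L) (lin0f L)); apply: eq_bigr => i _.
by rewrite linearZ /= actZl altf_trZ // (linZf L) [fint _ _ (tr _ _)](fint_ann yl phil yC i af).
Qed.

(** Even and odd elements go through one induction, because moving an element of [b1] past a
    contraction leaves an even bracket. *)
Lemma ind_ext_act (f : seq Q -> N) : altf f ->
  (forall z, z \in even_part g -> fint y phi (evact z f) = act z (fint y phi f)) /\
  (forall w, w \in b1 -> fint y phi (odact w f) = act w (fint y phi f)).
Proof.
move: f; apply: fock_top_ind.
- move=> f k [fe fo] [ke ko]; split=> z zz; first by rewrite evactD !(linDf L) linearD /= fe ?ke.
  by rewrite odactD !(linDf L) linearD /= fo ?ko.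
- move=> n; split=> z zz.
    rewrite evact_topf !fint_topf //.
    have := hom_act phih z n; rewrite res_act; auto; rewrite twist_even; auto.
    by rewrite /top_charN scaleNr.
  rewrite odact_topf // !fint_topf //.
  by have := hom_act phih z n; rewrite res_act; auto; rewrite twist_odd; auto.
- move=> i f af [fe fo]; rewrite /ann; split=> z zz.
    have -> : evact z (tr (mode i) f) = tr (mode i) (evact z f) + tr (adq z (mode i)) f.
      by rewrite tr_evact subrK.
    rewrite (linDf L) !ind_ext_tr //; last exact: altf_evact.
    rewrite fe // (adqE eq_q) // (act_br (i := false) (j := true)) ?scale1r //; auto.
    by rewrite addrC subrK.
  have -> : odact z (tr (mode i) f) = evact (br (vsval (mode i)) z) f - tr (mode i) (odact z f).
    by rewrite tr_odact opprB addrC subrK.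
  rewrite (linDf L) (linNf L) !ind_ext_tr //; last exact: (altf_odact S).
  rewrite fe ?br_oo ?fo //; auto.
  by rewrite (act_br (i := true) (j := true)) ?expr1 ?scaleN1r ?opprK //; auto; rewrite addrC addKr.
Qed.

(** The induction on forms does not stay among homogeneous ones, so parity is asserted for each
    component of an arbitrary form. *)
Lemma ind_ext_par (f : seq Q -> N) : altf f -> forall i, smod_par i (fint y phi (ppart i f)).
Proof.
have Pl := @ppr_linear _ _ _ N.
move: f; apply: fock_top_ind.
- move=> f k fi ki i; have -> : ppart i (f + k) = ppart i f + ppart i k.
    by apply/funext => w; rewrite /ppart !addrfctE (linDf (Pl _)).
  by rewrite (linDf L); apply: smod_parA.
- move=> n i; have -> : ppart i (topf n) = topf (ppr (i (+) odd m) n) :> (seq Q -> N).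
    apply/funext => w; rewrite (topf_post _ (Pl _)) /post /ppart.
    have [->//|ne] := eqVneq (size w) m.
    by rewrite homog_topf // !(lin0f (Pl _)).
  rewrite fint_topf //; apply: (hom_par phih) => /=; exact: ppr_par.
- move=> j f af fi i; have -> : ppart i (ann j f) = tr (mode j) (ppart (~~ i) f).
    apply/funext => w; rewrite trw /ppart /ann trw /=.
    by case: i; case: odd.
  rewrite ind_ext_tr; last exact: altf_ppart.
  have := act_graded (qa (vq (mode j))) (qo (vq (mode j))) (fi (~~ i)).
  by rewrite addTb negbK.
Qed.

Lemma ind_ext_hom : smod_hom ind_ext.
Proof.
apply: hom_homog; first exact: stage_ag S.
- by move=> c F G; rewrite /ind_ext /= L.
- move=> i F Fi; have := ind_ext_par (cvalP F) i.
  by rewrite (ppart_id Fi) eqxx.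
- move=> x F xa xe; rewrite /ind_ext coind_act // (gact_even b1 (cvalP F) xe).
  by have [-> ] := ind_ext_act (cvalP F).
- move=> x F xa xo; rewrite /ind_ext coind_act // (gact_odd b1 (cvalP F) xo) (linDf L).
  have xq := prq_mem b1 q x; have x1 := pr1_mem b1 q x.
  rewrite ind_ext_tr // vsprojK //; have [_ ->] := ind_ext_act (cvalP F) => //.
  by rewrite -actDl addrC -(pr_odd S xa xo).
Qed.

End Extend.

Lemma ind_unit_gen (Z : C N -> Prop) : (forall F G, Z F -> Z G -> Z (F + G)) ->
  (forall n, Z (ind_unit n)) -> (forall x F, x \in q -> Z F -> Z (act x F)) -> forall F, Z F.
Proof.
move=> ZD Zu Zq F; pose Z' f := exists2 G : C N, cval G = f & Z G.
suff [G e GZ] : Z' (cval F) by rewrite -(cval_inj e).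
move: (cval F) (cvalP F); apply: fock_top_ind.
- by move=> _ _ [G1 <- Z1] [G2 <- Z2]; exists (G1 + G2) => //; apply: ZD.
- by move=> n; exists (ind_unit n).
- move=> i _ _ [G <- ZG]; exists (act (vsval (mode i)) G); last exact: Zq.
  by rewrite coind_act ?(gact_mode S) //; auto.
Qed.

Lemma ind_hom_uniq (X : supermodule a) (f k : C N -> X) : smod_hom f -> smod_hom k ->
  (forall n, f (ind_unit n) = k (ind_unit n)) -> forall F, f F = k F.
Proof.
move=> fh kh e; apply: ind_unit_gen => //.
- by move=> F G eF eG; rewrite (homD fh) (homD kh) eF eG.
- by move=> x F xq eF; rewrite (hom_act fh) (hom_act kh) eF.
Qed.

End Module.
End Induction.

(** * Transfer between categories O *)

Section LinearSpan.

Variables (K : fieldType) (g : lieSuperalgebra K) (a : {vspace g}).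
Implicit Type M N : supermodule a.

Definition linset M (Z : M -> Prop) := Z 0 /\ forall c u v, Z u -> Z v -> Z (c *: u + v).

Lemma lspan_cons M (x : M) s v :
  in_lspan (x :: s) v <-> exists c u, in_lspan s u /\ v = c *: x + u.
Proof.
split.
  case=> c ->; exists (c ord0), (\sum_(i < size s) c (lift ord0 i) *: s`_i).
  by rewrite /= big_ord_recl; split=> //; exists (fun i => c (lift ord0 i)).
case=> c [u [[d ->] ->]].
exists (fun i : 'I_(size (x :: s)) => if unlift ord0 i is Some j then d j else c).
rewrite /= big_ord_recl unlift_none; congr (_ + _).
by apply: eq_bigr => i _; rewrite liftK.
Qed.

Lemma lspan_nil M (v : M) : in_lspan [::] v <-> v = 0.
Proof. by split=> [[c ->]|->]; [|exists (fun=> 0)]; rewrite big_ord0. Qed.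

Lemma lspan_linset M (s : seq M) : linset (in_lspan s).
Proof.
elim: s => [|x s [I0 ID]].
  by split=> [|c u v /lspan_nil -> /lspan_nil ->]; apply/lspan_nil; rewrite ?scaler0 ?addr0.
split; first by apply/lspan_cons; exists 0, 0; rewrite scale0r addr0.
move=> c u v /lspan_cons[d [w [sw ->]]] /lspan_cons[d' [w' [sw' ->]]].
apply/lspan_cons; exists (c * d + d'), (c *: w + w'); split; first exact: ID.
by lin K M.
Qed.

Lemma lspan_mem M (s : seq M) x : x \in s -> in_lspan s x.
Proof.
elim: s => // y s IH; rewrite inE => /orP[/eqP ->|/IH sx]; apply/lspan_cons.
  by exists 1, 0; rewrite scale1r addr0; split=> //; case: (lspan_linset s).
by exists 0, x; rewrite scale0r add0r.
Qed.

Lemma lspan_sub M (s : seq M) (Z : M -> Prop) : linset Z -> (forall x, x \in s -> Z x) ->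
  forall v, in_lspan s v -> Z v.
Proof.
case=> Z0 ZD; elim: s => [|x s IH] sZ v; first by move/lspan_nil->.
move=> /lspan_cons[c [u [su ->]]]; apply: ZD; first by apply: sZ; rewrite mem_head.
by apply: IH su => y ys; apply: sZ; rewrite inE ys orbT.
Qed.

Lemma linset_sum M (Z : M -> Prop) I (r : seq I) (P : pred I) (F : I -> M) : linset Z ->
  (forall i, P i -> Z (F i)) -> Z (\sum_(i <- r | P i) F i).
Proof.
by case=> Z0 ZD FZ; apply: big_ind => // u v Zu Zv; rewrite -[u]scale1r; exact: ZD.
Qed.

Lemma linset_add M (Z : M -> Prop) u v : linset Z -> Z u -> Z v -> Z (u + v).
Proof. by case=> _ ZD Zu Zv; rewrite -[u]scale1r; exact: ZD. Qed.
Lemma linset_scale M (Z : M -> Prop) c u : linset Z -> Z u -> Z (c *: u).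
Proof. by case=> Z0 ZD Zu; rewrite -[_ *: _]addr0; apply: ZD. Qed.
Lemma linset_opp M (Z : M -> Prop) u : linset Z -> Z u -> Z (- u).
Proof. by move=> Zl Zu; rewrite -scaleN1r; apply: linset_scale. Qed.
Lemma linset_sub M (Z : M -> Prop) u v : linset Z -> Z u -> Z v -> Z (u - v).
Proof. by move=> Zl Zu Zv; apply: linset_add => //; apply: linset_opp. Qed.

Lemma linset_preim M N (f : M -> N) (Z : N -> Prop) : linear f -> linset Z ->
  linset (fun v => Z (f v)).
Proof.
by move=> fl [Z0 ZD]; split=> [|c u v Zu Zv]; rewrite ?(lin0f fl) // fl; apply: ZD.
Qed.

Lemma lspan_map M N (f : M -> N) s v : linear f -> in_lspan s v -> in_lspan (map f s) (f v).
Proof.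
move=> fl; have ll := linset_preim fl (lspan_linset (map f s)).
by apply: (lspan_sub ll) => x xs; apply: lspan_mem; apply: map_f.
Qed.

Lemma lspan_mapV M N (f : M -> N) s w : linear f -> in_lspan (map f s) w ->
  exists2 v, in_lspan s v & f v = w.
Proof.
move=> fl; have [I0 ID] := lspan_linset s.
apply: (@lspan_sub _ _ (fun w => exists2 v, in_lspan s v & f v = w)).
  split; first by exists 0; rewrite ?(lin0f fl).
  move=> c _ _ [u us <-] [v vs <-]; exists (c *: u + v); first exact: ID.
  by rewrite fl.
by move=> _ /mapP[v vs ->]; exists v => //; apply: lspan_mem.
Qed.

Lemma lspan_subseq M (s t : seq M) : {subset s <= t} -> forall v, in_lspan s v -> in_lspan t v.
Proof.
by move=> st; apply: lspan_sub; [exact: lspan_linset|move=> x /st; apply: lspan_mem].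
Qed.

Lemma subsup_linset M (Z : M -> Prop) : is_subsupermodule Z -> linset Z.
Proof. by case. Qed.

Lemma subsup_act M (Z : M -> Prop) x v : is_subsupermodule Z -> Z v -> Z (act x v).
Proof. by case=> _ _ ZA _ Zv; apply: ZA. Qed.

End LinearSpan.

Section CategoryO.

Variables (K : fieldType) (g : lieSuperalgebra K) (a h p : {vspace g}).
Implicit Type M N : supermodule a.

(** A pointwise version of a condition in [catO], as is [lfinv] below: the vectors satisfying it
    form a subspace, so generators suffice. *)
Definition hssv M (v : M) := exists s : seq M,
  (forall w, w \in s -> exists la : hdual h, is_weight_vector la w) /\ v = \sum_(w <- s) w.

Definition lfinv (k : {vspace g}) M (v : M) := exists s : seq M, in_lspan s v /\
  forall x w, x \in k -> in_lspan s w -> in_lspan s (act x w).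

Lemma weight_hssv M (la : hdual h) (w : M) : is_weight_vector la w -> hssv w.
Proof. by move=> ww; exists [:: w]; split=> [_ /[1!inE]/eqP->|]; [exists la|rewrite big_seq1]. Qed.

Lemma hssv_linset M : linset (@hssv M).
Proof.
split; first by exists [::]; split=> //; rewrite big_nil.
move=> c _ _ [s [sw ->]] [t [tw ->]]; exists (map ( *:%R c) s ++ t); split; last first.
  by rewrite big_cat big_map -scaler_sumr.
move=> w; rewrite mem_cat => /orP[/mapP[u us ->]|/tw//].
by have [la wu] := sw _ us; exists la => x; rewrite linearZ /= wu !scalerA mulrC.
Qed.

Lemma hssv_hom M N (f : M -> N) v : smod_hom f -> hssv v -> hssv (f v).
Proof.
move=> fh [s [sw ->]]; rewrite (hom_sum fh); elim: s sw => [|w s IH] sw.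
  by rewrite big_nil; case: (hssv_linset N).
rewrite big_cons; apply: (linset_add (hssv_linset N)).
  have [la ww] := sw w (mem_head _ _); apply: (@weight_hssv _ la) => t.
  by rewrite -(hom_act fh) ww (homZ fh).
by apply: IH => u us; apply: sw; rewrite inE us orbT.
Qed.

Lemma lfinv_linset k M : linset (@lfinv k M).
Proof.
split; first by exists [::]; split=> [|x w _ /lspan_nil->]; apply/lspan_nil; rewrite ?linear0.
move=> c u v [s [us su]] [t [vt tu]]; exists (s ++ t).
have [_ ID] := lspan_linset (s ++ t).
have sl : {subset s <= s ++ t} by move=> x xs; rewrite mem_cat xs.
have tl : {subset t <= s ++ t} by move=> x xs; rewrite mem_cat xs orbT.
split; first by apply: ID; [apply: lspan_subseq us|apply: lspan_subseq vt].
move=> x w xk; move: w; apply: lspan_sub.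
  exact: linset_preim (act_linear x) (lspan_linset _).
move=> w; rewrite mem_cat => /orP[ws|wt].
  by apply: (lspan_subseq sl); apply: su => //; apply: lspan_mem.
by apply: (lspan_subseq tl); apply: tu => //; apply: lspan_mem.
Qed.

Lemma lfinv_hom k M N (f : M -> N) v : smod_hom f -> lfinv k v -> lfinv k (f v).
Proof.
move=> fh [s [sv st]]; have fl : linear f by case: fh.
exists (map f s); split; first exact: lspan_map.
move=> x _ xk /(lspan_mapV fl)[u us <-]; rewrite -(hom_act fh).
by apply: lspan_map => //; apply: st.
Qed.

Lemma lfinvS k k' M (v : M) : (k' <= k)%VS -> lfinv k v -> lfinv k' v.
Proof.
by move=> /subvP kk [s [vs sk]]; exists s; split=> // x w /kk; apply: sk.
Qed.

Lemma fg_quo M N (f : M -> N) : finitely_generated M -> smod_hom f ->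
  (forall w, exists v, f v = w) -> finitely_generated N.
Proof.
move=> [s gs] fh fs; exists (map f s) => Z Zs Zf w; have [v <-] := fs w.
by apply: (gs _ (hom_preim fh Zs)) => u us; apply: Zf; apply: map_f.
Qed.

Lemma catO_quo M N (f : M -> N) : catO h p M -> smod_hom f ->
  (forall w, exists v, f v = w) -> catO h p N.
Proof.
move=> [fg hs lf] fh fs; split; first exact: fg_quo fg fh fs.
  by move=> w; have [v <-] := fs w; apply: (hssv_hom fh (hs v)).
by move=> w; have [v <-] := fs w; apply: (lfinv_hom fh (lf v)).
Qed.

Lemma zero_hom M N : smod_hom (fun _ : M => 0 : N).
Proof.
split; first by move=> c u v; rewrite scaler0 addr0.
  by move=> x v; rewrite smod_actE linear0.
by move=> i v _; apply: smod_par0.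
Qed.

Lemma catO_prod M N : catO h p M -> catO h p N -> catO h p (prod_smod M N).
Proof.
move=> [fgM hsM lfM] [fgN hsN lfN].
have i1 : smod_hom (fun v : M => (v, 0) : prod_smod M N).
  by apply: (@pair_hom _ _ _ M N M id) => //; apply: zero_hom.
have i2 : smod_hom (fun v : N => (0, v) : prod_smod M N).
  by apply: (@pair_hom _ _ _ M N N _ id) => //; apply: zero_hom.
have e (v : prod_smod M N) : v = ((v.1, 0) : prod_smod M N) + (0, v.2).
  by case: v => u v; rewrite -[RHS]/(u + 0, 0 + v) addr0 add0r.
split.
- have [s gs] := fgM; have [t gt] := fgN.
  exists ([seq (v, 0) | v <- s] ++ [seq (0, v) | v <- t]) => Z Zs Zst v.
  rewrite (e v); apply: (linset_add (subsup_linset Zs)).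
    apply: (gs _ (hom_preim i1 Zs)) => u us; apply: Zst.
    by rewrite mem_cat; apply/orP; left; apply: map_f.
  apply: (gt _ (hom_preim i2 Zs)) => u us; apply: Zst.
  by rewrite mem_cat; apply/orP; right; apply: map_f.
- move=> v; rewrite (e v); apply: (linset_add (hssv_linset _)).
    exact: (hssv_hom i1).
  exact: (hssv_hom i2).
- move=> v; rewrite (e v); apply: (linset_add (lfinv_linset p _)).
    exact: (lfinv_hom i1).
  exact: (lfinv_hom i2).
Qed.

Lemma act_br_even M t y (v : M) : graded a -> t \in a -> t \in even_part g -> y \in a ->
  act t (act y v) = act (lsa_br t y) v + act y (act t v).
Proof.
move=> ga ta te ya; have y0 := ga _ ya; have y1 : pro g y \in a.
  have -> : pro g y = y - pr0 g y by rewrite [X in X - _]pr0_pro addrAC subrr add0r.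
  exact: memvB.
rewrite [y]pr0_pro !brE !actDl linearD /=.
rewrite (act_br v ta y0 te (pr0_mem y)) (act_br v ta y1 te (pro_mem y)) !expr0.
by lin K M.
Qed.

Definition ad_weight (be : hdual h) (y : g) := forall t : subvs_of h, lsa_br (vsval t) y = (be t : K) *: y.

(** Diagonalizability of [ad h] on [W]; for [W = q] this is what coinduction requires in order to
    preserve [h]-semisimplicity. *)
Definition ad_ss (W : {vspace g}) := forall x, x \in W ->
  exists s : seq g, x = \sum_(y <- s) y /\ forall y, y \in s -> y \in W /\ exists be, ad_weight be y.

Hypotheses (ha : (h <= a)%VS) (he : (h <= even_part g)%VS) (ga : graded a).

Lemma weight_act M (la be : hdual h) y (v : M) : y \in a -> ad_weight be y ->
  is_weight_vector la v -> is_weight_vector (la + be) (act y v).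
Proof.
move=> ya wy wv t; have th := subvsP t.
rewrite (act_br_even v ga (subvP ha _ th) (subvP he _ th) ya).
rewrite wy wv actZl linearZ /= add_lfunE -scalerDl addrC.
by [].
Qed.

Lemma hssv_act M W x (v : M) : ad_ss W -> (W <= a)%VS -> x \in W -> hssv v -> hssv (act x v).
Proof.
move=> Ws /subvP Wa xW [s [sw ->]]; have [r [-> rw]] := Ws _ xW.
rewrite act_suml; rewrite big_seq_cond; apply: (linset_sum _ (hssv_linset M)) => y.
rewrite andbT => /rw[yW [be wy]].
rewrite linear_sum /= big_seq_cond; apply: (linset_sum _ (hssv_linset M)) => w.
rewrite andbT => /sw[la ww]; apply: (@weight_hssv _ (la + be)).
by apply: weight_act => //; apply: Wa.
Qed.

End CategoryO.

Section TwistCategory.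

Variables (K : fieldType) (g : lieSuperalgebra K) (a h p : {vspace g}).
Variables (chi : g -> K) (e : K) (d : bool).
Hypothesis chil : forall c x y, chi (c *: x + y) = c * chi x + chi y.
Hypothesis chi0 : forall i x y, x \in a -> y \in a ->
  x \in lsa_par g i -> y \in lsa_par g i -> chi (lsa_br x y) = 0.
Hypothesis ee : e * e = 1.
Hypotheses (sa : subalgebra a) (ga : graded a).
Hypotheses (ha : (h <= a)%VS) (he : (h <= even_part g)%VS).
Hypotheses (pa : (p <= a)%VS) (pe : (p <= even_part g)%VS).

Variable M : supermodule a.
Local Notation T := (twist_smod d chil chi0 ee sa M).

Lemma twist_sub (U : M -> Prop) : is_subsupermodule (U : T -> Prop) -> is_subsupermodule U.
Proof.
move=> Us; have Ul : linset U := subsup_linset Us.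
have [U0 UD _ Ug] := Us; split=> //.
- move=> x v Uv; rewrite smod_actE; have xa := subvsP x; have x0a := ga xa.
  have xoa : pro g (vsval x) \in a.
    have -> : pro g (vsval x) = vsval x - pr0 g (vsval x).
      by rewrite [X in X - _]pr0_pro addrAC subrr add0r.
    exact: memvB.
  rewrite [vsval x]pr0_pro actDl; apply: (linset_add Ul).
    have := subsup_act (pr0 g (vsval x)) Us Uv; rewrite twist_even ?pr0_mem // => h1.
    rewrite -[act _ _](addrK (chi (pr0 g (vsval x)) *: v)).
    by apply: (linset_sub Ul) => //; apply: (linset_scale _ Ul).
  have := subsup_act (pro g (vsval x)) Us Uv; rewrite twist_odd ?pro_mem // => h1.
  by rewrite -[act _ _]scale1r -ee -scalerA; apply: (linset_scale _ Ul).
- move=> v0 v1 e0 e1; case ed: d Ug => Ug.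
    by rewrite addrC => /(Ug v1 v0 e1 e0)[].
  by apply: Ug.
Qed.

Lemma twist_catO : catO h p M -> catO h p T.
Proof.
move=> [fg hs lf]; split.
- by have [s gs] := fg; exists s => Z Zs Zst v; apply: (gs _ (twist_sub Zs)).
- move=> v; have [s [sw e1]] := hs v; exists s; split=> // w /sw[la ww].
  (* Twisting shifts all weights by the restriction of [chi] to [h]. *)
  pose f : {linear subvs_of h -> K^o} :=
    HB.pack (fun t : subvs_of h => chi (vsval t) : K^o)
      (GRing.isLinear.Build K (subvs_of h) K^o _ (fun t : subvs_of h => chi (vsval t) : K^o)
        (fun c x y => etrans (congr1 chi (linearP vsval c x y)) (chil c _ _))).
  exists (la + linfun f) => t; have th := subvsP t.
  rewrite twist_even ?(subvP ha _ th) ?(subvP he _ th) // ww add_lfunE lfunE /=.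
  by rewrite scalerDl.
- move=> v; have [s [vs st]] := lf v; exists s; split=> // x w xp ws.
  rewrite twist_even ?(subvP pa _ xp) ?(subvP pe _ xp) //.
  have sl : linset (in_lspan (s : seq M)) by exact: lspan_linset.
  by apply: (linset_add sl); [apply: st|apply: (linset_scale _ sl)].
Qed.

End TwistCategory.

(** * Restriction and coinduction between parabolic categories O *)

Section StageCategory.

Variables (K : numFieldType) (g : lieSuperalgebra K) (b1 q b a h p p' : {vspace g}).
Hypothesis S : stage b1 q b a.
Hypotheses (he : (h <= even_part g)%VS) (pe : (p <= even_part g)%VS).
(** Adjoining [gm] leaves the parabolic as it is, [p' = p], whereas adjoining [gp] enlarges it to
    [p' = p + q]. *)
Hypotheses (pp' : (p <= p')%VS) (p'pq : (p' <= p + q)%VS) (qss : ad_ss h q).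

Local Notation br := (@lsa_br K g).
Local Notation Q := (subvs_of q).
Local Notation m := (\dim {:Q}).
Local Notation C N := (coind S N).
Local Notation Res M := (res_smod (stage_bs S) (stage_ba S) M).
Local Notation Ob := (catO h p : supermodule b -> Prop).
Local Notation Oa := (catO h p' : supermodule a -> Prop).

Lemma even_sub_b x : x \in even_part g -> x \in b. Proof. exact: (even_b S). Qed.
Lemma even_sub_a x : x \in even_part g -> x \in a.
Proof. by move/even_sub_b; apply: (b_a S). Qed.
Let eva := even_sub_a.
Let evb := even_sub_b.
Let hb : (h <= b)%VS. Proof. by apply/subvP => x /(subvP he)/evb. Qed.
Let ha : (h <= a)%VS. Proof. by apply/subvP => x /(subvP he)/eva. Qed.
Let pb : (p <= b)%VS. Proof. by apply/subvP => x /(subvP pe)/evb. Qed.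
Let qa x : x \in q -> x \in a. Proof. exact: (q_a S). Qed.
Let qo x : x \in q -> x \in odd_part g. Proof. exact: (subvP (st_q S)). Qed.
Let vq (x : Q) : vsval x \in q. Proof. exact: subvsP. Qed.
Hint Resolve qa qo vq : core.

Lemma twn_catO N : Ob N -> Ob (twn S N).
Proof. exact: (twist_catO _ _ _ _ _ (stage_bg S) hb he pb pe). Qed.
Lemma twp_catO N : Ob N -> Ob (twp S N).
Proof. exact: (twist_catO _ _ _ _ _ (stage_bg S) hb he pb pe). Qed.

Section Closure.

Variable M : supermodule a.

(** Lists the products of sublists of [l] applied to [s]; for a basis of [q] its span is the
    exterior algebra of [q] applied to [s]. *)
Fixpoint qlist (l : seq Q) (s : seq M) : seq M :=
  if l is x :: l' then qlist l' s ++ map (act (vsval x)) (qlist l' s) else s.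

Lemma qlist_sub l s : {subset s <= qlist l s}.
Proof. by elim: l => //= x l IH v /IH h1; rewrite mem_cat h1. Qed.

Lemma qlist_gen (Z : M -> Prop) l s : linset Z -> (forall v, v \in s -> Z v) ->
  (forall x v, x \in q -> Z v -> Z (act x v)) -> forall v, v \in qlist l s -> Z v.
Proof.
move=> Zl Zs Zq; elim: l => //= x l IH v; rewrite mem_cat => /orP[/IH//|/mapP[w /IH wZ ->]].
exact: Zq.
Qed.

(** The letter [y] is moved inwards by anticommutation until it meets its own copy, where the square
    is zero. *)
Lemma qlist_stable_mem l s y v : y \in l -> in_lspan (qlist l s) v ->
  in_lspan (qlist l s) (act (vsval y) v).
Proof.
elim: l v => // x l IH v; have L := lspan_linset (qlist (x :: l) s).
move=> yl; move: v; apply: lspan_sub; first exact: linset_preim (act_linear _) L.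
have sub1 : {subset qlist l s <= qlist (x :: l) s} by move=> v h1; rewrite /= mem_cat h1.
have xl v : in_lspan (qlist l s) v -> in_lspan (qlist (x :: l) s) (act (vsval x) v).
  move/(lspan_map (act_linear (vsval x))); apply: lspan_subseq => w h1.
  by rewrite /= mem_cat h1 orbT.
move=> v /=; rewrite mem_cat => /orP[vl|/mapP[w wl ->]].
  move: yl; rewrite inE => /orP[/eqP->|yl]; first by apply: xl; apply: lspan_mem.
  by apply: (lspan_subseq sub1); apply: IH => //; apply: lspan_mem.
rewrite (qact_anti S); apply: (linset_opp L).
have [yl'|yl'] := boolP (y \in l); first by apply: xl; apply: IH => //; apply: lspan_mem.
move: yl; rewrite inE (negPf yl') orbF => /eqP->.
have -> : act (vsval x) (act (vsval x) w) = 0.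
  have /eqP := qact_anti S x x w; rewrite -addr_eq0 -mulr2n -scaler_nat scaler_eq0.
  by rewrite pnatr_eq0 /= => /eqP.
by case: L.
Qed.

Definition qclosure := qlist (vbasis {:Q}).

Lemma qclosure_stable s x v : x \in q -> in_lspan (qclosure s) v ->
  in_lspan (qclosure s) (act x v).
Proof.
move=> xq vs; rewrite -(vsprojK xq) (coord_vbasis (memvf (vsproj q x))).
rewrite linear_sum act_suml; have L := lspan_linset (qclosure s).
apply: (linset_sum _ L) => i _; rewrite linearZ actZl; apply: (linset_scale _ L).
by apply: qlist_stable_mem => //; apply: mem_nth; rewrite size_tuple.
Qed.

Lemma qclosure_pq s : (forall x v, x \in p -> in_lspan s v -> in_lspan s (act x v)) ->
  forall x v, x \in (p + q)%VS -> in_lspan (qclosure s) v -> in_lspan (qclosure s) (act x v).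
Proof.
move=> sp; have L := lspan_linset (qclosure s); have qs := @qclosure_stable s.
have ps z v : z \in p -> in_lspan (qclosure s) v -> in_lspan (qclosure s) (act z v).
  move=> zp vs; have ze := subvP pe _ zp.
  pose Z v := in_lspan (qclosure s) v /\ forall z, z \in p -> in_lspan (qclosure s) (act z v).
  suff [_ /(_ z zp)] : Z v by [].
  have Zl : linset Z.
    split; first by split=> [|y yp]; rewrite ?linear0; case: L.
    move=> c u w [u1 u2] [w1 w2]; split=> [|y yp]; first by case: L => _; apply.
    by rewrite linearP; case: L => _; apply; [apply: u2|apply: w2].
  move: v vs; apply: (lspan_sub Zl); apply: qlist_gen => //.
    move=> w ws; split=> [|y yp]; first by apply: lspan_mem; apply: qlist_sub.
    by apply: (lspan_subseq (@qlist_sub _ s)); apply: sp => //; apply: lspan_mem.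
  move=> x w xq [w1 w2]; split=> [|y yp]; first exact: qs.
  have ye := subvP pe _ yp.
  rewrite (act_br_even w (stage_ag S) (eva ye) ye (qa xq)).
  apply: (linset_add L); first by apply: qs => //; apply: (st_eq S).
  by apply: qs => //; apply: w2.
move=> _ v /memv_addP[x xp [y yq ->]] vs; rewrite actDl; apply: (linset_add L).
  exact: ps.
exact: qs.
Qed.

(** The generators over [b] are those over [a] multiplied by the exterior algebra of [q]. *)
Lemma res_fg : finitely_generated M -> finitely_generated (Res M).
Proof.
move=> [s gs]; exists (qclosure s : seq M) => Z Zs Zq.
have Zl : linset (Z : M -> Prop) := subsup_linset Zs.
have Zb x (v : M) : x \in b -> Z v -> Z (act x v : M).
  by move=> xb /(subsup_act x Zs); rewrite res_act.
(* An [a]-submodule inside [Z]: containing the generators of [M], it is all of [M], and then so is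
   [Z]. *)
pose W (v : M) := forall w : seq Q, Z (wact w v).
have wl (w : seq Q) : linear (wact w : M -> M) by exact: wact_linear.
have Wl : linset W.
  split; first by move=> w; rewrite (lin0f (wl w)); case: Zl.
  by move=> c u v Wu Wv w; rewrite wl; case: Zl => _; apply.
suff sW : is_subsupermodule W.
  move=> v; apply: (gs _ sW _ v [::]) => u us w.
  have : in_lspan (qclosure s) (wact w u).
    have: in_lspan (qclosure s) u by apply: lspan_mem; apply: qlist_sub.
    by elim: w u {us} => //= x w IH u uq; apply: IH; apply: qclosure_stable.
  by apply: lspan_sub.
have Weven z v : z \in even_part g -> W v -> W (act z v).
  move=> ze Wv w; elim: w v Wv => [|x w IH] v Wv /=.
    by apply: Zb; [exact: evb|exact: (Wv [::])].
  have -> : act (vsval x) (act z v) = act z (act (vsval x) v) - act (br z (vsval x)) v.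
    by rewrite (act_br_even v (stage_ag S) (eva ze) ze (qa (vq x))) addrAC subrr add0r.
  rewrite (linDf (wl w)) (linNf (wl w)); apply: (linset_sub Zl).
    by apply: IH => u; apply: (Wv (x :: u)).
  have h1 := st_eq S ze (vq x).
  by have := Wv (vsproj q (br z (vsval x)) :: w); rewrite /= vsprojK.
have Wb1 y v : y \in b1 -> W v -> W (act y v).
  move=> yb Wv w; have yo := subvP (st_b1 S) _ yb; elim: w v Wv => [|x w IH] v Wv /=.
    by apply: Zb; [exact: b1_b S _ yb|exact: (Wv [::])].
  have ya : y \in a by apply: b_a S _ (b1_b S yb).
  have -> : act (vsval x) (act y v) = act (br (vsval x) y) v - act y (act (vsval x) v).
    by rewrite (act_br v (qa (vq x)) ya (qo (vq x)) yo) expr1 scaleN1r opprK addrK.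
  rewrite (linDf (wl w)) (linNf (wl w)); apply: (linset_sub Zl).
    by apply: Weven => //; apply: br_oo => //; auto.
  by apply: IH => u; apply: (Wv (x :: u)).
have Wq x v : x \in q -> W v -> W (act x v).
  by move=> xq Wv w; have := Wv (vsproj q x :: w); rewrite /= vsprojK.
split; [by case: Wl|by case: Wl| |].
- move=> x v Wv; rewrite smod_actE (pr_sum S (subvsP x)) !actDl.
  apply: (linset_add Wl); last by apply: Wq => //; apply: prq_mem.
  by apply: (linset_add Wl); [apply: Weven => //; apply: pr0_mem|apply: Wb1 => //; apply: pr1_mem].
- move=> v0 v1 e0 e1 W01.
  suff H (w : seq Q) : Z (wact w v0) /\ Z (wact w v1) by split=> w; case: (H w).
  have := W01 w; rewrite (linDf (wl w)).
  have par i (v : M) : smod_par i v -> smod_par (i (+) odd (size w)) (wact w v).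
    elim: w i v => [|x w IH] i v vi /=; first by rewrite addbF.
    have := IH _ _ (act_graded (qa (vq x)) (qo (vq x)) vi).
    by case: i {vi}; case: odd.
  have [_ _ _ Zg] := Zs; have := par _ _ e0; have := par _ _ e1.
  case: odd => h1 h0; last exact: Zg.
  by rewrite addrC => /(Zg _ _ h1 h0)[].
Qed.

Lemma res_catO : Oa M -> Ob (Res M).
Proof.
move=> [fg hs lf]; split; first exact: res_fg.
- move=> v; have [s [sw e]] := hs v; exists s; split=> // w /sw[la ww].
  by exists la => t; rewrite res_act ?ww // (subvP hb) // subvsP.
- move=> v; have [s [vs st]] := lf v; exists s; split=> // x w xp ws.
  by rewrite res_act ?(subvP pb) //; apply: st => //; apply: (subvP pp').
Qed.

End Closure.

(** All three conditions are checked on the image of [ind_unit], a copy of [twn N], and carried to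
    the rest by the action of [q]. *)
Lemma coind_catO N : Ob N -> Oa (C N).
Proof.
move=> ON; have [fg hs lf] := twn_catO ON; have uh := ind_unit_hom S N; split.
- have [s gs] := fg; exists (map (ind_unit S (N := N)) s) => Z Zs Zst.
  have Zr : is_subsupermodule (Z : Res (C N) -> Prop).
    have [Z0 ZD ZA Zg] := Zs; split=> //.
    by move=> x v Zv; rewrite smod_actE res_act ?subvsP //; apply: subsup_act.
  apply: ind_unit_gen.
  + by move=> F G; apply: (linset_add (subsup_linset Zs)).
  + by apply: (gs _ (hom_preim uh Zr)) => v vs; apply: Zst; apply: map_f.
  + by move=> x F _; apply: subsup_act.
- apply: ind_unit_gen.
  + by move=> F G; apply: (linset_add (hssv_linset h (C N))).
  + move=> n; have := hssv_hom uh (hs n); case=> s [sw e]; exists s; split=> // w /sw[la ww].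
    by exists la => t; rewrite -[RHS]ww res_act // (subvP hb) // subvsP.
  + move=> x F xq; apply: (hssv_act ha he (stage_ag S) qss) => //; exact/subvP.
- suff H F : lfinv (p + q)%VS (F : C N) by move=> F; apply: (lfinvS p'pq).
  move: F; apply: ind_unit_gen.
  + by move=> F G; apply: (linset_add (lfinv_linset (p + q)%VS (C N))).
  + move=> n; have [s [ns st]] := lfinv_hom uh (lf n).
    exists (qclosure (s : seq (C N))); split.
      by apply: (lspan_subseq (@qlist_sub _ _ s)).
    apply: qclosure_pq => x w xp ws.
    by have := st x w xp ws; rewrite res_act // (subvP pb).
  + move=> x F xq [s [Fs st]]; exists s; split=> //; apply: st => //.
    by apply: (subvP (addvSr p q)).
Qed.

Lemma twn_adjr (M N : supermodule b) (f : M -> N) :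
  smod_hom (f : twn S M -> N) -> smod_hom (f : M -> twp S N).
Proof.
have chiN x : top_char q x = - top_charN q x by rewrite /top_charN opprK.
exact: (@twist_adjr _ _ _ _ _ _ _ _ _ _ _ chiN _ _ (stage_bg S)).
Qed.
Lemma twn_adjl (M N : supermodule b) (f : M -> N) :
  smod_hom (f : M -> twp S N) -> smod_hom (f : twn S M -> N).
Proof.
have chiN x : top_char q x = - top_charN q x by rewrite /top_charN opprK.
exact: (@twist_adjl _ _ _ _ _ _ _ _ _ _ _ chiN _ _ (stage_bg S)).
Qed.
Lemma twp_adjr (M N : supermodule b) (f : M -> N) :
  smod_hom (f : twp S M -> N) -> smod_hom (f : M -> twn S N).
Proof.
have chiN x : top_charN q x = - top_char q x by [].
exact: (@twist_adjr _ _ _ _ _ _ _ _ _ _ _ chiN _ _ (stage_bg S)).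
Qed.

Lemma twn_projective P : projective Ob P -> projective Ob (twn S P).
Proof.
move=> [OP lP]; split; first exact: twn_catO.
move=> M N f k OM ON fh fs kh.
have fh' : smod_hom (f : twp S M -> twp S N) by apply: (twist_hom _ _ _ _ _ (stage_bg S)).
have [k' [k'h e]] := lP (twp S M) (twp S N) f k (twp_catO OM) (twp_catO ON) fh' fs (twn_adjr kh).
by exists k'; split=> //; apply: twn_adjl.
Qed.

Lemma res_hom (X Y : supermodule a) (j : X -> Y) : smod_hom j -> smod_hom (j : Res X -> Res Y).
Proof.
move=> jh; split; [by case: jh| |by case: jh].
by move=> x v; rewrite !smod_actE !res_act ?subvsP // (hom_act jh).
Qed.

(** As induction from [twn P], coinduction is left adjoint to the exact restriction functor. *)
Lemma coind_projective P : projective Ob P -> projective Oa (C P).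
Proof.
move=> pP; have [OP _] := pP; have [OT lT] := twn_projective pP.
split; first exact: coind_catO.
move=> M N f k OM ON fh fs kh; have uh := ind_unit_hom S P.
have [k' [k'h e]] := lT (Res M) (Res N) f (fun n => k (ind_unit S n))
  (res_catO OM) (res_catO ON) (res_hom fh) fs (hom_comp uh (res_hom kh)).
exists (@ind_ext _ _ _ _ _ _ S P M k'); split; first exact: ind_ext_hom.
apply: ind_hom_uniq; first exact: (hom_comp (ind_ext_hom k'h) fh).
  exact: kh.
by move=> n; rewrite ind_ext_unit.
Qed.

(** Restriction is left adjoint to coinduction, which is exact. *)
Lemma res_projective P : projective Oa P -> projective Ob (Res P).
Proof.
move=> [OP lP]; split; first exact: res_catO.
move=> M N f k OM ON fh fs kh.
have [k' [k'h e]] := lP (C M) (C N) (coind_map (S := S) fh) (coind_lift (S := S) kh)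
  (coind_catO OM) (coind_catO ON) (coind_map_hom S fh) (coind_map_surj fh fs) (coind_lift_hom kh).
exists (fun v => coind_eps (k' v)); split.
  exact: (hom_comp (res_hom k'h) (coind_eps_hom S M)).
by move=> v; rewrite -[RHS](coind_lift_eps kh) -e.
Qed.

(** Coinduction is right adjoint to restriction, which is exact. *)
Lemma coind_injective I : injective_object Ob I -> injective_object Oa (C I).
Proof.
move=> [OI lI]; split; first exact: coind_catO.
move=> M N f k OM ON fh fi kh.
have [k' [k'h e]] := lI (Res M) (Res N) f (fun v => coind_eps (k v))
  (res_catO OM) (res_catO ON) (res_hom fh) fi (hom_comp (res_hom kh) (coind_eps_hom S I)).
exists (coind_lift (S := S) k'h); split; first exact: coind_lift_hom.
apply: coind_hom_uniq kh _; first exact: (hom_comp fh (coind_lift_hom k'h)).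
by move=> v; rewrite coind_lift_eps e.
Qed.

(** Restriction is right adjoint to induction. The module induced from [M] is [C (twp S M)], because
    the twists cancel. *)
Lemma res_injective J : injective_object Oa J -> injective_object Ob (Res J).
Proof.
move=> [OJ lJ]; split; first exact: res_catO.
move=> M N f k OM ON fh fi kh.
have fh' : smod_hom (f : twp S M -> twp S N) by apply: (twist_hom _ _ _ _ _ (stage_bg S)).
have kh' : smod_hom (k : twn S (twp S M) -> Res J).
  exact: (hom_comp (twn_adjl (hom_id (twp S M))) kh).
have [k' [k'h e]] := lJ (C (twp S M)) (C (twp S N)) (coind_map (S := S) fh') (@ind_ext _ _ _ _ _ _ S (twp S M) J k)
  (coind_catO (twp_catO OM)) (coind_catO (twp_catO ON)) (coind_map_hom S fh')
  (coind_map_inj (uh := fh') fi) (ind_ext_hom kh').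
exists (fun n => k' (ind_unit S (n : twp S N))); split.
  have h1 := hom_comp (ind_unit_hom S (twp S N)) (res_hom k'h).
  exact: (hom_comp (twp_adjr (hom_id (twp S N))) h1).
move=> v; have := e (ind_unit S (v : twp S M)); rewrite ind_ext_unit // => <-.
congr k'; apply: cval_inj; rewrite /= topf_post //.
by have [] := fh.
Qed.

Lemma coind_pdle n N : pdle Ob n N -> pdle Oa n (C N).
Proof.
apply: exact_functor_pdle; first exact: coind_projective.
exact: coind_exact.
Qed.

Lemma res_pdle n M : pdle Oa n M -> pdle Ob n (Res M).
Proof.
apply: exact_functor_pdle; first exact: res_projective.
move=> X Y Z i p0 [ih ph iI ps ex]; exists i, p0; split=> //; exact: res_hom.
Qed.

End StageCategory.

(** * Traces and Fitting decompositions *)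

Section TraceFitting.

Variables (K : numClosedFieldType) (V : vectType K).
Implicit Types (f k T : 'End(V)) (W : {vspace V}).

Definition lmx W f : 'M[K]_(\dim W) :=
  \matrix_(i, j) coord (vbasis W) j (f (vbasis W)`_i).

Definition vof W (u : 'rV[K]_(\dim W)) : V := \sum_i u ord0 i *: (vbasis W)`_i.
Arguments vof : clear implicits.

Lemma vof_mem W u : vof W u \in W.
Proof. by apply: memv_suml => i _; rewrite memvZ // vbasis_mem // mem_nth // size_tuple. Qed.

Lemma vof_eq0 W (u : 'rV[K]_(\dim W)) : vof W u = 0 -> u = 0.
Proof.
move=> u0; apply/rowP => i; rewrite mxE.
by have /freeP := basis_free (vbasisP W); apply; exact: u0.
Qed.

Lemma vof_lmx W f (u : 'rV[K]_(\dim W)) : (forall v, v \in W -> f v \in W) ->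
  f (vof W u) = vof W (u *m lmx W f).
Proof.
move=> fW; rewrite linear_sum /=.
have e (i : 'I_(\dim W)) : f (vbasis W)`_i = \sum_j lmx W f i j *: (vbasis W)`_j.
  rewrite {1}[f _](coord_vbasis (fW _ _)); last by rewrite vbasis_mem // mem_nth // size_tuple.
  by apply: eq_bigr => j _; rewrite mxE.
under eq_bigr => i _ do rewrite linearZ /= e scaler_sumr.
rewrite exchange_big /=; apply: eq_bigr => j _; rewrite !mxE scaler_suml.
by apply: eq_bigr => i _; rewrite scalerA.
Qed.

Lemma eigen_in W f : (forall v, v \in W -> f v \in W) -> W != 0%VS ->
  exists c v, [/\ v \in W, v != 0 & f v = c *: v].
Proof.
move=> fW W0; have n0 : (0 < \dim W)%N by rewrite lt0n dimv_eq0.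
have /closed_rootP[c rc] : size (char_poly (lmx W f)) != 1%N.
  by rewrite size_char_poly; case: (\dim W) n0.
move: rc; rewrite -eigenvalue_root_char => /eigenvalueP[u uA u0].
exists c, (vof W u); split; first exact: vof_mem.
  by apply: contraNneq u0 => /vof_eq0 ->.
rewrite vof_lmx // uA /vof scaler_sumr; apply: eq_bigr => i _.
by rewrite mxE scalerA.
Qed.

Definition ftr f : K := \tr (lmx {:V} f).

Lemma lmx_comp f k : lmx {:V} (f \o k)%VF = lmx {:V} k *m lmx {:V} f.
Proof.
apply/matrixP => i j; rewrite !mxE comp_lfunE.
rewrite {1}(coord_vbasis (memvf (k _))) !linear_sum /=.
by apply: eq_bigr => l _; rewrite !linearZ /= !mxE.
Qed.

Lemma ftrC f k : ftr (f \o k)%VF = ftr (k \o f)%VF.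
Proof. by rewrite /ftr !lmx_comp mxtrace_mulC. Qed.

Lemma ftr_linear c f k : ftr (c *: f + k) = c * ftr f + ftr k.
Proof.
rewrite /ftr -mxtraceZ -raddfD /=; congr (\tr _); apply/matrixP => i j.
by rewrite !mxE add_lfunE scale_lfunE linearP.
Qed.
Lemma ftrD f k : ftr (f + k) = ftr f + ftr k.
Proof. by rewrite -[f]scale1r ftr_linear mul1r scale1r. Qed.
Lemma ftr0 : ftr 0 = 0.
Proof. by apply: (addrI (ftr 0)); rewrite -ftrD !addr0. Qed.
Lemma ftrZ c f : ftr (c *: f) = c * ftr f.
Proof. by rewrite -[c *: f]addr0 ftr_linear ftr0 addr0. Qed.
Lemma ftrN f : ftr (- f) = - ftr f.
Proof. by rewrite -scaleN1r ftrZ mulN1r. Qed.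
Lemma ftrB f k : ftr (f - k) = ftr f - ftr k.
Proof. by rewrite ftrD ftrN. Qed.
Lemma ftr_sum I r (P : pred I) (F : I -> 'End(V)) :
  ftr (\sum_(i <- r | P i) F i) = \sum_(i <- r | P i) ftr (F i).
Proof. exact: (big_morph ftr ftrD ftr0). Qed.

(** Every eigenvalue is 0, so the characteristic polynomial is a pure power and its trace
    coefficient vanishes. *)
Lemma ftr_nilp f n : (forall v, iter n f v = 0) -> ftr f = 0.
Proof.
move=> fn; rewrite /ftr; set A := lmx _ f.
have [n0|n0] := posnP (\dim {:V}); first by rewrite /mxtrace big1 // => i; have := ltn_ord i; rewrite {2}n0.
apply: oppr_inj; rewrite oppr0 -char_poly_trace //.
have [r er] := closed_field_poly_normal (char_poly A).
rewrite (monicP (char_poly_monic A)) scale1r in er.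
have r0 c : c \in r -> c = 0.
  move=> cr; have : root (char_poly A) c by rewrite er root_prod_XsubC.
  rewrite -eigenvalue_root_char => /eigenvalueP[u uA u0].
  have vc : f (vof {:V} u) = c *: vof {:V} u.
    rewrite vof_lmx; last by move=> *; apply: memvf.
    by rewrite uA /vof scaler_sumr; apply: eq_bigr => i _; rewrite mxE scalerA.
  have : iter n f (vof {:V} u) = c ^+ n *: vof {:V} u.
    elim: n {fn} => [|n IH] /=; first by rewrite scale1r.
    by rewrite IH linearZ /= vc scalerA exprSr.
  rewrite fn => /esym/eqP; rewrite scaler_eq0 expf_eq0 => /orP[/andP[_ /eqP//]|/eqP/vof_eq0 u00].
  by rewrite u00 eqxx in u0.
have -> : char_poly A = 'X^(size r).
  rewrite er (eq_big_seq (fun=> 'X)) ?big_const_seq ?iter_mulr_1 ?count_predT //.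
  by move=> c /r0->; rewrite subr0.
have := size_char_poly A; rewrite er size_prod_XsubC => -[->].
by rewrite coefXn; case: (\dim _) n0 => // k _; rewrite eqn_leq ltnn andbF.
Qed.

(** The trace is the rank. This is how weight multiplicities become positive natural numbers inside
    [K]. *)
Lemma ftr_idem f : (forall v, f (f v) = f v) -> f != 0 -> exists n, ftr f = n.+1%:R.
Proof.
move=> ff f0; rewrite /ftr; set A := lmx _ f.
have AA : A *m A = A.
  by rewrite -lmx_comp; congr lmx; apply/lfunP => v; rewrite comp_lfunE ff.
have A0 : A != 0.
  apply: contraNneq f0 => A0; apply/eqP/lfunP => v; rewrite zero_lfunE.
  rewrite [v](coord_vbasis (memvf v)) linear_sum big1 // => i _.
  rewrite linearZ /= [f _](coord_vbasis (memvf _)) big1 ?scaler0 // => j _.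
  by have /matrixP/(_ i j) := A0; rewrite !mxE => ->; rewrite scale0r.
have rk : (0 < \rank A)%N by rewrite lt0n mxrank_eq0.
(* In the rank factorization [A = C R] the factors cancel on the outer sides, so [A *m A = A]
   becomes [R C = 1]. *)
have e : row_base A *m col_base A = 1%:M.
  have [B BC] := row_fullP (col_base_full A).
  have [D RD] := row_freeP (row_base_free A).
  have CR := mulmx_base A; move: (col_base A) (row_base A) BC RD CR => C R.
  move=> BC RD CR; have E : C *m R *m (C *m R) = C *m R by rewrite CR.
  have := congr1 (fun X => B *m X *m D) E.
  by rewrite !mulmxA BC !mul1mx -!mulmxA RD !mulmx1.
exists (\rank A).-1; rewrite prednK //.
by rewrite -[X in \tr X](mulmx_base A) mxtrace_mulC e mxtrace1.
Qed.

Fixpoint lpow f n : 'End(V) := if n is n'.+1 then (f \o lpow f n')%VF else \1%VF.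
Lemma lpowE f n v : lpow f n v = iter n f v.
Proof. by elim: n => [|n IH]; rewrite ?id_lfunE //= comp_lfunE IH. Qed.
Lemma iter_lin f n : linear (iter n f).
Proof. by elim: n => // n IH c u v /=; rewrite IH linearP. Qed.
Lemma lfun_iter0 f n : iter n f 0 = 0.
Proof. exact: lin0f (iter_lin f n). Qed.

Notation N := (\dim {:V}).

(** The kernels of the powers of [f] stabilize within [N] steps by dimension, so [N] serves as
    exponent for every generalized eigenspace. *)
Lemma iter_stab f (r : nat) v : iter r f v = 0 -> iter N f v = 0.
Proof.
pose L i := lker (lpow f i).
have LE i u : (u \in L i) = (iter i f u == 0) by rewrite memv_ker lpowE.
have LS i : (L i <= L i.+1)%VS.
  by apply/subvP => u; rewrite !LE /= => /eqP->; rewrite linear0.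
have stab i : (L i.+1 <= L i)%VS -> forall n u, iter (i + n) f u = 0 -> iter i f u = 0.
  move=> Li; elim=> [|n IH] u; first by rewrite addn0.
  move=> u0; apply: IH; have : iter n f u \in L i.+1 by rewrite LE -iterD addSnnS u0.
  by move/(subvP Li); rewrite LE -iterD => /eqP.
have [i [iN Li]] : exists i, (i <= N)%N /\ (L i.+1 <= L i)%VS.
  apply/not_existsP => H.
  have D i : (i <= N.+1)%N -> (i <= \dim (L i))%N.
    elim: i => // i IH iN; have /not_andP[/(_ iN)//|Li] := H i.
    apply: leq_ltn_trans (IH (ltnW iN)) _; rewrite ltn_neqAle dimvS // andbT.
    apply/eqP => e; apply: Li; have := dimv_leqif_sup (LS i).
    by case=> _ <-; rewrite e.
  by have := D N.+1 (leqnn _); rewrite ltnNge => /negP; apply; apply/dimvS/subvf.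
move=> v0; have v1 : iter i f v = 0.
  apply: (stab i Li r); rewrite iterD.
  by rewrite v0 lfun_iter0.
by rewrite -(subnK iN) iterD v1 lfun_iter0.
Qed.

(** The Fitting components of [f], generalized kernel and stable image; [fit] is the projection onto
    the first along the second. *)
Definition fitk f := lker (lpow f N).
Definition fiti f := limg (lpow f N).
Definition fit f : 'End(V) := daddv_pi (fitk f) (fiti f).

Lemma fitkP f v : reflect (iter N f v = 0) (v \in fitk f).
Proof. by rewrite memv_ker lpowE; apply: eqP. Qed.
Lemma fitiP f v : reflect (exists u, v = iter N f u) (v \in fiti f).
Proof.
apply: (iffP memv_imgP) => [[u _ ->]|[u ->]]; first by exists u; rewrite lpowE.
by exists u; rewrite ?memvf // lpowE.
Qed.

Lemma fit_cap f : (fitk f :&: fiti f = 0)%VS.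
Proof.
apply/eqP; rewrite -subv0; apply/subvP => v /memv_capP[/fitkP v0 /fitiP[u e]].
by rewrite memv0 e; apply/eqP/(@iter_stab f (N + N)); rewrite iterD -e.
Qed.

Lemma fit_split f W v : (forall u, u \in W -> f u \in W) -> v \in W ->
  exists v0 v1, [/\ v0 \in W, v1 \in W, v0 \in fitk f, v1 \in fiti f & v = v0 + v1].
Proof.
move=> fW vW; have iW n u : u \in W -> iter n f u \in W.
  by move=> uW; elim: n => //= n; apply: fW.
pose I := (lpow f N @: W)%VS.
have IW : (I <= W)%VS by apply/subvP => _ /memv_imgP[u uW ->]; rewrite lpowE iW.
have II : (lpow f N @: I <= I)%VS by apply: limgS.
have /eqP eI : (lpow f N @: I)%VS == I.
  rewrite eqEdim II /= limg_dim_eq //; apply/eqP; rewrite -subv0 -(fit_cap f) capvC.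
  apply: capvS => //; exact/limgS/subvf.
have : lpow f N v \in I by apply: memv_img.
rewrite -eI => /memv_imgP[_ /memv_imgP[u uW ->] e].
exists (v - lpow f N u), (lpow f N u); split; rewrite ?subrK //.
- by rewrite memvB // lpowE iW.
- by rewrite lpowE iW.
- by rewrite memv_ker linearB /= e subrr.
- exact/memv_img/memvf.
Qed.

Lemma fit_k f v : v \in fitk f -> fit f v = v.
Proof. exact/daddv_pi_id/fit_cap. Qed.
Lemma fit_i f v : v \in fiti f -> fit f v = 0.
Proof. exact/daddv_pi0/fit_cap. Qed.
Lemma fit_mem f v : fit f v \in fitk f.
Proof. exact: memv_pi. Qed.
Lemma fit_stab f W v : (forall u, u \in W -> f u \in W) -> v \in W -> fit f v \in W.
Proof.
move=> fW /(fit_split fW)[v0 [v1 [v0W v1W v0k v1i ->]]].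
by rewrite linearD /= fit_k // fit_i // addr0.
Qed.
Lemma fit_idem f v : fit f (fit f v) = fit f v.
Proof. exact/fit_k/fit_mem. Qed.
Lemma fit_comm f k v : (forall u, u \in fitk f -> k u \in fitk f) ->
  (forall u, u \in fiti f -> k u \in fiti f) -> fit f (k v) = k (fit f v).
Proof.
move=> kk ki; have [|v0 [v1 [_ _ v0k v1i ->]]] := @fit_split f fullv v _ (memvf v).
  by move=> *; apply: memvf.
by rewrite !linearD /= (fit_k (kk _ v0k)) (fit_i (ki _ v1i)) (fit_k v0k) (fit_i v1i) linear0.
Qed.

End TraceFitting.

(** * Weights of the Cartan subalgebra *)

Section WeightDecomposition.

Variables (K : numClosedFieldType) (g : lieSuperalgebra K) (h : {vspace g}).
Hypotheses (he : (h <= even_part g)%VS) (hn : lie_nilpotent h).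

Local Notation br := (@lsa_br K g).
Local Notation N := (\dim {:g}).
Local Notation H := (subvs_of h).

Definition adsh (c : K) (t : g) : 'End(g) := ad t - c *: \1%VF.

Lemma adshE c t v : adsh c t v = br t v - c *: v.
Proof. by rewrite /adsh add_lfunE opp_lfunE scale_lfunE id_lfunE adE. Qed.

Lemma adsh_der t a b x v : t \in even_part g ->
  adsh (a + b) t (br x v) = br (adsh a t x) v + br x (adsh b t v).
Proof. by move=> te; rewrite !adshE !brE even_der //; lin K g. Qed.

(** Each application of the derivation rule lowers the order of one factor, so brackets add
    generalized eigenvalues. *)
Lemma adsh_leibniz t a b n k x v : t \in even_part g ->
  iter n (adsh a t) x = 0 -> iter k (adsh b t) v = 0 ->
  iter (n + k) (adsh (a + b) t) (br x v) = 0.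
Proof.
move=> te; have [s] := ubnP (n + k); elim: s n k x v => // s IH [|n] k x v.
  by move=> _ /= -> _; rewrite br0l lfun_iter0.
case: k => [|k]; first by move=> _ _ v0; rewrite (v0 : v = 0) br0r lfun_iter0.
rewrite ltnS => sl x0 v0; rewrite addSn iterSr adsh_der // (linDf (iter_lin _ _)).
rewrite IH // -?iterSr // add0r -addSnnS IH // -?iterSr //.
by rewrite addSnnS.
Qed.

Definition hstable (W : {vspace g}) := forall t x, t \in h -> x \in W -> br t x \in W.

Lemma h_nil t y : t \in h -> y \in h -> exists m, iter m (adsh 0 t) y = 0.
Proof.
move=> th yh; have [m em] := hn; exists m; apply/eqP; rewrite -memv0 -em.
elim: m {em} => //= m IH; rewrite adshE scale0r subr0.
exact: mem_brv.
Qed.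

Lemma fitk_stable t c : t \in h -> hstable (fitk (adsh c t)).
Proof.
move=> th y x yh /fitkP x0; have [m ym] := h_nil th yh; apply/fitkP.
apply: (@iter_stab _ _ _ (m + N)); rewrite -[c]add0r.
by apply: adsh_leibniz => //; apply: (subvP he).
Qed.

Lemma fiti_iter (f : 'End(g)) m v : v \in fiti f -> exists u, v = iter (m + N) f u.
Proof.
have fi u : u \in fiti f -> f u \in fiti f.
  by move=> /fitiP[w ->]; apply/fitiP; exists (f w); rewrite -iterS -iterSr.
have surj u : u \in fiti f -> exists2 w, w \in fiti f & u = f w.
  move=> /fitiP[w ->]; have [|w0 [w1 [_ _ /fitkP w00 w1i ->]]] := @fit_split _ _ f fullv w _ (memvf w).
    by move=> *; apply: memvf.
  rewrite (linDf (iter_lin _ _)) w00 add0r.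
  case EN : N => [|n].
    have /eqP : \dim {:g} == 0%N by rewrite EN.
    move/eqP; rewrite dimv_eq0 => /eqP g0; exists 0; first exact: mem0v.
    have : w1 \in {:g}%VS by apply: memvf.
    by rewrite g0 memv0 => /eqP ->; rewrite linear0.
  exists (iter n f w1) => //; elim: n {EN} => //= n IH; exact: fi.
elim: m v => [|m IH] v vi; first by have /fitiP := vi.
have [w wi ->] := surj _ vi; have [u ->] := IH _ wi.
by exists u.
Qed.

(** Moving [y] past a power of [ad t - c] costs at most [m] factors, [m] being its order of
    nilpotency under [ad t]. *)
Lemma br_img t c y m n u : t \in even_part g -> iter m (adsh 0 t) y = 0 ->
  exists w, br y (iter (n + m) (adsh c t) u) = iter n (adsh c t) w.
Proof.
move=> te; elim: m y n u => [|m IHm] y n u y0.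
  by exists 0; rewrite lfun_iter0 (y0 : y = 0) br0l.
elim: n u => [|n IHn] u; first by eexists; reflexivity.
pose w := iter (n + m.+1) (adsh c t) u.
rewrite addSn iterS -/w.
have -> : br y (adsh c t w) = adsh c t (br y w) - br (adsh 0 t y) w.
  by have := @adsh_der t 0 c y w te; rewrite add0r => ->; rewrite addrAC subrr add0r.
have [w1 e1] := IHn u; rewrite -/w in e1.
have [|w2 e2] := IHm (adsh 0 t y) n.+1 u; first by rewrite -iterSr.
have -> : w = iter (n.+1 + m) (adsh c t) u by rewrite addSnnS.
rewrite e2 addSnnS -/w e1; exists (w1 - w2).
by rewrite (linDf (iter_lin _ _)) (linNf (iter_lin _ _)).
Qed.

Lemma fiti_stable t c : t \in h -> hstable (fiti (adsh c t)).
Proof.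
move=> th y x yh xi; have [m ym] := h_nil th yh; have [u ->] := fiti_iter m xi.
have [w ew] := br_img c N u (subvP he _ th) ym.
by apply/fitiP; exists w; rewrite -ew addnC.
Qed.

(** The last condition makes the weight projections respect parities and submodules, without
    presenting them as polynomials in operators [ad t]. *)
Definition hproj (p : 'End(g)) := [/\ forall v, p (p v) = p v,
  forall t v, t \in h -> p (br t v) = br t (p v)
  & forall W v, hstable W -> v \in W -> p v \in W].

Definition primary (p : 'End(g)) :=
  forall t, t \in h -> exists c, forall v, iter N (adsh c t) (p v) = 0.

(** Some [t] has no single generalized eigenvalue on the image of [p]. The Fitting projection of
    [ad t - c], with [c] an eigenvalue on that image, cuts it into two nonzero parts. *)
Lemma hproj_split p : hproj p -> ~ primary p -> exists p1 p2,
  [/\ hproj p1, hproj p2, p = p1 + p2, (forall v, p1 (p2 v) = 0) /\ (forall v, p2 (p1 v) = 0)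
    & (\dim (limg p1) < \dim (limg p))%N /\ (\dim (limg p2) < \dim (limg p))%N].
Proof.
move=> [pp pc ps] /existsNP[t /not_implyP[th nc]].
have pW v : v \in limg p -> p v = v by move=> /memv_imgP[u _ ->].
have Wt v : v \in limg p -> ad t v \in limg p.
  by move=> /pW <-; rewrite adE -pc // memv_img // memvf.
have p0 : limg p != 0%VS.
  apply/eqP => p0; apply: nc; exists 0 => v; have : p v \in limg p by rewrite memv_img // memvf.
  by rewrite p0 memv0 => /eqP->; rewrite lfun_iter0.
have [c [x [xp x0 ex]]] := eigen_in Wt p0; rewrite adE in ex.
pose T := adsh c t; pose e := fit T.
have Tk : hstable (fitk T) by apply: fitk_stable.
have Ti : hstable (fiti T) by apply: fiti_stable.
have ee v : e (e v) = e v by exact: fit_idem.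
have ec y v : y \in h -> e (br y v) = br y (e v).
  move=> yh; rewrite -!adE; apply: (@fit_comm _ _ T (ad y)) => u uu; rewrite adE.
    exact: Tk.
  exact: Ti.
have es W v : hstable W -> v \in W -> e v \in W.
  by move=> Ws; apply: fit_stab => u uW; rewrite adshE memvB ?memvZ // Ws.
have ep v : e (p v) = p (e v).
  by apply: (@fit_comm _ _ T p) => u; [apply: ps|apply: ps].
pose p1 : 'End(g) := (e \o p)%VF; pose p2 : 'End(g) := p - p1.
have p1E v : p1 v = e (p v) by rewrite comp_lfunE.
have p2E v : p2 v = p v - e (p v) by rewrite add_lfunE opp_lfunE p1E.
have z12 v : p1 (p2 v) = 0 by rewrite p1E p2E linearB /= -ep pp linearB /= ee subrr.
have z21 v : p2 (p1 v) = 0 by rewrite p2E p1E -ep pp ee subrr.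
have p10 : p1 x = x.
  rewrite p1E (pW x xp); apply: fit_k; apply/fitkP/(@iter_stab _ _ _ 1).
  by rewrite /= adshE ex subrr.
have p2n0 : exists u, p2 u <> 0.
  apply: contrapT => p20'; apply: nc; exists c => v.
  have p20 : p2 v = 0 by apply: contrapT => ?; apply: p20'; exists v.
  have : p v = e (p v) by apply/eqP; rewrite -subr_eq0 -p2E p20.
  by move=> ->; apply/fitkP; apply: fit_mem.
have sub1 : (limg p1 <= limg p)%VS.
  by apply/subvP => _ /memv_imgP[u _ ->]; rewrite p1E ep memv_img // memvf.
have sub2 : (limg p2 <= limg p)%VS.
  by apply/subvP => _ /memv_imgP[u _ ->]; rewrite p2E ep memvB // memv_img // memvf.
exists p1, p2; split.
- split=> [v|y v yh|W v Ws vW].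
  + by rewrite !p1E -ep pp ee.
  + by rewrite !p1E pc // ec.
  + by rewrite p1E; apply: es => //; apply: ps.
- split=> [v|y v yh|W v Ws vW].
  + have e1 := p2E v; rewrite {1}p2E; have -> : p (p2 v) = p2 v.
      by apply: pW; apply: (subvP sub2); rewrite memv_img // memvf.
    by have := z12 v; rewrite p1E ( _ : p (p2 v) = p2 v) ?subr0 => [->|]; rewrite ?subr0 //;
       apply: pW; apply: (subvP sub2); rewrite memv_img // memvf.
  + by rewrite !p2E pc // ec // !brE.
  + by rewrite p2E memvB //; [apply: ps|apply: es => //; apply: ps].
- by rewrite addrC subrK.
- by split.
- split; rewrite ltn_neqAle dimvS // andbT; apply/eqP => ed.
    have [u u0] := p2n0; apply: u0; have /subvP s1 : (limg p <= limg p1)%VS.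
      by have := dimv_leqif_sup sub1; case=> _ <-; rewrite ed.
    have /s1/memv_imgP[w _ ew] : p2 u \in limg p by apply: (subvP sub2); rewrite memv_img // memvf.
    by rewrite -(z12 u) ew !p1E -ep pp ee.
  have /subvP s1 : (limg p <= limg p2)%VS.
    by have := dimv_leqif_sup sub2; case=> _ <-; rewrite ed.
  have /memv_imgP[w _ ew] := s1 _ xp.
  by case/eqP: x0; rewrite -p10 ew z12.
Qed.

Lemma hproj_decomp p : hproj p -> exists s : seq 'End(g),
  [/\ p = \sum_(r <- s) r, forall r, r \in s -> [/\ hproj r, primary r & r != 0],
      forall r v, r \in s -> r (p v) = r v /\ p (r v) = r v & uniq s] /\
  forall r r' v, r \in s -> r' \in s -> r != r' -> r (r' v) = 0.
Proof.
have [n] := ubnP (\dim (limg p)); elim: n p => // n IH p; rewrite ltnS => pn hp.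
have [p0|p0] := eqVneq p 0; first by exists [::]; rewrite p0 big_nil; split=> //; split.
have [pp|/(hproj_split hp)[p1 [p2 [h1 h2 e [z12 z21] [d1 d2]]]]] := pselect (primary p).
  exists [:: p]; rewrite big_seq1; split=> [|r r' v]; last first.
    by rewrite !inE => /eqP-> /eqP->; rewrite eqxx.
  split=> // r => [|v]; rewrite inE => /eqP-> //.
  by case: hp => ->.
have [s1 [[e1 a1 b1 u1] o1]] := IH p1 (leq_trans d1 pn) h1.
have [s2 [[e2 a2 b2 u2] o2]] := IH p2 (leq_trans d2 pn) h2.
have o12 r r' v : r \in s1 -> r' \in s2 -> r (r' v) = 0 /\ r' (r v) = 0.
  move=> /b1 br1 /b2 br2; have [c1 c2] := br1 (r' v); have [c3 c4] := br2 v.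
  have [c5 c6] := br1 v; have [c7 c8] := br2 (r v).
  by rewrite -c1 -c4 z12 linear0 -c7 -c6 z21 linear0.
exists (s1 ++ s2); split; last first.
  move=> r r' v; rewrite !mem_cat => /orP[rs|rs] /orP[rs'|rs'] nr.
  - exact: o1.
  - by case: (o12 _ _ v rs rs').
  - by case: (o12 _ _ v rs' rs).
  - exact: o2.
split.
- by rewrite big_cat -e1 -e2.
- by move=> r; rewrite mem_cat => /orP[/a1|/a2].
- move=> r v; rewrite mem_cat e !add_lfunE => /orP[rs|rs].
    have [c1 c2] := b1 r v rs; have [c3 c4] := b1 r (p2 v) rs.
    rewrite linearD /= c1 -c3 z12 linear0 addr0; split=> //.
    by rewrite c2 -c2 z21 addr0.
  have [c1 c2] := b2 r v rs; have [c3 c4] := b2 r (p1 v) rs.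
  rewrite linearD /= c1 -c3 z21 linear0 add0r; split=> //.
  by rewrite c2 -c2 z12 add0r.
- rewrite cat_uniq u1 u2 andbT /=; apply/hasPn => r rs2; apply/negP => rs1.
  have [[rr _ _] _ /eqP[]] := a1 r rs1; apply/lfunP => v.
  by rewrite zero_lfunE -rr; case: (o12 _ _ v rs1 rs2).
Qed.

(** The single eigenvalue of [ad t] on the image of a primary [r], written as a normalized trace so
    that linearity in [t] is immediate. *)
Definition pweight (r : 'End(g)) (t : H) : K^o := ftr (r \o ad (vsval t))%VF / ftr r.

Lemma pweight_linear r : linear (pweight r).
Proof.
move=> c t u; rewrite /pweight.
have -> : (r \o ad (vsval (c *: t + u)))%VF
        = c *: (r \o ad (vsval t))%VF + (r \o ad (vsval u))%VF.
  apply/lfunP => v.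
  by rewrite add_lfunE scale_lfunE !comp_lfunE !adE linearP /= brDl brZl linearP.
by rewrite ftrD ftrZ mulrDl -mulrA.
Qed.

HB.instance Definition _ r :=
  GRing.isLinear.Build K H K^o _ (pweight r) (pweight_linear r).

Definition pwt r : hdual h := linfun (pweight r).

(** [G] commutes with [r] and [ad t], so [G (ad t - c) r] is nilpotent: in traces, generalized
    eigenvalues count like genuine ones. *)
Lemma ftr_eig (G r : 'End(g)) c t :
  (forall v, r (r v) = r v) -> (forall v, r (br t v) = br t (r v)) ->
  (forall v, iter N (adsh c t) (r v) = 0) ->
  (forall v, G (r v) = r (G v)) -> (forall v, G (br t v) = br t (G v)) ->
  ftr (G \o (ad t \o r))%VF = c * ftr (G \o r)%VF.
Proof.
move=> rr rc ct Gr Gt; apply/eqP; rewrite -subr_eq0 -ftrZ -ftrB.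
pose T := adsh c t; have Tr w : T (r w) = r (T w).
  by rewrite !adshE [in RHS]linearB [in RHS]linearZ /= rc.
have TG w : T (G w) = G (T w) by rewrite !adshE [in RHS]linearB [in RHS]linearZ /= Gt.
set F := (X in ftr X); have FE w : F w = G (T (r w)).
  by rewrite add_lfunE opp_lfunE scale_lfunE !comp_lfunE adE adshE [in RHS]linearB [in RHS]linearZ.
have TGn m w : iter m T (G w) = G (iter m T w).
  by elim: m => // m IH; rewrite !iterS IH TG.
have FGT w : G (T (r w)) = r (G (T w)) by rewrite Tr Gr.
have E w m : iter m F (r w) = iter m G (iter m T (r w)).
  elim: m w => // m IH w.
  by rewrite iterSr FE rr FGT IH -FGT TGn -iterSr -iterSr.
by apply/eqP/(@ftr_nilp _ _ _ N.+1) => u; rewrite iterSr FE FGT E ct lfun_iter0.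
Qed.

Lemma primary_pwt r (t : H) v : hproj r -> primary r -> r != 0 ->
  iter N (adsh (pwt r t) (vsval t)) (r v) = 0.
Proof.
move=> hr rp r0; have [c ct] := rp _ (subvsP t).
suff -> : pwt r t = c by [].
have [rr rc _] := hr.
have [n en] := ftr_idem rr r0; have n0 : ftr r != 0 by rewrite en pnatr_eq0.
rewrite lfunE /= /pweight; apply: (canLR (mulfK n0)).
by have := ftr_eig (G := \1%VF) rr (fun v => rc _ v (subvsP t)) ct; rewrite !comp_lfun1l ftrC; apply=> v'; rewrite !id_lfunE.
Qed.

(** Generalized weights only: [h] is not yet known to act diagonalizably, whence the nilpotency in
    [wd_nil]. *)
Record weight_dec (wts : seq (hdual h)) (pi : hdual h -> 'End(g)) : Prop := WeightDec {
  wd_uniq : uniq wts;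
  wd_sum : \sum_(mu <- wts) pi mu = \1%VF;
  wd_mem : forall mu, (mu \in wts) = (pi mu != 0);
  wd_pipi : forall mu nu v, pi mu (pi nu v) = if mu == nu then pi mu v else 0;
  wd_hproj : forall mu, hproj (pi mu);
  wd_nil : forall (mu : hdual h) (t : H) v, iter N (adsh (mu t) (vsval t)) (pi mu v) = 0
}.

Lemma weight_decomposition : exists wts pi, weight_dec wts pi.
Proof.
have h1 : hproj \1%VF by split=> [v|t v _|W v _]; rewrite !id_lfunE.
have [s [[es sP _ us] so]] := hproj_decomp h1.
(* Primary pieces that share a weight are merged. *)
pose pi mu : 'End(g) := \sum_(r <- s | pwt r == mu) r.
have piE mu v : pi mu v = \sum_(r <- s | pwt r == mu) r v by rewrite sum_lfunE.
have rpi r nu v : r \in s -> r (pi nu v) = if pwt r == nu then r v else 0.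
  move=> rs; rewrite piE linear_sum /= big_mkcond /= (bigD1_seq r) //= big_seq_cond.
  rewrite big1 => [|r' /andP[r's rr']]; last by case: eqP => // _; rewrite so // eq_sym.
  by rewrite addr0; have [[-> _ _] _ _] := sP r rs.
have pipi mu nu v : pi mu (pi nu v) = if mu == nu then pi mu v else 0.
  rewrite [pi mu _]piE [pi mu v]piE big_seq_cond.
  rewrite (eq_bigr (fun r : 'End(g) => if mu == nu then r v else 0)).
    by case: eqP => _; [rewrite -big_seq_cond|rewrite big1].
  by move=> r /andP[rs /eqP <-]; rewrite rpi.
exists (undup (map pwt s)), pi; split; rewrite ?undup_uniq //.
- rewrite [RHS]es /pi (exchange_big_dep predT) //= big_seq [RHS]big_seq; apply: eq_bigr => r rs.
  rewrite -big_filter (_ : filter _ _ = [:: pwt r]) ?big_seq1 //.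
  rewrite (eq_filter (a2 := pred1 (pwt r))); last by move=> x; rewrite eq_sym.
  rewrite filter_pred1_uniq ?undup_uniq // mem_undup map_f //.
- move=> mu; rewrite mem_undup; apply/mapP/idP => [[r rs ->]|p0].
    have [_ _ r0] := sP r rs; apply: contraNneq r0 => p0; apply/eqP/lfunP => v.
    have z : pi (pwt r) v = 0 by rewrite p0; exact: zero_lfunE.
    by have := rpi r (pwt r) v rs; rewrite eqxx z linear0 => <-; exact/esym/zero_lfunE.
  apply: contrapT => nr; case/eqP: p0; rewrite /pi big_seq_cond big1 // => r /andP[rs /eqP e].
  by case: nr; exists r.
- move=> mu; split=> [v|t v th|W v Ws vW]; first by rewrite pipi eqxx.
    rewrite !piE -[in RHS]adE linear_sum /= big_seq_cond [RHS]big_seq_cond.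
    by apply: eq_bigr => r /andP[/sP[[_ rc _] _ _] _]; rewrite !adE rc.
  by rewrite piE big_seq_cond; apply: memv_suml => r /andP[/sP[[_ _ rs] _ _] _]; apply: rs.
- move=> mu t v; rewrite piE big_seq_cond.
  have E := iter_lin (adsh (mu t) (vsval t)) N.
  elim/big_ind: _ => [|x y x0 y0|r /andP[rs /eqP <-]]; first exact: lfun_iter0.
    by rewrite (linDf E) x0 y0 addr0.
  by have [? ? ?] := sP r rs; apply: primary_pwt.
Qed.

End WeightDecomposition.

(** * Engel's theorem *)

Section Engel.

Variables (K : numClosedFieldType) (g : lieSuperalgebra K).
Implicit Types (U V W P : {vspace g}).
Local Notation br := (@lsa_br K g).
Local Notation N := (\dim {:g}).

Lemma brvS U V W : (V <= W)%VS -> (brv U V <= brv U W)%VS.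
Proof. by move=> /subvP VW; apply/brvP => x y xU /VW; apply: mem_brv. Qed.

Lemma iter_brv_stable U W n : (brv U W <= W)%VS ->
  (brv U (iter n (brv U) W) <= iter n (brv U) W)%VS.
Proof. by move=> UW; elim: n => // n IH; apply: brvS. Qed.

Lemma brv_span (l : seq g) V W :
  (forall x y, x \in l -> y \in V -> br x y \in W) -> (brv <<l>> V <= W)%VS.
Proof.
move=> lV; apply/brvP => x y xl yV.
rewrite (coord_span (X := in_tuple l) xl) br_suml; apply: memv_suml => i _.
by rewrite brZl memvZ // lV // mem_nth.
Qed.

(** Among [W], [[U, W]], [[U, [U, W]]] and so on, the last term not contained in [P] provides
    [y]. *)
Lemma nil_deep U W P n : (brv U W <= W)%VS -> iter n (brv U) W = 0%VS ->
  ~~ (W <= P)%VS -> exists y, [/\ y \in W, y \notin P & forall k, k \in U -> br k y \in P].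
Proof.
elim: n W => [|n IH] W UW; first by move=> /= ->; rewrite sub0v.
rewrite iterSr => Un WP; have [UP|UP] := boolP (brv U W <= P)%VS.
  have [y yW yP] := subvPn WP; exists y; split=> // k kU.
  exact: (subvP UP) (mem_brv kU yW).
have [y [yW yP yU]] := IH _ (brvS U UW) Un UP.
by exists y; split=> //; apply: (subvP UW).
Qed.

Variables (S : g -> Prop) (M0 : {vspace g}).
Hypotheses (Se : forall s, S s -> s \in even_part g)
  (Sbr : forall s s', S s -> S s' -> S (br s s'))
  (SM : forall s v, S s -> v \in M0 -> br s v \in M0)
  (Sn : forall s v, S s -> v \in M0 -> iter N (ad s) v = 0)
  (S0 : forall s, S s -> s \in M0).

(** The new [s] normalizes the span of [l], hence preserves the descending series of [l] and acts
    nilpotently on its layers. *)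
Lemma engel_extend (l : seq g) n s0 : (forall s, s \in l -> S s) ->
  iter n (brv <<l>>) M0 = 0%VS -> S s0 -> s0 \notin <<l>>%VS ->
  exists s n', [/\ S s, s \notin <<l>>%VS & iter n' (brv <<s :: l>>) M0 = 0%VS].
Proof.
move=> lS ln Ss0 s0l; pose M i := iter i (brv <<l>>) M0.
have lM : (brv <<l>> M0 <= M0)%VS by apply: brv_span => x y /lS; apply: SM.
have MS i : (M i.+1 <= M i)%VS by apply: iter_brv_stable.
(* Bracketing [s0] with elements of [l] descends the series [M], which ends at 0 and so inside the
   span; the last element outside it is normalized by [l]. *)
have [s [Ss sl sK]] : exists s, [/\ S s, s \notin <<l>>%VS & forall k, k \in l -> br k s \in <<l>>%VS].
  suff H j : forall s, S s -> s \notin <<l>>%VS -> s \in M (n - j)%N ->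
      exists s, [/\ S s, s \notin <<l>>%VS & forall k, k \in l -> br k s \in <<l>>%VS].
    by apply: (H n s0 Ss0 s0l); rewrite subnn; apply: S0.
  elim: j => [|j IH] s Ss sl sM.
    by move: sM sl; rewrite subn0 /M ln memv0 => /eqP->; rewrite mem0v.
  have [/allP a|/allPn[k kl ks]] := boolP (all (fun k => br k s \in <<l>>%VS) l); first by exists s.
  apply: (IH (br k s) (Sbr (lS _ kl) Ss) ks).
  have : br k s \in M (n - j.+1).+1 by apply: mem_brv => //; apply: memv_span.
  have [nj|nj] := ltnP j n; first by rewrite subnSK.
  have /subvP := MS (n - j.+1)%N; rewrite (eqP (_ : n - j.+1 == 0)%N) ?subn_eq0 ?(leq_trans nj) //.
  by rewrite (eqP (_ : n - j == 0)%N) ?subn_eq0 // => /[apply].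
have sKK : (brv <<l>> <[s]> <= <<l>>)%VS.
  by apply: brv_span => x y xl /vlineP[c ->]; rewrite brZr memvZ // sK.
have sM i x : x \in M i -> br s x \in M i.
  elim: i x => [|i IH] x; first exact: SM.
  have : (M i.+1 <= ad s @^-1: M i.+1)%VS.
    apply/brvP => k m kl mM; rewrite -memv_preim adE even_der ?Se //.
    rewrite memvD ?mem_brv // ?IH //.
    rewrite br_even_skew ?Se // memvN; apply: (subvP sKK); apply: mem_brv => //.
    exact: memv_line.
  by move=> /subvP H /H; rewrite -memv_preim adE.
(* Modulo [M i.+1] the elements of [l] act as zero on [M i], so only powers of [s] survive. *)
have step i j : (iter j (brv <<s :: l>>) (M i) <= lpow (ad s) j @: M i + M i.+1)%VS.
  elim: j => [|j IH].
    apply/subvP => x xM; apply: (subvP (addvSl _ _)).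
    by apply/memv_imgP; exists x; rewrite ?id_lfunE.
  rewrite iterS; apply: subv_trans (brvS _ IH) _; apply: brv_span => x _ xl /memv_addP[_ /memv_imgP[u uM ->] [m mM ->]].
  have sju : lpow (ad s) j u \in M i.
    by rewrite lpowE; elim: j {IH} => //= j IH; rewrite adE sM.
  move: xl; rewrite inE => /orP[/eqP->|xl].
    rewrite brDr memv_add ?sM //; apply/memv_imgP; exists u => //.
    by rewrite !lpowE iterS adE.
  apply: (subvP (addvSr _ _)); rewrite brDr memvD // mem_brv ?memv_span //.
  exact: (subvP (MS _)).
(* Each of the [n] layers is exhausted after [N] steps. *)
exists s, (n * N)%N; split=> //; apply/eqP; rewrite -subv0 -[X in (_ <= X)%VS]ln -/(M n).
elim: n {ln} => [|n IH]; first by rewrite mul0n.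
rewrite mulSn iterD; have mono k V W : (V <= W)%VS ->
    (iter k (brv <<s :: l>>) V <= iter k (brv <<s :: l>>) W)%VS.
  by move=> VW; elim: k => // k IHk; apply: brvS.
apply: subv_trans (mono _ _ _ IH) _; apply: subv_trans (step n N) _.
apply/subvP => _ /memv_addP[_ /memv_imgP[u uM ->] [m mM ->]].
rewrite lpowE Sn ?add0r //.
by elim: n {IH m mM} u uM => // n IH u /(subvP (MS n)); apply: IH.
Qed.

(** Jacobson's form of Engel's theorem, for a set closed under brackets that need not be a subspace;
    the list grows until its span contains [S]. *)
Lemma engel : exists l : seq g, [/\ forall s, s \in l -> S s, forall s, S s -> s \in <<l>>%VS
  & exists n, iter n (brv <<l>>) M0 = 0%VS].
Proof.
suff H k (l : seq g) : (forall s, s \in l -> S s) -> (exists n, iter n (brv <<l>>) M0 = 0%VS) ->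
    (N - \dim <<l>> < k)%N -> exists l : seq g, [/\ forall s, s \in l -> S s,
    forall s, S s -> s \in <<l>>%VS & exists n, iter n (brv <<l>>) M0 = 0%VS].
  apply: (H N.+1 [::]) => //; last by rewrite ltnS leq_subr.
  by exists 1%N; apply/eqP; rewrite -subv0; apply: brv_span.
elim: k l => // k IH l lS [n ln] lk.
have [a|/existsNP[s0 /not_implyP[Ss0 /negP s0l]]] := pselect (forall s, S s -> s \in <<l>>%VS).
  by exists l; split=> //; exists n.
have [s [n' [Ss sl sn]]] := engel_extend lS ln Ss0 s0l.
apply: (IH (s :: l)); first by move=> x; rewrite inE => /orP[/eqP->|/lS].
  by exists n'.
have d : (\dim <<l>> < \dim <<s :: l>>)%N.
  rewrite span_cons ltn_neqAle dimvS ?addvSr // andbT; apply/eqP => e.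
  have := dimv_leqif_sup (addvSr <[s]> <<l>>); rewrite -e => -[_]; rewrite eqxx => /esym/subvP H.
  by case/negP: sl; apply: H; apply: (subvP (addvSl _ _)); apply: memv_line.
rewrite ltnS in lk; apply: leq_trans lk; rewrite ltn_sub2l //.
by apply: leq_trans d _; rewrite dimvS ?subvf.
Qed.

End Engel.

(** * Root strings and the trace form *)

Section WeightSpaces.

Variables (K : numClosedFieldType) (g : lieSuperalgebra K) (h : {vspace g}).
Hypothesis he : (h <= even_part g)%VS.

Local Notation br := (@lsa_br K g).
Local Notation N := (\dim {:g}).
Local Notation H := (subvs_of h).
Local Notation D := (hdual h).
Local Notation hstable := (hstable h).

Variables (wts : seq D) (pi : D -> 'End(g)).
Hypothesis wd : weight_dec wts pi.
Let wtu := wd_uniq wd.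
Let pi1 := wd_sum wd.
Let wtP := wd_mem wd.
Let pipi := wd_pipi wd.
Let pih := wd_hproj wd.
Let pin := wd_nil wd.

Lemma H_even (t : H) : vsval t \in even_part g.
Proof. exact: (subvP he) (subvsP t). Qed.

Lemma pi_sum v : v = \sum_(mu <- wts) pi mu v.
Proof. by rewrite -sum_lfunE pi1 id_lfunE. Qed.

Lemma pi_out mu v : mu \notin wts -> pi mu v = 0.
Proof. by rewrite wtP negbK => /eqP->; exact: zero_lfunE. Qed.

Lemma pi_idem mu v : pi mu (pi mu v) = pi mu v.
Proof. by rewrite pipi eqxx. Qed.

Lemma pi_other mu nu v : pi nu v = v -> mu != nu -> pi mu v = 0.
Proof. by move=> <- /negbTE mn; rewrite pipi mn. Qed.

Lemma pi_br_h mu (t : H) v : pi mu (br (vsval t) v) = br (vsval t) (pi mu v).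
Proof. by have [_ c _] := pih mu; apply: c; apply: subvsP. Qed.

Lemma pi_wt mu v : pi mu v = v -> v != 0 -> mu \in wts.
Proof. by move=> e; apply: contraNT => /(pi_out v) e0; rewrite -e e0. Qed.

Lemma geig_disj (a b : K) (t : g) n k v : a != b ->
  iter n (adsh a t) v = 0 -> iter k (adsh b t) v = 0 -> v = 0.
Proof.
move=> ab; have comm u : adsh b t (adsh a t u) = adsh a t (adsh b t u).
  by rewrite !adshE !brE; lin K g.
elim: n v => // n IH v; rewrite iterSr => vn vk.
have vk' : iter k (adsh b t) (adsh a t v) = 0.
  suff -> : iter k (adsh b t) (adsh a t v) = adsh a t (iter k (adsh b t) v) by rewrite vk linear0.
  by elim: (k) => // m IHm; rewrite !iterS IHm comm.
have /eqP := IH _ vn vk'; rewrite adshE subr_eq0 => /eqP tv.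
have : iter k (adsh b t) v = (a - b) ^+ k *: v.
  elim: (k) => [|m IHm]; first by rewrite expr0 scale1r.
  by rewrite iterS IHm linearZ /= adshE tv exprS -scalerBl scalerA mulrC.
rewrite vk => /esym/eqP; rewrite scaler_eq0 expf_eq0 subr_eq0 (negbTE ab) andbF.
by move=> /eqP.
Qed.

Lemma wspaceP (mu : D) v : (forall t : H, iter N (adsh (mu t) (vsval t)) v = 0) -> pi mu v = v.
Proof.
move=> v0; rewrite [in RHS](pi_sum v) {1}(pi_sum v) linear_sum /=; apply: eq_bigr => nu _.
rewrite pipi; case: eqP => [-> //|/eqP nm].
have [t ht] : exists t, nu t != mu t.
  apply: contrapT => e; case/eqP: nm; apply/lfunP => t; apply: contrapT => et; apply: e.
  by exists t; apply/eqP => /esym.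
apply/esym/(geig_disj ht (pin nu t v) (k := N)).
suff -> : forall n, iter n (adsh (mu t) (vsval t)) (pi nu v) = pi nu (iter n (adsh (mu t) (vsval t)) v).
  by rewrite v0 linear0.
elim=> // n IH; rewrite !iterS IH !adshE [in RHS]linearB [in RHS]linearZ /=.
by rewrite pi_br_h.
Qed.

Lemma pi_br al mu x v : pi al x = x -> pi mu v = v -> pi (al + mu) (br x v) = br x v.
Proof.
move=> ax mv; apply: wspaceP => t; apply: (@iter_stab _ _ _ (N + N)).
by rewrite add_lfunE; apply: adsh_leibniz; [exact: H_even|rewrite -ax; exact: pin|rewrite -mv; exact: pin].
Qed.

Lemma pi_even mu v : v \in even_part g -> pi mu v \in even_part g.
Proof.
by have [_ _ s] := pih mu; apply: s => t u th; apply: br_ee; apply: (subvP he).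
Qed.

Lemma pi_odd mu v : v \in odd_part g -> pi mu v \in odd_part g.
Proof.
by have [_ _ s] := pih mu; apply: s => t u th; apply: br_eo; apply: (subvP he).
Qed.

Local Notation pr0 := (pr0 g).

Lemma pr0_pi mu v : pr0 (pi mu v) = pi mu (pr0 v).
Proof.
rewrite {1}(pr0_pro v) !linearD /= (pr0_even (pi_even mu (pr0_mem v))).
by rewrite (pr0_odd (pi_odd mu (pro_mem v))) addr0.
Qed.

Lemma pr0_br x v : x \in even_part g -> pr0 (br x v) = br x (pr0 v).
Proof.
move=> xe; rewrite {1}(pr0_pro v) brDr linearD /= (pr0_even (br_ee xe (pr0_mem v))).
by rewrite (pr0_odd (br_eo xe (pro_mem v))) addr0.
Qed.

Lemma ad_br x y : x \in even_part g ->
  ad (br x y) = (ad x \o ad y)%VF - (ad y \o ad x)%VF.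
Proof.
move=> xe; apply/lfunP => v; rewrite add_lfunE opp_lfunE !comp_lfunE !adE.
by rewrite even_der // addrK.
Qed.

(** Since [Q] commutes with [ad e], the operator is the commutator of [ad e] with [ad f \o Q]. *)
Lemma ftr_commutator e f (Q : 'End(g)) : e \in even_part g ->
  (forall v, Q (br e v) = br e (Q v)) ->
  ftr (ad (br e f) \o Q)%VF = 0.
Proof.
move=> ee Qe; rewrite ad_br // comp_lfunDl comp_lfunNl ftrB -!comp_lfunA.
have -> : (ad e \o Q = Q \o ad e)%VF by apply/lfunP => v; rewrite !comp_lfunE !adE Qe.
by rewrite ftrC -comp_lfunA subrr.
Qed.

Section Strings.

Variable P : 'End(g).
Hypotheses (PP : forall v, P (P v) = P v) (Ppi : forall mu v, P (pi mu v) = pi mu (P v))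
  (Pbr : forall x v, x \in even_part g -> P (br x v) = br x (P v)).

(** The multiplicity of [mu] in the image of [P], as an element of [K]. The projection [P] will be
    the identity or the projection to the even part. *)
Definition mult (mu : D) : K := ftr (pi mu \o P)%VF.

Lemma piP_idem mu v : (pi mu \o P)%VF ((pi mu \o P)%VF v) = (pi mu \o P)%VF v.
Proof. by rewrite !comp_lfunE Ppi PP pi_idem. Qed.

Lemma mult_nat mu : exists n, mult mu = n%:R.
Proof.
have [p0|p0] := eqVneq (pi mu \o P)%VF 0; first by exists 0%N; rewrite /mult p0 ftr0.
by have [n e] := ftr_idem (@piP_idem mu) p0; exists n.+1; exact: e.
Qed.

Lemma mult_ge0 mu : 0 <= mult mu.
Proof. by have [n ->] := mult_nat mu; rewrite ler0n. Qed.

Lemma mult_gt0 mu v : pi mu v = v -> P v = v -> v != 0 -> 0 < mult mu.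
Proof.
move=> mv Pv v0; have p0 : (pi mu \o P)%VF != 0.
  by apply: contraNneq v0 => p0; rewrite -mv -{1}Pv -comp_lfunE p0 zero_lfunE.
by have [n e] := ftr_idem (@piP_idem mu) p0; rewrite (e : mult mu = _) ltr0Sn.
Qed.

Lemma ftr_ad_pi (G : 'End(g)) (mu : D) (t : H) :
  (forall v, G (pi mu (P v)) = pi mu (P (G v))) ->
  (forall v, G (br (vsval t) v) = br (vsval t) (G v)) ->
  ftr (G \o (ad (vsval t) \o (pi mu \o P)))%VF = mu t * ftr (G \o (pi mu \o P))%VF.
Proof.
move=> Gp Gt; apply: ftr_eig => [v|v|v|v|//]; first exact: piP_idem.
- by rewrite !comp_lfunE Pbr ?H_even // pi_br_h.
- by rewrite comp_lfunE pin.
- by rewrite !comp_lfunE.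
Qed.

Section TheString.

Variable T : pred D.

Definition strp : 'End(g) := \sum_(nu <- wts | T nu) (pi nu \o P)%VF.

Lemma strpE v : strp v = \sum_(nu <- wts | T nu) pi nu (P v).
Proof. by rewrite sum_lfunE; apply: eq_bigr => nu _; rewrite comp_lfunE. Qed.

Lemma strpP v : strp v = strp (P v).
Proof. by rewrite !strpE PP. Qed.

Lemma strp_wt ka v : pi ka v = v -> P v = v -> strp v = if T ka then v else 0.
Proof.
move=> kv Pv; rewrite strpE Pv; have [kw|kw] := boolP (ka \in wts).
  rewrite big_mkcond (bigD1_seq ka) //= kv big1 ?addr0 // => nu nk.
  by rewrite (pi_other kv nk) if_same.
have -> : v = 0 by rewrite -kv; exact: pi_out.
by rewrite if_same big1 // => nu _; rewrite linear0.
Qed.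

Lemma strp_br al e v : pi al e = e -> e \in even_part g ->
  (forall ka u, T ka != T (al + ka) -> pi ka u = u -> P u = u -> br e u = 0) ->
  strp (br e v) = br e (strp v).
Proof.
move=> ea ee Te; rewrite strpP Pbr // [strp v]strpP; set u := P v.
have Pu : P u = u by rewrite /u PP.
rewrite {1}(pi_sum u) [in RHS](pi_sum u) br_sumr !linear_sum /= br_sumr.
apply: eq_bigr => ka _; set w := pi ka u; have kw : pi ka w = w by rewrite /w pi_idem.
have Pw : P w = w by rewrite /w Ppi Pu.
rewrite (@strp_wt (al + ka) (br e w)) ?(strp_wt kw Pw) ?pi_br ?Pbr ?Pw //.
have [->|ne] := eqVneq (T ka) (T (al + ka)); first by case: ifP; rewrite ?br0r.
by rewrite (Te ka) ?if_same //; case: ifP; rewrite ?br0r // (Te ka).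
Qed.

(** By hypothesis [e] cannot cross the boundary of [T], so the projection onto these weight spaces
    commutes with [ad e] and [[e, f]] has trace 0 on them; the sum is that trace, weight by
    weight. *)
Lemma string_sum al e f (t : H) : pi al e = e ->
  e \in even_part g -> vsval t = br e f ->
  (forall ka u, T ka != T (al + ka) -> pi ka u = u -> P u = u -> u != 0 ->
     forall w, pi (al + ka) w = w -> P w = w -> w = 0) ->
  \sum_(nu <- wts | T nu) (nu t : K) * mult nu = 0.
Proof.
move=> ea ee te Tn.
have E : ftr (ad (vsval t) \o strp)%VF = 0.
  rewrite te; apply: (ftr_commutator f ee) => v; apply: (strp_br v ea ee) => ka u Tk uk Pu.
  have [->|u0] := eqVneq u 0; first by rewrite br0r.
  by apply: (Tn ka u Tk uk Pu u0); rewrite ?pi_br // Pbr // Pu.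
rewrite -[RHS]E.
have -> : (ad (vsval t) \o strp)%VF = \sum_(nu <- wts | T nu) (ad (vsval t) \o (pi nu \o P))%VF.
  apply/lfunP => v; rewrite comp_lfunE !sum_lfunE linear_sum /=.
  by apply: eq_bigr => nu _; rewrite [RHS]comp_lfunE.
rewrite ftr_sum; apply: eq_bigr => nu _.
have := @ftr_ad_pi \1%VF nu t; rewrite !comp_lfun1l => -> // v; rewrite !id_lfunE //.
Qed.

End TheString.
End Strings.
End WeightSpaces.

Section RootSpaces.

Variables (K : numClosedFieldType) (g : lieSuperalgebra K) (h : {vspace g}).
Hypotheses (he : (h <= even_part g)%VS) (hh : (brv h h <= h)%VS) (hn : lie_nilpotent h)
  (hself : forall x, x \in even_part g -> (forall y, y \in h -> lsa_br x y \in h) -> x \in h).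

Local Notation br := (@lsa_br K g).
Local Notation N := (\dim {:g}).
Local Notation H := (subvs_of h).
Local Notation D := (hdual h).
Local Notation pr0 := (pr0 g).
Local Notation even := (even_part g).

Variables (wts : seq D) (pi : D -> 'End(g)).
Hypothesis wd : weight_dec wts pi.

Lemma h_wt0 x : x \in h -> pi 0%R x = x.
Proof.
move=> xh; apply: (wspaceP wd) => t; rewrite zero_lfunE.
have [m xm] := h_nil hn (subvsP t) xh; exact: iter_stab xm.
Qed.

(** Engel's theorem for [h] on the zero weight space of the even part: were that space larger than
    [h], it would contain an element outside [h] normalizing [h]. *)
Lemma wt0_h x : x \in even -> pi 0%R x = x -> x \in h.
Proof.
pose M0 : {vspace g} := (even :&: limg (pi 0%R))%VS.
have M0P y : y \in M0 <-> y \in even /\ pi 0%R y = y.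
  rewrite memv_cap; split=> [/andP[-> /memv_imgP[u _ ->]]|[-> <-]]; first by rewrite (pi_idem wd).
  by rewrite memv_img // memvf.
have hM s v : s \in h -> v \in M0 -> br s v \in M0.
  move=> sh /M0P[ve v0]; apply/M0P; split; first by apply: br_ee => //; apply: (subvP he).
  by have := pi_br he wd (h_wt0 sh) v0; rewrite addr0.
have [s sh|s s' sh s'h|//|s v sh /M0P[_ v0]|s sh|l [lh hl [n ln]]] := @engel K g (fun s => s \in h) M0.
- exact: (subvP he).
- by apply: (subvP hh); apply: mem_brv.
- have E u : ad s u = adsh 0 s u by rewrite adshE adE scale0r subr0.
  have := wd_nil wd 0%R (vsproj h s) v; rewrite v0 zero_lfunE vsprojK // => vn.
  by rewrite -[RHS]vn; apply: eq_iter.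
- by apply/M0P; rewrite h_wt0 // (subvP he).
have lM : (brv <<l>> M0 <= M0)%VS by apply: brv_span => u v /lh; apply: hM.
have [M0h|M0h] := boolP (M0 <= h)%VS.
  by move=> xe x0; apply: (subvP M0h); apply/M0P.
have [y [/M0P[ye _] yh yl]] := nil_deep lM ln M0h.
by case/negP: yh; apply: hself => // z zh; rewrite br_even_skew // memvN yl // hl.
Qed.

Lemma int_comb (al : D) (i : int) (t : H) : (al *~ i) t = i%:~R * (al t : K).
Proof. by rewrite -scaler_int scale_lfunE. Qed.

(** The full [al]-string through [mu] is closed under adding [al]. The weights there are [mu] plus
    integer multiples of [al], so the vanishing trace is a linear relation in which [mu t] has a
    positive coefficient. *)
Lemma string_rat mu al e f (t : H) : pi al e = e -> e \in even -> vsval t = br e f ->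
  mu \in wts -> exists2 q, q \is Num.real & (mu t : K) = q * (al t : K).
Proof.
move=> ea ee te mw; pose T (ka : D) := `[< exists i : int, ka = mu + al *~ i >].
have TT ka : T ka = T (al + ka).
  apply: asbool_equiv_eq; split=> -[i ei].
    by exists (i + 1); rewrite ei mulrzDr addrCA [al + _]addrC.
  by exists (i - 1); rewrite mulrzBr addrA -ei addrAC subrr add0r.
pose m := mult pi \1%VF.
have S : \sum_(nu <- wts | T nu) (nu t : K) * m nu = 0.
  apply: (string_sum he wd _ _ _ ea ee te) => [v|nu v|u v _|ka u]; rewrite ?id_lfunE //.
  by rewrite -TT eqxx.
have m0 nu : 0 <= m nu by apply: (mult_ge0 wd) => [v|ka v]; rewrite !id_lfunE.
have mm : 0 < m mu.
  move: mw; rewrite (wd_mem wd) => p0.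
  have [v v0] : exists v, pi mu v != 0.
    apply: contrapT => e0; case/eqP: p0; apply/lfunP => v; rewrite zero_lfunE.
    by apply: contrapT => v0; apply: e0; exists v; apply/eqP.
  by apply: (mult_gt0 wd _ _ (pi_idem wd mu v)) => // [u|ka u|]; rewrite !id_lfunE.
have [ix ixP] : {ix : D -> int & forall ka, T ka -> ka = mu + al *~ ix ka}.
  apply: (@choice _ _ (fun ka i => T ka -> ka = mu + al *~ i)) => ka.
  have [/asboolP[i ei]|nT] := boolP (T ka); first by exists i.
  by exists 0.
pose M := \sum_(nu <- wts | T nu) m nu.
pose A := \sum_(nu <- wts | T nu) (ix nu)%:~R * m nu.
have E : (mu t : K) * M + (al t : K) * A = 0.
  rewrite -[RHS]S !mulr_sumr -big_split /=; apply: eq_bigr => nu /ixP e'.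
  have -> : (nu t : K) = (mu t : K) + (ix nu)%:~R * (al t : K).
    by rewrite {1}e' add_lfunE int_comb.
  by rewrite mulrDl [(al t : K) * _]mulrCA mulrA.
have M0 : 0 < M.
  rewrite /M big_mkcond (bigD1_seq mu) ?(wd_uniq wd) //=.
  have -> : T mu by apply/asboolP; exists 0; rewrite mulr0z addr0.
  by apply: ltr_wpDr mm; apply: sumr_ge0 => nu _; case: ifP.
exists (- A / M); last first.
  apply: (mulIf (lt0r_neq0 M0)); rewrite mulrAC divfK ?lt0r_neq0 //.
  by apply/eqP; rewrite -subr_eq0 mulNr opprK [A * _]mulrC E.
apply: rpredM; last by rewrite rpredV; exact: gtr0_real.
rewrite rpredN; apply: rpred_sum => nu _; apply: rpredM; first exact: realz.
exact: ger0_real.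
Qed.

(** The half string downwards from [be] can only be left at its top, where the next weight space is
    zero. The vanishing trace equates [be t] times a positive number with a sum of terms [2 * n]
    times multiplicities. *)
Lemma string_pos be al e f (t : H) u : pi al e = e -> e \in even -> vsval t = br e f ->
  al t = 2%:R -> u \in even -> pi be u = u -> u != 0 ->
  (forall w, w \in even -> pi (al + be) w = w -> w = 0) -> 0 <= (be t : K).
Proof.
move=> ea ee te a2 ue bu u0 nw; pose T (ka : D) := `[< exists n : nat, ka = be - al *+ n >].
have p0P v : pr0 v = v -> v \in even by move=> <-; exact: pr0_mem.
have pp v : pr0 (pr0 v) = pr0 v by rewrite pr0_even ?pr0_mem.
pose m := mult pi pr0.
have S : \sum_(nu <- wts | T nu) (nu t : K) * m nu = 0.
  apply: (string_sum he wd _ _ _ ea ee te) => [v|nu v|v w ve|ka v TT kv /p0P ve v0 w kw /p0P we] //.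
  - exact: (pr0_pi he wd).
  - exact: pr0_br.
  apply: nw => //; rewrite -{2}kw; congr (pi _ w).
  have [/asboolP[[|n] en]|nT] := boolP (T ka).
  - by rewrite en mulr0n subr0.
  - case/negP: TT; apply/eqP; apply: asbool_equiv_eq; split=> _.
      by exists n; rewrite en mulrS opprD addrCA [al + _]addrA subrr add0r.
    by exists n.+1.
  case/negP: TT; apply/eqP; apply: asbool_equiv_eq; split=> [Tk|[n en]].
    by case/negP: nT; apply/asboolP.
  by exists n.+1; rewrite mulrS opprD addrCA -en addrA addNr add0r.
have m0 nu : 0 <= m nu by apply: (mult_ge0 wd) => // ka v; exact: (pr0_pi he wd).
have mm : 0 < m be.
  by apply: (mult_gt0 wd _ _ bu) => // [ka v|]; [exact: (pr0_pi he wd)|exact: pr0_even].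
have [ix ixP] : {ix : D -> nat & forall ka, T ka -> ka = be - al *+ ix ka}.
  apply: (@choice _ _ (fun ka i => T ka -> ka = be - al *+ i)) => ka.
  have [/asboolP[i ei]|nT] := boolP (T ka); first by exists i.
  by exists 0%N.
pose M := \sum_(nu <- wts | T nu) m nu.
pose A := \sum_(nu <- wts | T nu) (2 * ix nu)%:R * m nu.
have E : (be t : K) * M = A.
  apply/eqP; rewrite -subr_eq0 -[X in _ == X]S mulr_sumr -sumrB; apply/eqP/eq_bigr => nu /ixP e'.
  have -> : (nu t : K) = (be t : K) - (2 * ix nu)%:R.
    by rewrite {1}e' add_lfunE opp_lfunE -scaler_nat scale_lfunE a2 natrM mulrC.
  by rewrite mulrBl.
have M0 : 0 < M.
  rewrite /M big_mkcond (bigD1_seq be) ?(wd_uniq wd) ?(pi_wt wd bu) //=.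
  have -> : T be by apply/asboolP; exists 0%N; rewrite mulr0n subr0.
  by apply: ltr_wpDr mm; apply: sumr_ge0 => nu _; case: ifP.
rewrite -(pmulr_lge0 _ M0) E; apply: sumr_ge0 => nu _; rewrite mulr_ge0 //.
Qed.

End RootSpaces.

(** * The trace form of the adjoint representation *)

Section TraceForm.

Variables (K : numClosedFieldType) (g : lieSuperalgebra K) (h : {vspace g}).
Hypotheses (he : (h <= even_part g)%VS) (hh : (brv h h <= h)%VS) (hn : lie_nilpotent h)
  (hself : forall x, x \in even_part g -> (forall y, y \in h -> lsa_br x y \in h) -> x \in h).

Local Notation br := (@lsa_br K g).
Local Notation N := (\dim {:g}).
Local Notation H := (subvs_of h).
Local Notation D := (hdual h).
Local Notation even := (even_part g).

Variables (wts : seq D) (pi : D -> 'End(g)).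
Hypothesis wd : weight_dec wts pi.

(** The ordinary trace over all of [g], not the supertrace: the later arguments rest on positivity
    of sums of squares. *)
Definition trf x y : K := ftr (@ad K g x \o ad y)%VF.

Lemma ad_lin c x y : ad (c *: x + y) = c *: ad x + ad y :> 'End(g).
Proof. by apply/lfunP => v; rewrite add_lfunE scale_lfunE !adE brDl brZl. Qed.

Lemma trfC x y : trf x y = trf y x. Proof. exact: ftrC. Qed.

Lemma trf_lin c x y z : trf (c *: x + y) z = c * trf x z + trf y z.
Proof. by rewrite /trf ad_lin comp_lfunDl -comp_lfunZl ftrD ftrZ. Qed.

Lemma trfD x y z : trf (x + y) z = trf x z + trf y z.
Proof. by rewrite -[x]scale1r trf_lin mul1r scale1r. Qed.

Lemma trf0 z : trf 0 z = 0.
Proof. by have := trf_lin (-1) 0 0 z; rewrite scaler0 addr0 mulN1r addNr. Qed.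

Lemma trf_wt x y : trf y x = \sum_(mu <- wts) trf y (pi mu x).
Proof.
rewrite trfC {1}(pi_sum wd x); elim: (wts) => [|mu s IH]; rewrite ?big_nil ?trf0 //.
by rewrite !big_cons trfD IH trfC.
Qed.

Lemma trf_inv x y z : x \in even -> y \in even -> trf (br x y) z = trf x (br y z).
Proof.
move=> xe ye; rewrite /trf !ad_br // comp_lfunDl comp_lfunDr comp_lfunNl comp_lfunNr.
rewrite !ftrB; congr (_ - _); first by rewrite comp_lfunA.
by rewrite -comp_lfunA ftrC comp_lfunA.
Qed.

(** The diagonal blocks with respect to the weight decomposition vanish. *)
Lemma ftr_shift (F : 'End(g)) : (forall mu v, pi mu (F (pi mu v)) = 0) -> ftr F = 0.
Proof.
move=> F0; have -> : F = \sum_(mu <- wts) (F \o pi mu)%VF.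
  apply/lfunP => v; rewrite sum_lfunE {1}(pi_sum wd v) linear_sum /=.
  by apply: eq_bigr => mu _; rewrite comp_lfunE.
rewrite ftr_sum big1 // => mu _.
have -> : (F \o pi mu = (F \o pi mu) \o pi mu)%VF.
  by apply/lfunP => v; rewrite !comp_lfunE (pi_idem wd).
rewrite ftrC (_ : (_ \o _)%VF = 0) ?ftr0 //.
by apply/lfunP => v; rewrite !comp_lfunE F0 zero_lfunE.
Qed.

Lemma trf_shift a b x y : pi a x = x -> pi b y = y -> a + b != 0 -> trf x y = 0.
Proof.
move=> ax yb ab; apply: ftr_shift => mu v; rewrite comp_lfunE !adE.
apply: (pi_other wd (pi_br he wd ax (pi_br he wd yb (pi_idem wd mu v)))).
by rewrite addrA -[X in X != _]add0r (inj_eq (addIr mu)) eq_sym.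
Qed.

Local Notation m := (mult pi \1%VF).

Lemma trf_hh (t : H) : trf (vsval t) (vsval t) = \sum_(mu <- wts) (mu t : K) ^+ 2 * m mu.
Proof.
rewrite /trf; set T := ad (vsval t).
have -> : (T \o T)%VF = \sum_(mu <- wts) (T \o (T \o (pi mu \o \1)))%VF.
  apply/lfunP => v; rewrite sum_lfunE comp_lfunE {1}(pi_sum wd v) !linear_sum /=.
  by apply: eq_bigr => mu _; rewrite !comp_lfunE id_lfunE.
rewrite ftr_sum; apply: eq_bigr => mu _.
have P (G : 'End(g)) : (forall v, G (pi mu v) = pi mu (G v)) ->
    (forall v, G (br (vsval t) v) = br (vsval t) (G v)) ->
    ftr (G \o (ad (vsval t) \o (pi mu \o \1)))%VF = mu t * ftr (G \o (pi mu \o \1))%VF.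
  by move=> Gp Gt; apply: (ftr_ad_pi he wd) => // *; rewrite !id_lfunE.
rewrite P => [|v|v]; rewrite ?adE ?(pi_br_h wd) //.
have := P \1%VF; rewrite !comp_lfun1l => P1.
by rewrite P1 => [|v|v]; rewrite ?id_lfunE // expr2 mulrA.
Qed.

(** Obtained by polarization: the computation of the square uses that the operators involved commute
    with [ad t], and [ad t], [ad u] need not commute when [h] is known only to be nilpotent. *)
Lemma trf_pol (t u : H) : trf (vsval t) (vsval u) = \sum_(mu <- wts) (mu t : K) * (mu u : K) * m mu.
Proof.
set y := RHS; have := trf_hh (t + u).
rewrite linearD /= trfD trfC trfD [trf (vsval u) (_ + _)]trfC trfD !trf_hh (trfC (vsval u) (vsval t)).
set B := trf (vsval t) _; set x := \sum_(mu <- wts) (mu t : K) ^+ 2 * _.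
set z := \sum_(mu <- wts) (mu u : K) ^+ 2 * _.
have -> : \sum_(mu <- wts) (mu (t + u) : K) ^+ 2 * m mu = x + y *+ 2 + z.
  rewrite mulr2n /x /y /z -!big_split /=; apply: eq_bigr => mu _.
  by rewrite linearD /=; ring.
move=> e; have : B *+ 2 = y *+ 2.
  by apply: (addrI x); apply: (addIr z); rewrite -e mulr2n; ring.
by move/eqP; rewrite -subr_eq0 -mulrnBl mulrn_eq0 /= subr_eq0 => /eqP.
Qed.

End TraceForm.

Lemma memv_bigcap_seq (K : fieldType) (V : vectType K) (I : eqType) (s : seq I)
    (F : I -> {vspace V}) z :
  z \in (\bigcap_(i <- s) F i)%VS <-> forall i, i \in s -> z \in F i.
Proof.
elim: s => [|i s IH]; first by rewrite big_nil memvf.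
rewrite big_cons memv_cap; split=> [/andP[zi /IH zs] j|zs].
  by rewrite inE => /orP[/eqP->|/zs].
by rewrite zs ?mem_head //=; apply/IH => j js; rewrite zs // inE js orbT.
Qed.

(** * Complete reducibility and the diagonal action of the Cartan subalgebra *)

Section Reductive.

Variables (K : numClosedFieldType) (g : lieSuperalgebra K) (h : {vspace g}).
Hypotheses (he : (h <= even_part g)%VS) (hh : (brv h h <= h)%VS) (hn : lie_nilpotent h)
  (hself : forall x, x \in even_part g -> (forall y, y \in h -> lsa_br x y \in h) -> x \in h).
Hypotheses (cr : forall i, completely_reducible (lsa_par g i)).

Local Notation br := (@lsa_br K g).
Local Notation N := (\dim {:g}).
Local Notation H := (subvs_of h).
Local Notation D := (hdual h).
Local Notation even := (even_part g).

Variables (wts : seq D) (pi : D -> 'End(g)).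
Hypothesis wd : weight_dec wts pi.

(** The vectors killed by [U] form a submodule for the even part. A nonzero complement would, by
    nilpotency, contain another such vector. *)
Lemma cr_nilpotent_ideal (U : {vspace g}) n : (U <= even)%VS -> (brv even U <= U)%VS ->
  iter n (brv U) fullv = 0%VS -> forall k v, k \in U -> br k v = 0.
Proof.
move=> Ue eU Un k v kU.
suff H i x : x \in lsa_par g i -> br k x = 0.
  by have [v0 [v1 [/(H false) e0 /(H true) e1 ->]]] := evenI v; rewrite brDr e0 e1 addr0.
pose Z : {vspace g} := (lsa_par g i :&: \bigcap_(y <- vbasis U) lker (ad y))%VS.
have ZP z : z \in Z <-> z \in lsa_par g i /\ forall y, y \in U -> br y z = 0.
  rewrite memv_cap; split=> [/andP[-> /memv_bigcap_seq zk]|[-> zk]].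
    split=> // y yU; rewrite (coord_vbasis yU) br_suml big1 // => j _.
    rewrite brZl -adE; have jU : (vbasis U)`_j \in vbasis U by rewrite mem_nth ?size_tuple.
    by have := zk _ jU; rewrite memv_ker => /eqP->; rewrite scaler0.
  by apply/memv_bigcap_seq => y /vbasis_mem yU; rewrite memv_ker adE zk.
have ei a b : a \in even -> b \in lsa_par g i -> br a b \in lsa_par g i.
  by move=> ae bi; exact: (lsa_graded ae bi).
have [||W [Wi We ZW ZW0]] := @cr i Z.
- by apply/subvP => z /ZP[].
- apply/brvP => a z ae /ZP[zi z0]; apply/ZP; split; first exact: ei.
  move=> y yU; have ye := subvP Ue _ yU; rewrite even_der // (z0 y yU) br0r addr0.
  by apply: z0; rewrite br_even_skew // memvN; apply: (subvP eU); apply: mem_brv.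
have UW : (brv U W <= W)%VS.
  by apply/brvP => a b aU bW; apply: (subvP We); apply: mem_brv => //; apply: (subvP Ue).
have Wn : iter n (brv U) W = 0%VS.
  apply/eqP; rewrite -subv0 -Un; elim: (n) => [|j IH]; first exact: subvf.
  exact: brvS.
have [W0|W0] := boolP (W <= 0)%VS; last first.
  have [y [yW y0 yU]] := nil_deep UW Wn W0; case/negP: y0; rewrite -ZW0 memv_cap yW andbT.
  apply/ZP; split=> [|u uU]; first exact: (subvP Wi).
  by apply/eqP; rewrite -memv0 yU.
rewrite -ZW => /memv_addP[z /ZP[_ z0] [w /(subvP W0)]]; rewrite memv0 => /eqP-> ->.
by rewrite addr0 z0.
Qed.

Definition kill (t : H) := forall mu, mu \in wts -> (mu t : K) = 0.
(** The radical of the trace form restricted to the even part. *)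
Definition inrad x := x \in even /\ forall y, y \in even -> trf x y = 0.
Local Notation m := (mult pi \1%VF).

Lemma m_ge0 mu : 0 <= m mu.
Proof. by apply: (mult_ge0 wd) => [v|ka v]; rewrite !id_lfunE. Qed.

Lemma m_gt0 mu v : pi mu v = v -> v != 0 -> 0 < m mu.
Proof. by move=> mv v0; apply: (mult_gt0 wd _ _ mv) => // [u|ka u|]; rewrite !id_lfunE. Qed.

Lemma m_wt mu : mu \in wts -> 0 < m mu.
Proof.
rewrite (wd_mem wd) => p0; have [v v0] : exists v, pi mu v != 0.
  apply: contrapT => e0; case/eqP: p0; apply/lfunP => v; rewrite zero_lfunE.
  by apply: contrapT => v0; apply: e0; exists v; apply/eqP.
exact: m_gt0 (pi_idem wd mu v) v0.
Qed.

Lemma inrad_br x y : inrad x -> y \in even -> inrad (br y x).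
Proof.
move=> [xe x0] ye; split=> [|z ze]; first exact: br_ee.
by rewrite br_even_skew // -[- _]addr0 -scaleN1r trf_lin trf0 addr0 trf_inv // x0 ?mulr0 ?br_ee.
Qed.

Lemma br_opp_h al e f : e \in even -> pi al e = e -> f \in even -> pi (- al) f = f ->
  br e f \in h.
Proof.
move=> ee ea fe fa; apply: (wt0_h he hh hn hself wd); first exact: br_ee.
by have := pi_br he wd ea fa; rewrite subrr.
Qed.

(* On [t] every weight is a real multiple of [al], so the vanishing of the sum
   of squares [trf t t] forces all of them to vanish. *)
Lemma kill_opp al e f (t : H) : e \in even -> pi al e = e -> vsval t = br e f ->
  trf (vsval t) (vsval t) = 0 -> kill t.
Proof.
move=> ee ea te; rewrite (trf_hh he wd) => S0.
suff a0 : (al t : K) = 0.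
  by move=> mu mw; have [q _ ->] := string_rat he wd ea ee te mw; rewrite a0 mulr0.
apply: contrapT => /eqP a0.
have e0 : e != 0.
  apply: contraNneq a0 => e0; have -> : t = 0 by apply: val_inj; rewrite /= te e0 br0l.
  by rewrite linear0.
have r0 mu : mu \in wts -> 0 <= ((mu t : K) / (al t : K)) ^+ 2 * m mu.
  move=> mw; have [q qr ->] := string_rat he wd ea ee te mw; rewrite mulfK //.
  by rewrite mulr_ge0 ?m_ge0 // real_exprn_even_ge0.
have aw := pi_wt wd ea e0.
have : 0 < \sum_(mu <- wts) ((mu t : K) / (al t : K)) ^+ 2 * m mu.
  rewrite (bigD1_seq al) ?(wd_uniq wd) //= divff // expr1n mul1r.
  apply: ltr_wpDr (m_gt0 ea e0); rewrite big_seq_cond; apply: sumr_ge0 => mu /andP[/r0].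
  by [].
suff -> : \sum_(mu <- wts) ((mu t : K) / (al t : K)) ^+ 2 * m mu = 0 by rewrite Order.POrderTheory.ltxx.
transitivity ((\sum_(mu <- wts) (mu t : K) ^+ 2 * m mu) / (al t : K) ^+ 2).
  by rewrite mulr_suml; apply: eq_bigr => mu _; rewrite expr_div_n mulrAC.
by rewrite S0 mul0r.
Qed.

Lemma rad_kill al e f : inrad e -> pi al e = e -> f \in even -> pi (- al) f = f ->
  exists t : H, vsval t = br e f /\ kill t.
Proof.
move=> [ee e0] ea fe fa; exists (vsproj h (br e f)).
have xh := br_opp_h ee ea fe fa; have te := vsprojK xh; split=> //.
by apply: (kill_opp ee ea te); rewrite te trf_inv // e0 // !br_ee.
Qed.

Lemma kill_inrad (t : H) : kill t -> inrad (vsval t).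
Proof.
move=> kt; split=> [|y ye]; first exact: (subvP he) (subvsP t).
rewrite (trf_wt wd) big1_seq // => mu /andP[_ mw].
have [m0|m0] := eqVneq mu 0; last first.
  by apply: (trf_shift he wd (h_wt0 hn wd (subvsP t)) (pi_idem wd mu y)); rewrite add0r.
have yh : pi mu y \in h.
  by apply: (wt0_h he hh hn hself wd); rewrite ?(pi_even he wd) // m0 (pi_idem wd).
have := trf_pol he wd t (vsproj h (pi mu y)); rewrite vsprojK // => ->.
by rewrite big1_seq // => nu /andP[_ /kt ->]; rewrite !mul0r.
Qed.

(** On the weight space of [mu] the commutator has trace 0, and this trace is [mu s] times a
    positive multiplicity. *)
Lemma kill_brhh (t u : H) : exists s : H, vsval s = br (vsval t) (vsval u) /\ kill s.
Proof.
exists (vsproj h (br (vsval t) (vsval u))).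
have xh : br (vsval t) (vsval u) \in h by apply: (subvP hh); apply: mem_brv; apply: subvsP.
split=> [|mu mw]; rewrite ?vsprojK //; set s := vsproj _ _.
have P := @ftr_ad_pi _ _ _ he _ _ wd \1%VF _ _ _ \1%VF mu s.
have Z := @ftr_commutator _ _ (vsval t) (vsval u) (pi mu) (subvP he _ (subvsP t)) (pi_br_h wd mu t).
move: P; rewrite !comp_lfun1l !comp_lfun1r vsprojK // Z => P; apply/eqP.
have := m_wt mw; rewrite /mult comp_lfun1r => /lt0r_neq0/negbTE mn.
have e : 0 = mu s * ftr (pi mu) by apply: P => *; rewrite !id_lfunE.
by move/esym/eqP: e; rewrite mulf_eq0 mn orbF.
Qed.

(* A set of ad-nilpotent elements, containing all root vectors in the radical
   of the trace form, to which Engel's theorem applies. *)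
Definition nilset s := (exists al, [/\ al != 0, inrad s & pi al s = s]) \/
  (exists t : H, vsval t = s /\ kill t).

Lemma nilset_inrad s : nilset s -> inrad s.
Proof. by case=> [[al []]//|[t [<- /kill_inrad]]]. Qed.

Lemma nilset_wt s : nilset s -> exists al, pi al s = s.
Proof.
case=> [[al [_ _ e]]|[t [<- _]]]; first by exists al.
by exists 0; apply: (h_wt0 hn wd); apply: subvsP.
Qed.

(** When the weights cancel, the bracket falls into [h]; there [rad_kill] or [kill_brhh] shows that
    every weight vanishes on it. *)
Lemma nilset_br be e s : e \in even -> pi be e = e -> nilset s -> nilset (br e s).
Proof.
move=> ee eb [[al [a0 sr sa]]|[t [<- kt]]].
  have [b0|b0] := eqVneq (be + al) 0; last first.
    by left; exists (be + al); split=> //; [apply: inrad_br|apply: (pi_br he wd)].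
  have [|t [te kt]] := @rad_kill al s e sr sa ee.
    by rewrite -(_ : be = - al) //; apply/eqP; rewrite -addr_eq0 b0.
  right; exists (- t); split=> [|mu mw]; first by rewrite linearN /= te -br_even_skew.
  by rewrite linearN /= kt // oppr0.
have [b0|b0] := eqVneq be 0; last first.
  left; exists be; split=> //; first by apply: inrad_br => //; apply: kill_inrad.
  by have := pi_br he wd eb (h_wt0 hn wd (subvsP t)); rewrite addr0.
have eh : e \in h by apply: (wt0_h he hh hn hself wd); rewrite // -b0.
by right; have := kill_brhh (vsproj h e) t; rewrite vsprojK.
Qed.

(** The weights [mu], [al + mu], [al *+ 2 + mu] and so on are distinct, so only finitely many of
    them occur. *)
Lemma wt_nilp al s v : al != 0 -> pi al s = s -> iter N (ad s) v = 0.
Proof.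
move=> a0 sa; have E := iter_lin (ad s) N.
rewrite (pi_sum wd v); elim/big_ind: _ => [|x y x0 y0|mu _]; first exact: lfun_iter0.
  by rewrite (linDf E) x0 y0 addr0.
have W n : pi (al *+ n + mu) (iter n (ad s) (pi mu v)) = iter n (ad s) (pi mu v).
  elim: n => [|n IH]; first by rewrite mulr0n add0r (pi_idem wd).
  by rewrite iterS adE mulrS -addrA (pi_br he wd).
have [n nw] : exists n, al *+ n + mu \notin wts.
  apply: contrapT => nn; pose l := [seq al *+ n + mu | n <- iota 0 (size wts).+1].
  have : (size l <= size wts)%N.
    apply: uniq_leq_size => [|_ /mapP[n _ ->]].
      rewrite map_inj_uniq ?iota_uniq // => i j /addIr/eqP.
      wlog ij : i j / (i <= j)%N.
        by move=> H; case/orP: (leq_total i j) => /H // H' e; apply/esym/H'; rewrite eq_sym.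
      rewrite -(subnKC ij) mulrnDr -subr_eq0 opprD addNKr oppr_eq0 -scaler_nat scaler_eq0 (negbTE a0) orbF.
      by rewrite pnatr_eq0 => /eqP->; rewrite addn0.
    by apply: contrapT => /negP nw; apply: nn; exists n.
  by rewrite size_map size_iota ltnn.
by apply: (@iter_stab _ _ _ n); rewrite -W (pi_out wd).
Qed.

Lemma kill_nilp (t : H) v : kill t -> iter N (ad (vsval t)) v = 0.
Proof.
move=> kt; have E := iter_lin (ad (vsval t)) N.
rewrite (pi_sum wd v) big_seq; elim/big_ind: _ => [|x y x0 y0|mu mw]; first exact: lfun_iter0.
  by rewrite (linDf E) x0 y0 addr0.
rewrite -[RHS](wd_nil wd mu t v); apply: eq_iter => u.
by rewrite adshE adE (kt _ mw) scale0r subr0.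
Qed.

(** Engel's theorem makes the span of [nilset] act nilpotently on [g]. It is an ideal of the even
    part, so [cr_nilpotent_ideal] applies. *)
Lemma nilset0 s v : nilset s -> br s v = 0.
Proof.
move=> ns; have [x /nilset_inrad[]|x y nx ny|x y _ _|x y [[al [a0 _ xa]]|[t [<- kt]]] _|x _|l [ln lS [n nl]]] //
    := @engel K g nilset fullv; rewrite ?memvf //.
- by have [al xa] := nilset_wt nx; have [xe _] := nilset_inrad nx; apply: nilset_br xa ny.
- exact: wt_nilp a0 xa.
- exact: kill_nilp.
have le : (<<l>> <= even)%VS by apply/span_subvP => x /ln/nilset_inrad[].
apply: (cr_nilpotent_ideal le _ nl); last exact: lS.
apply/brvP => x y xe yl; rewrite (coord_span (X := in_tuple l) yl) br_sumr.
apply: memv_suml => j _; rewrite brZr memvZ // (pi_sum wd x) br_suml.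
apply: memv_suml => be _; apply: lS; apply: nilset_br (pi_idem wd be x) _.
  exact: (pi_even he wd).
by apply: ln; rewrite mem_nth.
Qed.

(** By [nilset0] such an [e] commutes with [h], which is incompatible with a nonzero weight unless
    [e = 0]. *)
Lemma inrad_root al e : al != 0 -> inrad e -> pi al e = e -> e = 0.
Proof.
move=> a0 er ea; have [t at0] : exists t : H, (al t : K) != 0.
  apply: contrapT => n; case/eqP: a0; apply/lfunP => t; rewrite zero_lfunE.
  by apply: contrapT => t0; apply: n; exists t; apply/eqP.
have en : nilset e by left; exists al.
apply: (geig_disj (t := vsval t) (n := N) (k := 1%N) at0); first by rewrite -ea (wd_nil wd).
by rewrite /= adshE scale0r subr0 br_even_skew ?nilset0 ?oppr0 // (H_even he).
Qed.

(** With [nilpart], the Jordan decomposition of [ad t] along the generalized weight spaces. *)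
Definition diagpart (t : H) : 'End(g) := \sum_(mu <- wts) (mu t : K) *: pi mu.
Definition nilpart (t : H) : 'End(g) := ad (vsval t) - diagpart t.

Lemma diagpart_wt (t : H) mu v : pi mu v = v -> diagpart t v = (mu t : K) *: v.
Proof.
move=> mv; rewrite [in RHS](pi_sum wd v) scaler_sumr sum_lfunE; apply: eq_bigr => nu _.
rewrite scale_lfunE; have [-> //|nm] := eqVneq nu mu.
by rewrite (pi_other wd mv nm) !scaler0.
Qed.

Lemma nilpart_wt (t : H) mu v : pi mu v = v -> nilpart t v = adsh (mu t) (vsval t) v.
Proof. by move=> mv; rewrite add_lfunE opp_lfunE adE (diagpart_wt t mv) adshE. Qed.

Lemma nilpart_pi (t : H) mu v : pi mu (nilpart t v) = nilpart t (pi mu v).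
Proof.
rewrite (nilpart_wt t (pi_idem wd mu v)) adshE add_lfunE opp_lfunE adE linearB /= (pi_br_h wd).
congr (_ - _); rewrite sum_lfunE linear_sum /= (pi_sum wd (_ *: _)); apply: eq_bigr => nu _.
rewrite scale_lfunE !linearZ /= !(wd_pipi wd) [nu == mu]eq_sym.
by case: eqP => [->|_] //; rewrite !scaler0.
Qed.

Lemma nilpart_nil (t : H) v : iter N (nilpart t) v = 0.
Proof.
have E := iter_lin (nilpart t) N.
rewrite (pi_sum wd v); elim/big_ind: _ => [|x y x0 y0|mu _]; first exact: lfun_iter0.
  by rewrite (linDf E) x0 y0 addr0.
rewrite -[RHS](wd_nil wd mu t v); elim: (N) => // n IH; rewrite !iterS IH.
apply: nilpart_wt; elim: n {IH} => [|n IH]; first exact: (pi_idem wd).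
by rewrite iterS adshE linearB linearZ /= (pi_br_h wd) IH.
Qed.

Lemma nilpart_der (t : H) x y :
  nilpart t (br x y) = br (nilpart t x) y + br x (nilpart t y).
Proof.
rewrite (pi_sum wd x) br_suml !linear_sum !br_suml -big_split /=; apply: eq_bigr => a _.
rewrite (pi_sum wd y) br_sumr !linear_sum /= !br_sumr -big_split /=; apply: eq_bigr => b _.
have pa := pi_idem wd a x; have pb := pi_idem wd b y.
rewrite (nilpart_wt t pa) (nilpart_wt t pb) (nilpart_wt t (pi_br he wd pa pb)) add_lfunE.
by rewrite adsh_der // (H_even he).
Qed.

Lemma nilpart_stable (t : H) (W : {vspace g}) v : (brv even W <= W)%VS -> v \in W ->
  nilpart t v \in W.
Proof.
move=> eW vW; have Ws x w : x \in even -> w \in W -> br x w \in W.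
  by move=> xe wW; apply: (subvP eW); apply: mem_brv.
rewrite add_lfunE opp_lfunE adE memvB ?Ws ?(H_even he) // sum_lfunE.
apply: memv_suml => mu _; rewrite scale_lfunE memvZ //.
have [_ _ s] := wd_hproj wd mu; apply: s => // x w xh wW.
by apply: Ws => //; apply: (subvP he).
Qed.

Lemma even_stable i : (brv even (lsa_par g i) <= lsa_par g i)%VS.
Proof. by apply/brvP => a b ae bi; exact: (lsa_graded ae bi). Qed.

(** Only the zero weight component of [z] contributes, and it is some [u] in [h]; [trf_pol] then
    says that [ad t] and its diagonal part have the same trace against [ad u]. *)
Lemma tr_nilpart (t : H) z : z \in even -> ftr (nilpart t \o ad z)%VF = 0.
Proof.
move=> ze; have -> : (nilpart t \o ad z)%VF = \sum_(ka <- wts) (nilpart t \o ad (pi ka z))%VF.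
  apply/lfunP => v; rewrite sum_lfunE comp_lfunE adE {1}(pi_sum wd z) br_suml linear_sum.
  by apply: eq_bigr => ka _; rewrite comp_lfunE adE.
rewrite ftr_sum big1 // => ka _; have [k0|k0] := eqVneq ka 0; last first.
  apply: (ftr_shift wd) => mu v; rewrite comp_lfunE adE nilpart_pi.
  rewrite (pi_other wd (pi_br he wd (pi_idem wd ka z) (pi_idem wd mu v))) ?linear0 //.
  by rewrite -[X in X != _]add0r (inj_eq (addIr mu)) eq_sym.
have zh : pi ka z \in h.
  by apply: (wt0_h he hh hn hself wd); rewrite ?(pi_even he wd) // k0 (pi_idem wd).
rewrite -(vsprojK zh); set u := vsproj _ _.
have P mu : ftr (ad (vsval u) \o pi mu)%VF = (mu u : K) * m mu.
  have P := @ftr_ad_pi _ _ _ he _ _ wd \1%VF _ _ _ \1%VF mu u.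
  by move: P; rewrite /mult !comp_lfun1l !comp_lfun1r => P; apply: P => *; rewrite !id_lfunE.
have -> : (nilpart t \o ad (vsval u))%VF =
    (ad (vsval t) \o ad (vsval u))%VF - \sum_(mu <- wts) (mu t : K) *: (pi mu \o ad (vsval u))%VF.
  rewrite comp_lfunDl comp_lfunNl; congr (_ - _); apply/lfunP => v.
  by rewrite comp_lfunE !sum_lfunE; apply: eq_bigr => mu _; rewrite !scale_lfunE comp_lfunE.
rewrite ftrB ftr_sum; have := trf_pol he wd t u; rewrite /trf => ->.
apply/eqP; rewrite subr_eq0; apply/eqP/eq_bigr => mu _.
by rewrite ftrZ ftrC P mulrA.
Qed.

(** With [n] the nilpotent part, the derivation rule and cyclicity turn [trf (n y) z] into the trace
    of [n] against [ad (br y z)], which is 0. So [n] maps into the radical: root components vanish,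
    and the zero weight component is a bracket within [h], which acts as zero. *)
Lemma nilpart_ad0 (t : H) x v : x \in even -> br (nilpart t x) v = 0.
Proof.
move=> xe; have nr y : y \in even -> inrad (nilpart t y).
  move=> ye; split=> [|z ze]; first exact: nilpart_stable (even_stable false) ye.
  have -> : trf (nilpart t y) z = ftr (nilpart t \o ad y \o ad z)%VF - ftr (ad y \o (nilpart t \o ad z))%VF.
    rewrite -ftrB /trf; congr ftr; apply/lfunP => w.
    rewrite add_lfunE opp_lfunE !comp_lfunE !adE nilpart_der.
    by rewrite addrK.
  rewrite [X in _ - X]ftrC -!comp_lfunA -ftrB -comp_lfunNr -comp_lfunDr -ad_br //.
  by rewrite tr_nilpart // br_ee.
rewrite (pi_sum wd x) linear_sum br_suml big1 // => be _ /=.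
have pe : pi be x \in even by apply: (pi_even he wd).
have [b0|b0] := eqVneq be 0; last first.
  by rewrite (inrad_root b0 (nr _ pe)) ?br0l // nilpart_pi (pi_idem wd).
have xh : pi be x \in h.
  by apply: (wt0_h he hh hn hself wd); rewrite // b0 (pi_idem wd).
apply: nilset0; right; have [s [es ks]] := kill_brhh t (vsproj h (pi be x)).
exists s; rewrite es vsprojK // (nilpart_wt t (pi_idem wd be x)) adshE b0.
by rewrite zero_lfunE scale0r subr0.
Qed.

(* The nilpotent part of [ad t] is a derivation mapping the even part into the
   elements that act as zero, so it commutes with the even part; its kernel has
   an invariant complement, on which it would be injective and nilpotent. *)
Lemma nilpart0 (t : H) v : nilpart t v = 0.
Proof.
suff Hi i x : x \in lsa_par g i -> nilpart t x = 0.
  by have [v0 [v1 [/(Hi false) e0 /(Hi true) e1 ->]]] := evenI v; rewrite linearD /= e0 e1 addr0.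
pose Z : {vspace g} := (lsa_par g i :&: lker (nilpart t))%VS.
have [||W [Wi We ZW ZW0]] := @cr i Z.
- by apply/subvP => z /memv_capP[].
- apply/brvP => a z ae /memv_capP[zi]; rewrite memv_ker => /eqP z0; apply/memv_capP; split.
    by apply: (subvP (even_stable i)); apply: mem_brv.
  by rewrite memv_ker nilpart_der nilpart_ad0 // z0 br0r addr0.
have ker0 n w : w \in W -> iter n (nilpart t) w = 0 -> w = 0.
  elim: n w => // n IH w wW; rewrite iterSr => /(IH _ (nilpart_stable t We wW)) w0.
  apply/eqP; rewrite -memv0 -ZW0 memv_cap wW andbT; apply/memv_capP; split.
    exact: (subvP Wi).
  by rewrite memv_ker w0.
rewrite -ZW => /memv_addP[z /memv_capP[_]]; rewrite memv_ker => /eqP z0 [w wW ->].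
by rewrite linearD /= z0 add0r (ker0 N w) ?linear0 // nilpart_nil.
Qed.

Lemma wt_act mu v (t : H) : pi mu v = v -> br (vsval t) v = (mu t : K) *: v.
Proof.
move=> mv; have := nilpart0 t v; rewrite (nilpart_wt t mv) adshE => /eqP.
by rewrite subr_eq0 => /eqP.
Qed.

End Reductive.

(** * The root system of the even part *)

Section RootSystem.

Variables (K : numClosedFieldType) (g : lieSuperalgebra K) (h : {vspace g}).
Hypotheses (cl : classical g) (ec : even_cartan h).

Local Notation br := (@lsa_br K g).
Local Notation N := (\dim {:g}).
Local Notation H := (subvs_of h).
Local Notation D := (hdual h).
Local Notation even := (even_part g).

Let he : (h <= even_part g)%VS. Proof. by case: ec. Qed.
Let hh : (brv h h <= h)%VS. Proof. by case: ec. Qed.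
Let hn : lie_nilpotent h. Proof. by case: ec. Qed.
Let hself x : x \in even_part g -> (forall y, y \in h -> lsa_br x y \in h) -> x \in h.
Proof. by case: ec => _ _ _; apply. Qed.
Let cr i : completely_reducible (lsa_par g i). Proof. by case: cl => c0 c1; case: i. Qed.

Lemma ad_weightP wts pi (wd : weight_dec wts pi) (mu : D) v : ad_weight mu v <-> pi mu v = v.
Proof.
split=> [w|mv t]; last exact: (wt_act he hh hn hself cr wd).
by apply: (wspaceP wd) => t; apply: (@iter_stab _ _ _ 1); rewrite /= adshE w subrr.
Qed.

Lemma root_spaceP (al : D) x : x \in root_space al <-> x \in even /\ ad_weight al x.
Proof.
rewrite memv_cap; split=> [/andP[-> /memv_bigcap_seq xr]|[-> xr]].
  split=> // t; rewrite (coord_vbasis (subvsP t)) br_suml.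
  transitivity (\sum_i coord (vbasis h) i (vsval t) *: ((al (vsproj h (vbasis h)`_i) : K) *: x)).
    apply: eq_bigr => i _; rewrite brZl; have ih : (vbasis h)`_i \in vbasis h by rewrite mem_nth ?size_tuple.
    have := xr _ ih; rewrite /passmx.leigenspace memv_ker add_lfunE opp_lfunE scale_lfunE id_lfunE adE subr_eq0.
    by move=> /eqP->.
  rewrite -[in RHS](vsvalK t) [in RHS](coord_vbasis (subvsP t)) !linear_sum /= scaler_suml.
  by apply: eq_bigr => i _; rewrite scalerA !linearZ.
apply/memv_bigcap_seq => t th; have {}th := vbasis_mem th.
rewrite /passmx.leigenspace memv_ker add_lfunE opp_lfunE scale_lfunE id_lfunE adE subr_eq0.
by rewrite -{1}(vsprojK th) xr.
Qed.

Lemma ad_ss_stable (W : {vspace g}) : (forall t x, t \in h -> x \in W -> br t x \in W) ->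
  ad_ss h W.
Proof.
move=> Ws x xW; have [wts [pi wd]] := weight_decomposition he hn.
exists [seq pi mu x | mu <- wts]; split; first by rewrite big_map -(pi_sum wd).
move=> _ /mapP[mu _ ->]; split; first by have [_ _ s] := wd_hproj wd mu; apply: s.
by exists mu; apply/(ad_weightP wd); apply: (pi_idem wd).
Qed.

(** If [al] vanished on all brackets [[e, f]], every weight would by [string_rat], so these brackets
    would lie in the radical. Invariance of the form then puts [e] in the radical too, against
    [inrad_root]. *)
Lemma coroot_exists (al : D) : is_root al -> exists e f (t : H),
  [/\ e \in root_space al, f \in root_space (- al), vsval t = br e f & (al t : K) = 2%:R].
Proof.
case/andP=> a0; rewrite -vpick0; set e := vpick _ => r0.
have [wts [pi wd]] := weight_decomposition he hn.
have [ee /(ad_weightP wd) ea] : e \in even /\ ad_weight al e by apply/root_spaceP/memv_pick.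
have [[f [t [ff te at0]]]|no] := pselect (exists f (t : H), [/\ f \in root_space (- al), vsval t = br e f & (al t : K) != 0]).
  (* Rescaling [e] rescales the bracket and normalizes [al t] to 2. *)
  exists ((2%:R / (al t : K)) *: e), f, ((2%:R / (al t : K)) *: t); split=> //.
  - by rewrite memvZ // memv_pick.
  - by rewrite linearZ /= te brZl.
  - by rewrite linearZ /=; exact: divfK.
have [t at0] : exists t : H, (al t : K) != 0.
  apply: contrapT => n; case/eqP: a0; apply/lfunP => t; rewrite zero_lfunE.
  by apply: contrapT => t0; apply: n; exists t; apply/eqP.
case/negP: r0; apply/eqP; apply: (inrad_root he hh hn hself cr wd a0) => //; split=> // y ye.
rewrite (trf_wt wd) big1 // => ka _; have [k0|k0] := eqVneq (al + ka) 0; last first.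
  exact: (trf_shift he wd ea (pi_idem wd ka y)).
have {}k0 : ka = - al by apply/eqP; rewrite -addr_eq0 addrC k0.
set f := pi ka y; have fe : f \in even by apply: (pi_even he wd).
have fa : pi (- al) f = f by rewrite /f k0 (pi_idem wd).
have xh := br_opp_h he hh hn hself wd ee ea fe fa.
have ku : kill wts (vsproj h (br e f)).
  have au : (al (vsproj h (br e f)) : K) = 0.
    apply: contrapT => /eqP au; apply: no; exists f, (vsproj h (br e f)); split=> //.
      by apply/root_spaceP; split=> //; apply/(ad_weightP wd).
    by rewrite vsprojK.
  move=> mu mw; have te := vsprojK xh.
  by have [q _ ->] := string_rat he wd ea ee te mw; rewrite au mulr0.
have [_ /(_ (vsval t) (subvP he _ (subvsP t)))] := kill_inrad he hh hn hself wd ku.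
rewrite vsprojK // trfC -trf_inv ?(subvP he _ (subvsP t)) //.
rewrite (wt_act he hh hn hself cr wd t ea) -[_ *: _]addr0 trf_lin trf0 addr0.
by move/eqP; rewrite mulf_eq0 (negbTE at0) => /eqP.
Qed.

Variable Phi : seq D.
Hypothesis ps : positive_system Phi.

(* In a vanishing sum containing [al], some [be] is negative on the coroot of
   [al]; then [al + be] is a root and the sum can be shortened. *)
Lemma pos_sum_neq0 (s : seq D) : s <> [::] -> {subset s <= Phi} -> \sum_(al <- s) al != 0.
Proof.
have [n] := ubnP (size s); elim: n s => // n IH [|al s] // sn _ sP; apply/eqP => s0.
have [wts [pi wd]] := weight_decomposition he hn; have [Pr Px Pc] := ps.
have aP : al \in Phi by apply: sP; rewrite mem_head.
have [e [f [t [/root_spaceP[ee /(ad_weightP wd) ea] _ te a2]]]] := coroot_exists (Pr _ aP).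
have [nn|] := pselect (forall be, be \in s -> 0 <= (be t : K)).
  have : (2%:R : K) + \sum_(be <- s) (be t : K) = 0.
    by have := congr1 (fun f : D => f t : K) s0; rewrite big_cons add_lfunE sum_lfunE a2 zero_lfunE.
  apply/eqP/lt0r_neq0; rewrite ltr_wpDr ?ltr0Sn // big_seq_cond.
  by apply: sumr_ge0 => be /andP[/nn].
move=> /existsNP[be /not_implyP[bs bt]]; have bP : be \in Phi by apply: sP; rewrite inE bs orbT.
have /andP[b0 u0] := Pr _ bP; rewrite -vpick0 in u0.
have [ue /(ad_weightP wd) ub] : vpick (root_space be) \in even /\ ad_weight be (vpick (root_space be)).
  exact/root_spaceP/memv_pick.
have [w [we wab w0]] : exists w, [/\ w \in even, pi (al + be) w = w & w <> 0].
  apply: contrapT => nw; apply: bt; apply: (string_pos he wd ea ee te a2 ue ub u0) => w we wab.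
  by apply: contrapT => w0; apply: nw; exists w.
have ab0 : al + be != 0.
  apply: contraNneq b0 => ab; have := Px _ (Pr _ aP).
  by rewrite aP (_ : - al = be) ?bP //; apply/eqP; rewrite eq_sym -addr_eq0 addrC ab.
have abP : al + be \in Phi.
  apply: Pc => //; rewrite /is_root ab0 /=; apply/eqP => r0; apply: w0.
  by apply/eqP; rewrite -memv0 -r0; apply/root_spaceP; split=> //; apply/(ad_weightP wd).
have := IH (al + be :: rem be s); rewrite /= size_rem // => /(_ _ _ _)/eqP; apply => //.
- by case: (s) bs sn => //= b s' _; rewrite !ltnS.
- move=> x; rewrite inE => /orP[/eqP-> //|/mem_rem xs]; apply: sP; by rewrite inE xs orbT.
- by rewrite big_cons -addrA; move: s0; rewrite big_cons (perm_big _ (perm_to_rem bs)) big_cons.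
Qed.

Lemma even_ind (Q : g -> Prop) : Q 0 -> (forall x y, Q x -> Q y -> Q (x + y)) ->
  (forall x, x \in h -> Q x) ->
  (forall al x, al \in Phi -> x \in root_space al -> Q x) ->
  (forall al x, al \in Phi -> x \in root_space (- al) -> Q x) ->
  forall x, x \in even -> Q x.
Proof.
move=> Q0 QD Qh Qp Qm x xe; have [wts [pi wd]] := weight_decomposition he hn.
have [_ Px _] := ps; rewrite (pi_sum wd x); apply: big_ind => // mu _.
have pe : pi mu x \in even by apply: (pi_even he wd).
have [m0|m0] := eqVneq mu 0.
  by apply/Qh/(wt0_h he hh hn hself wd); rewrite // m0 (pi_idem wd).
have [->//|p0] := eqVneq (pi mu x) 0.
have pr : pi mu x \in root_space mu.
  by apply/root_spaceP; split=> //; apply/(ad_weightP wd); apply: (pi_idem wd).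
have : is_root mu.
  rewrite /is_root m0 /=; apply: contraNneq p0 => r0; by rewrite -memv0 -r0.
move/Px; have [mP _|_ /= mP] := boolP (mu \in Phi); first exact: (Qp mu).
by apply: (Qm (- mu)) mP _; rewrite opprK.
Qed.

End RootSystem.

(** * Highest weight modules *)

Section Generated.

Variables (K : fieldType) (g : lieSuperalgebra K) (a : {vspace g}).

(* the linear span of all words in Y applied to B *)
Definition gen (M : supermodule a) (B : M -> Prop) (Y : g -> Prop) u :=
  forall Q : M -> Prop, linset Q -> (forall n, B n -> Q n) ->
    (forall y w, Y y -> Q w -> Q (act y w)) -> Q u.

Variables (M : supermodule a) (B : M -> Prop) (Y : g -> Prop).

Lemma gen_base n : B n -> gen B Y n.
Proof. by move=> Bn Q _ BQ _; apply: BQ. Qed.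

Lemma gen_act y u : Y y -> gen B Y u -> gen B Y (act y u).
Proof. by move=> Yy gu Q Ql BQ YQ; apply: (YQ) => //; apply: (gu Q). Qed.

Lemma gen_linset : linset (gen B Y).
Proof.
split=> [Q []//|c u v gu gv Q Ql BQ YQ].
have [_ QD] := Ql; apply: QD; [exact: (gu Q)|exact: (gv Q)].
Qed.

(** The induction carries the action of all of [X] at once, because moving [x] past a generator can
    replace it by another element of [X]. *)
Lemma gen_stable (X : g -> Prop) : (forall x n, X x -> B n -> gen B Y (act x n)) ->
  (forall x y w, X x -> Y y -> gen B Y w -> (forall x', X x' -> gen B Y (act x' w)) ->
     gen B Y (act x (act y w))) ->
  forall x u, X x -> gen B Y u -> gen B Y (act x u).
Proof.
move=> XB XY x u Xx gu.
have [] // := gu (fun u => gen B Y u /\ forall x, X x -> gen B Y (act x u)) _ _ _; last by move=> _; apply.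
- split; first by split=> [|y _]; rewrite ?linear0; case: gen_linset.
  move=> c w w' [gw Xw] [gw' Xw']; split=> [|y Xy]; first by case: gen_linset => _; apply.
  by rewrite act_linear; case: gen_linset => _; apply; [apply: Xw|apply: Xw'].
- by move=> n Bn; split=> [|y Xy]; [apply: gen_base|apply: XB].
- by move=> y w Yy [gw Xw]; split=> [|z Xz]; [apply: gen_act|apply: XY].
Qed.

Lemma gen_graded j : (forall y, Y y -> y \in a /\ y \in lsa_par g j) ->
  (forall n, B n -> exists n0 n1, [/\ smod_par false n0, smod_par true n1, B n0, B n1 & n = n0 + n1]) ->
  forall v0 v1, smod_par false v0 -> smod_par true v1 -> gen B Y (v0 + v1) -> gen B Y v0 /\ gen B Y v1.
Proof.
move=> Yj Bg v0 v1 e0 e1 gv; have [Z0 ZD] := gen_linset.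
have [u0 [u1 [d0 d1 g0 g1 e]]] : exists u0 u1, [/\ smod_par false u0, smod_par true u1,
    gen B Y u0, gen B Y u1 & v0 + v1 = u0 + u1].
  apply: (gv (fun v => exists u0 u1, [/\ smod_par false u0, smod_par true u1,
    gen B Y u0, gen B Y u1 & v = u0 + u1])).
  - split; first by exists 0, 0; rewrite addr0; split=> //; apply: smod_par0.
    move=> c _ _ [u0 [u1 [d0 d1 g0 g1 ->]]] [w0 [w1 [f0 f1 k0 k1 ->]]].
    exists (c *: u0 + w0), (c *: u1 + w1); split; try exact: ZD; try exact: smod_parD.
    by lin K M.
  - move=> n /Bg[n0 [n1 [d0 d1 b0 b1 e]]]; exists n0, n1; split=> //; exact: gen_base.
  - move=> y _ Yy [u0 [u1 [d0 d1 g0 g1 ->]]]; have [ya yj] := Yj _ Yy.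
    have := act_graded ya yj d0; have := act_graded ya yj d1; have A0 := gen_act Yy g0; have A1 := gen_act Yy g1.
    have ye : act y (u0 + u1) = act y u0 + act y u1  by rewrite linearD.
    case: (j) => f1 f0; rewrite ye.
      by exists (act y u1), (act y u0); rewrite addrC.
    by exists (act y u0), (act y u1).
by have [-> ->] := smod_par_uniq e0 (e1 : smod_par (~~ false) v1) d0 d1 e.
Qed.

End Generated.

Lemma gen_hom (K : fieldType) (g : lieSuperalgebra K) (a : {vspace g}) (M N : supermodule a)
    (f : M -> N) (v : M) Y u : smod_hom f -> gen (eq v) Y u -> gen (eq (f v)) Y (f u).
Proof.
move=> fh gu; apply: (gu (fun u => gen (eq (f v)) Y (f u))).
- by apply: linset_preim (gen_linset _ _); case: fh.
- by move=> _ <-; apply: gen_base.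
- by move=> y w Yy; rewrite (hom_act fh); apply: gen_act.
Qed.

Section WeightIndependence.

Variables (K : fieldType) (g : lieSuperalgebra K) (a h : {vspace g}).

(** For [t] separating [la] from the weight [mu] of a summand, the operator [t - mu t] rescales [u]
    by a nonzero factor and removes that summand. *)
Lemma weight_indep (M : supermodule a) (la : hdual h) (s : seq M) (u : M) :
  is_weight_vector la u -> u = \sum_(w <- s) w ->
  (forall w, w \in s -> exists2 mu : hdual h, mu != la & is_weight_vector mu w) -> u = 0.
Proof.
have [n] := ubnP (size s); elim: n s u => // n IH [|w s] u; first by rewrite big_nil.
rewrite big_cons ltnS => sn wu eu sw.
have [|mu mula wmu] := sw w; first by rewrite mem_head.
have [t tt] : exists t : subvs_of h, (la t : K) - (mu t : K) != 0.
  apply: contrapT => e; case/eqP: mula; apply/lfunP => t; apply/eqP.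
  by rewrite eq_sym -subr_eq0; apply: contrapT => /negP tt; apply: e; exists t.
have : ((la t : K) - (mu t : K)) *: u = 0.
  apply: (IH [seq act (vsval t) z - (mu t : K) *: z | z <- s]); first by rewrite size_map.
  - by move=> x; rewrite linearZ /= wu !scalerA mulrC.
  - rewrite scalerBl -wu eu linearD /= wmu scalerDr opprD addrACA subrr add0r.
    rewrite big_map sumrB; congr (_ - _); last by rewrite scaler_sumr.
    by apply: (big_morph (act (vsval t))); [exact: linearD|exact: linear0].
  - move=> _ /mapP[z zs ->]; have [|nu nula wnu] := sw z; first by rewrite inE zs orbT.
    exists nu => // x; rewrite wnu -scalerBl linearZ /= wnu !scalerA mulrC.
    by [].
by move/eqP; rewrite scaler_eq0 (negbTE tt) => /eqP.
Qed.

End WeightIndependence.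

Section HighestWeightEven.

Variables (K : numClosedFieldType) (g : lieSuperalgebra K) (h : {vspace g}).
Hypotheses (cl : classical g) (ec : even_cartan h).
Variable Phi : seq (hdual h).
Hypothesis ps : positive_system Phi.
Local Notation D := (hdual h).
Local Notation even := (even_part g).
Implicit Types M : supermodule even.

Let he : (h <= even_part g)%VS. Proof. by case: ec. Qed.

Lemma even_graded : graded even. Proof. by move=> x _; apply: pr0_mem. Qed.

Lemma root_even (al : D) x : x \in root_space al -> x \in even.
Proof. by case/root_spaceP. Qed.

Lemma root_even_n (al : D) x : al \in Phi -> x \in root_space al -> x \in even_n Phi.
Proof.
rewrite /even_n => aP xa; rewrite (big_rem al) //=; exact: (subvP (addvSl _ _)).
Qed.

Definition negroot (y : g) := exists2 al : D, al \in Phi & y \in root_space (- al).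

Definition hwv M (la : D) (v : M) :=
  is_weight_vector la v /\ forall x, x \in even_n Phi -> act x v = 0.

(** Takes the place of a PBW argument: an even element is moved past the negative root vectors until
    it reaches the highest weight vector. *)
Lemma hw_gen_even M la (v : M) : hwv la v -> forall x u, x \in even ->
  gen (eq v) negroot u -> gen (eq v) negroot (act x u).
Proof.
move=> [wv nv]; have gl := gen_linset (eq v) negroot.
have gv : gen (eq v) negroot v by apply: gen_base.
apply: gen_stable => [x _ xe <-|x y w xe [al aP ya] gw Xw].
  apply: (even_ind cl ec ps (Q := fun x => gen (eq v) negroot (act x v))) xe.
  - by rewrite act0l; case: gl.
  - by move=> y z gy gz; rewrite actDl; exact: (linset_add gl gy gz).
  - by move=> y yh; rewrite -(vsprojK yh) wv; exact: (linset_scale _ gl gv).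
  - by move=> al y aP ya; rewrite nv ?(root_even_n aP) //; case: gl.
  - by move=> al y aP ya; apply: gen_act => //; exists al.
have ye := root_even ya; rewrite (act_br_even w even_graded xe xe ye).
apply: (linset_add gl); first by apply: Xw; apply: br_ee.
by apply: gen_act; [exists al|apply: Xw].
Qed.

Lemma hw_gen_subsup M la (v : M) i : smod_par i v -> hwv la v ->
  is_subsupermodule (gen (eq v) negroot).
Proof.
move=> vi hv; have [Z0 ZD] := gen_linset (eq v) negroot; split=> // [x u gu|v0 v1 e0 e1].
  by rewrite smod_actE; apply: (hw_gen_even hv) => //; apply: subvsP.
have gv : gen (eq v) negroot v by apply: gen_base.
(* With 0 adjoined, the generators are closed under homogeneous components, as [gen_graded]
   demands. *)
pose B w := w = v \/ w = 0.
have [Bv B0] : B v /\ B 0 by split; [left|right].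
have H u : gen (eq v) negroot u <-> gen B negroot u.
  split=> gu.
    apply: (gu (gen B negroot)); first exact: gen_linset; last by move=> y w; apply: gen_act.
    by move=> _ <-; apply: gen_base; left.
  apply: (gu (gen (eq v) negroot)); first exact: gen_linset; last by move=> y w; apply: gen_act.
  by move=> _ [->|->].
move=> /H gv01; have [||] := gen_graded (j := false) _ _ e0 e1 gv01; last by move=> /H g0 /H g1.
  by move=> y [al _ ya]; split; apply: (root_even ya).
move=> _ [->|->]; last by exists 0, 0; rewrite addr0; split=> //; exact: smod_par0.
case: i vi => vi; last by exists v, 0; rewrite addr0; split=> //; exact: smod_par0.
by exists 0, v; rewrite add0r; split=> //; exact: smod_par0.
Qed.

(** All nonempty words have weight [la] minus a nonempty sum of positive roots, which differs from
    [la] by [pos_sum_neq0]. *)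
Lemma hw_gen_weight M la (v u : M) : hwv la v -> gen (eq v) negroot u ->
  is_weight_vector la u -> exists c, u = c *: v.
Proof.
move=> [wv nv] gu wu.
pose R (w : M) := exists l : seq D, [/\ l <> [::], {subset l <= Phi} & is_weight_vector (la - \sum_(al <- l) al) w].
have RZ c w : R w -> R (c *: w).
  move=> [l [l0 lP wl]]; exists l; split=> // t.
  by rewrite linearZ /= wl !scalerA mulrC.
have RY y w : negroot y -> (w = v \/ R w) -> R (act y w).
  move=> [al aP ya]; have [ye wy] := (root_spaceP (- al) y).1 ya.
  case=> [->|[l [l0 lP wl]]].
    exists [:: al]; rewrite big_seq1; split=> //; first by move=> z; rewrite inE => /eqP->.
    exact: (weight_act he he even_graded).
  exists (al :: l); rewrite big_cons opprD addrCA addrC; split=> //.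
    by move=> z; rewrite inE => /orP[/eqP->|/lP].
  exact: (weight_act he he even_graded).
have [c [s [sR eu]]] : exists c (s : seq M), (forall w, w \in s -> R w) /\ u = c *: v + \sum_(w <- s) w.
  apply: (gu (fun u => exists c (s : seq M), (forall w, w \in s -> R w) /\ u = c *: v + \sum_(w <- s) w)).
  - split; first by exists 0, [::]; rewrite big_nil scale0r addr0.
    move=> k _ _ [c [s [sR ->]]] [c' [s' [sR' ->]]].
    exists (k * c + c'), (map ( *:%R k) s ++ s'); split.
      by move=> w; rewrite mem_cat => /orP[/mapP[z /sR zR ->]|/sR'//]; apply: RZ.
    rewrite big_cat big_map -scaler_sumr /=; set x := \sum_(_ <- s) _; set y := \sum_(_ <- s') _.
    by lin K M.
  - by move=> _ <-; exists 1, [::]; rewrite big_nil scale1r addr0.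
  - move=> y _ Yy [c [s [sR ->]]]; exists 0, (c *: act y v :: map (act y) s); split.
      move=> w; rewrite inE => /orP[/eqP->|/mapP[z /sR zR ->]]; last by apply: RY => //; right.
      by apply: RZ; apply: RY => //; left.
    rewrite linearD linearZ /= scale0r add0r big_cons big_map.
    congr (_ + _); apply: (big_morph (act y)); [exact: linearD|exact: linear0].
exists c; apply/eqP; rewrite -subr_eq0; apply/eqP/(@weight_indep _ _ _ _ _ la s).
- move=> t; rewrite linearB linearZ /= wu wv.
  by lin K M.
- by rewrite eu addrAC subrr add0r.
move=> w /sR[l [l0 lP wl]]; exists (la - \sum_(al <- l) al) => //.
by rewrite -subr_eq0 addrAC subrr add0r oppr_eq0 (pos_sum_neq0 cl ec ps).
Qed.

End HighestWeightEven.

Section Embedding.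

Variables (K : numClosedFieldType) (g : lieSuperalgebra K) (h : {vspace g}).
Hypotheses (cl : classical g) (ec : even_cartan h).
Variable Phi : seq (hdual h).
Hypothesis ps : positive_system Phi.
Local Notation D := (hdual h).
Local Notation even := (even_part g).

(** The submodule of the product generated by [(v, v')] is the graph of the embedding. [M'] need not
    be simple: only its submodules inside the cyclic module of [v'] are constrained. *)
Lemma hw_embed (M M' : supermodule even) (la : D) (v : M) (v' : M') i : simple_smod M ->
  v <> 0 -> v' <> 0 -> smod_par i v -> smod_par i v' -> hwv Phi la v -> hwv Phi la v' ->
  (forall N : M' -> Prop, is_subsupermodule N ->
     (forall u, N u -> gen (eq v') (negroot Phi) u) -> (exists u, N u /\ u <> 0) -> N v') ->
  exists f : M -> M', smod_hom f /\ injective f.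
Proof.
move=> [_ sM] v0 v'0 vi v'i hv hv' HS; set Y := negroot Phi.
pose P := prod_smod M M'; pose p : P := (v, v'); pose Z : P -> Prop := gen (eq p) Y.
have hp : hwv Phi la p.
  split=> [t|x xn]; last by have [_ a1] := hv; have [_ a2] := hv'; congr (_, _); [apply: a1|apply: a2].
  by have [a1 _] := hv; have [a2 _] := hv'; congr (_, _); [apply: a1|apply: a2].
have Zs : is_subsupermodule Z by apply: (hw_gen_subsup cl ec ps (i := i)) hp; split.
have Zp : Z p by apply: gen_base.
have i2h : smod_hom (fun u : M' => (0, u) : P).
  by apply: pair_hom; [apply: zero_hom|apply: hom_id].
have Z0 u : Z (0, u) -> u = 0.
  move=> Zu; apply: contrapT => u0.
  have : Z (0, v').
    apply: (HS _ (hom_preim i2h Zs)); last by exists u.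
    by move=> w Zw; apply: (gen_hom (snd_hom M M') Zw).
  (* The [la]-weight space of [Z] is the line through [(v, v')], to which [(0, v')] does not
     belong. *)
  move=> Zv'; have [|c [/esym/eqP c0 e']] := hw_gen_weight cl ec ps hp Zv'.
    move=> t; have [a2 _] := hv'.
    have a1 : act (vsval t) (0 : M) = (la t : K) *: 0 by rewrite linear0 scaler0.
    exact: (congr2 pair a1 (a2 t)).
  move: c0; rewrite /= scaler_eq0 => /orP[/eqP c0|/eqP //].
  by apply: v'0; rewrite e' c0 scale0r.
have [f fP] : {f : M -> M' & forall u, Z (u, f u)}.
  apply: (@choice _ _ (fun u w => Z (u, w))) => u; have Is := hom_img (fst_hom M M') Zs.
  case: (sM _ Is) => [/(_ v)|/(_ u)[[u1 u2] Zu /= <-]]; last by exists u2.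
  by move=> H; case: v0; apply: H; exists p.
have [_ ZD ZA Zg] := Zs.
have uniq u w w' : Z (u, w) -> Z (u, w') -> w = w'.
  move=> Zw Zw'; apply/eqP; rewrite -subr_eq0; apply/eqP/Z0.
  have := ZD (-1) _ _ Zw' Zw; rewrite !scaleN1r => H.
  by rewrite -[X in Z (X, _)](addNr u) [w - w']addrC.
have fl : linear f.
  by move=> c u w; apply: (uniq (c *: u + w)) => //; apply: (ZD c _ _ (fP u) (fP w)).
have fh : smod_hom f.
  split=> // [x u|j u uj]; first by apply: (uniq (smod_act x u)) => //; apply: (ZA x _ (fP u)).
  have [w0 [w1 [e0 e1 e]]] := smod_full (f u).
  case: j uj => uj.
    have [] := Zg (0, w0) (u, w1).
    - by split=> //; apply: smod_par0.
    - by split.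
    - by have := fP u; rewrite e -{1}[u]add0r.
    by move=> /Z0 w00 _; rewrite e w00 add0r.
  have [] := Zg (u, w0) (0, w1).
  - by split.
  - by split=> //; apply: smod_par0.
  - by have := fP u; rewrite e -{1}[u]addr0.
  by move=> _ /Z0 w10; rewrite e w10 addr0.
have fv : f v = v' by apply: (uniq v).
exists f; split=> //; apply: (hom_inj fh).
case: (sM _ (ker_subsupermodule fh)) => // /(_ v) fv0.
by case: v'0; rewrite -fv.
Qed.

End Embedding.

(** * Invariants of [gp] in a simple module *)

Section TypeI.

Variables (K : numClosedFieldType) (g : lieSuperalgebra K) (gm gp : {vspace g}).
Hypothesis ti : type_I_grading gm gp.
Local Notation br := (@lsa_br K g).
Local Notation even := (even_part g).

Lemma gp_odd x : x \in gp -> x \in odd_part g.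
Proof. by case: ti => -[<- _] _ _ _ _; apply: (subvP (addvSl _ _)). Qed.
Lemma gm_odd x : x \in gm -> x \in odd_part g.
Proof. by case: ti => -[<- _] _ _ _ _; apply: (subvP (addvSr _ _)). Qed.
Lemma even_gp x y : x \in even -> y \in gp -> br x y \in gp.
Proof. by case: ti => _ /subvP s _ _ _ xe yp; apply: s; apply: mem_brv. Qed.
Lemma even_gm x y : x \in even -> y \in gm -> br x y \in gm.
Proof. by case: ti => _ _ /subvP s _ _ xe yp; apply: s; apply: mem_brv. Qed.
Lemma gp_gp x y : x \in gp -> y \in gp -> br x y = 0.
Proof. by case: ti => _ _ _ s _ xe yp; apply/eqP; rewrite -memv0 -s; apply: mem_brv. Qed.
Lemma gm_gm x y : x \in gm -> y \in gm -> br x y = 0.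
Proof. by case: ti => _ _ _ _ s xe yp; apply/eqP; rewrite -memv0 -s; apply: mem_brv. Qed.
Lemma typeI_split x : exists x0 xp xm, [/\ x0 \in even, xp \in gp, xm \in gm & x = x0 + xp + xm].
Proof.
have [x0 [x1 [e0 e1 ->]]] := evenI x; move: e1; case: ti => -[<- _] _ _ _ _.
by case/memv_addP => xp xpP [xm xmP ->]; exists x0, xp, xm; rewrite addrA.
Qed.

Lemma even_subalg : subalgebra even. Proof. by move=> x y; apply: br_ee. Qed.

Definition Res0 (L : supermodule (fullv : {vspace g})) : supermodule even :=
  res_smod even_subalg (subvf _) L.

Variable L : supermodule (fullv : {vspace g}).
Hypothesis sL : simple_smod L.

Definition gpinv (u : L) := forall x, x \in gp -> act x u = 0.
(** The span of [gm L]; the [gp]-invariants will turn out to be a complement to it. *)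
Definition gmL (u : L) := forall Q : L -> Prop, linset Q ->
  (forall y w, y \in gm -> Q (act y w)) -> Q u.

Lemma Res0_act x (v : Res0 L) : x \in even -> act x v = act x (v : L).
Proof. by move=> xe; apply: res_act. Qed.

Lemma gpinv_linset : linset gpinv.
Proof.
split=> [x _|c u v iu iv x xp]; first exact: linear0.
by rewrite linearP /= iu // iv // scaler0 addr0.
Qed.

Lemma full_graded : graded (fullv : {vspace g}). Proof. by move=> x _; apply: memvf. Qed.

Lemma act_even x y (v : L) : x \in even -> act x (act y v) = act (br x y) v + act y (act x v).
Proof. by move=> xe; apply: act_br_even; rewrite ?memvf //; apply: full_graded. Qed.

Lemma act_odd x y (v : L) : x \in odd_part g -> y \in odd_part g ->
  act x (act y v) = act (br x y) v - act y (act x v).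
Proof.
move=> xo yo; rewrite (act_br v (memvf x) (memvf y) xo yo) expr1 scaleN1r opprK.
by rewrite addrK.
Qed.

Lemma gpinv_even x u : x \in even -> gpinv u -> gpinv (act x u).
Proof.
by move=> xe iu y yp; have := act_even y u xe; rewrite (iu y yp) (iu _ (even_gp xe yp)) linear0 add0r => <-.
Qed.

Lemma gmL_linset : linset gmL.
Proof.
split=> [Q []//|c u v gu gv Q Ql QY].
by have [_ QD] := Ql; apply: QD; [apply: (gu Q)|apply: (gv Q)].
Qed.

Lemma gmL_act y w : y \in gm -> gmL (act y w).
Proof. by move=> ym Q _ QY; apply: QY. Qed.

Lemma gmL_even x u : x \in even -> gmL u -> gmL (act x u).
Proof.
move=> xe gu; apply: (gu (fun u => gmL (act x u))).
  by apply: linset_preim gmL_linset; apply: act_linear.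
move=> y w ym; rewrite act_even //; apply: (linset_add gmL_linset); apply: gmL_act => //.
exact: even_gm.
Qed.

Lemma linset_homog (Q : L -> Prop) : linset Q ->
  linset (fun u => exists u0 u1, [/\ smod_par false u0, smod_par true u1, Q u0, Q u1 & u = u0 + u1]).
Proof.
move=> [Q0 QD]; split; first by exists 0, 0; rewrite addr0; split=> //; apply: smod_par0.
move=> c _ _ [u0 [u1 [d0 d1 g0 g1 ->]]] [w0 [w1 [f0 f1 k0 k1 ->]]].
exists (c *: u0 + w0), (c *: u1 + w1); split; try exact: QD; try exact: smod_parD.
by lin K L.
Qed.

Lemma gmL_graded v0 v1 : smod_par false v0 -> smod_par true v1 -> gmL (v0 + v1) ->
  gmL v0 /\ gmL v1.
Proof.
(* Since [gm] reverses parity, the even component of [act y w] comes from the odd component of [w],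
   and conversely. *)
move=> e0 e1 gv; have [u0 [u1 [d0 d1 g0 g1 e]]] := gv _ (linset_homog gmL_linset) (fun y w ym =>
  let: ex_intro w0 (ex_intro w1 (And3 f0 f1 ew)) := smod_full w in
  ex_intro _ (act y w1) (ex_intro _ (act y w0) (And5 (act_graded (memvf y) (gm_odd ym) f1)
    (act_graded (memvf y) (gm_odd ym) f0) (gmL_act w1 ym) (gmL_act w0 ym)
    (etrans (congr1 (act y) (etrans ew (addrC w0 w1))) (linearD _ w1 w0))))).
by have [-> ->] := smod_par_uniq e0 (e1 : smod_par (~~ false) v1) d0 d1 e.
Qed.

Lemma gpinv_graded v0 v1 : smod_par false v0 -> smod_par true v1 -> gpinv (v0 + v1) ->
  gpinv v0 /\ gpinv v1.
Proof.
move=> e0 e1 iv.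
suff H x : x \in gp -> act x v0 = 0 /\ act x v1 = 0 by split=> x /H[].
move=> xp; have := iv x xp; rewrite linearD /= => e.
have p0 := act_graded (memvf x) (gp_odd xp) e0; have p1 := act_graded (memvf x) (gp_odd xp) e1.
have a1 : act x v1 = - act x v0 by apply/eqP; rewrite -addr_eq0 addrC e.
have a0 : act x v0 = 0.
  by apply: smod_direct p0; rewrite -[act x v0]opprK -a1; apply: smod_parN.
by rewrite a1 a0 oppr0.
Qed.

(* products of more than dim gm elements of gm act as zero, so gm L = L would
   force L = 0 *)
Lemma gmL_proper : ~ forall u, gmL u.
Proof.
move=> aL; pose word (w : seq (subvs_of gm)) (u : L) := foldr (fun y => act (vsval y)) u w.
pose W k u := forall Q : L -> Prop, linset Q ->
  (forall w u', size w = k -> Q (word w u')) -> Q u.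
have aW k u : W k u.
  elim: k u => [|k IH] u Q Ql QW; first exact: (QW [::] u).
  apply: (aL u) => // y w ym; apply: (IH w (fun w => Q (act y w))).
    by apply: linset_preim Ql; apply: act_linear.
  by move=> s u' sk; have := QW (vsproj gm y :: s) u'; rewrite /= vsprojK // sk; apply.
have [[v v0] _] := sL; apply: v0; pose d := \dim {:subvs_of gm}.
apply: (aW d.+1 v (fun u => u = 0)) => [|w u sw].
  by split=> // c x y -> ->; rewrite scaler0 addr0.
apply: (@altf_long _ _ _ (fun w => word w u)); last by rewrite sw.
have wcat s t : word (s ++ t) u = word s (word t u) by rewrite /word foldr_cat.
have wl s c x y : word s (c *: x + y) = c *: word s x + word s y.
  by elim: s => // z s IH; rewrite /= IH linearP.
split=> [s c x y t|s x y t]; rewrite !wcat.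
  have -> : word (c *: x + y :: t) u = c *: act (vsval x) (word t u) + act (vsval y) (word t u).
    by rewrite -actZl -actDl; congr act; apply: linearP.
  by rewrite wl.
have -> : word [:: x, y & t] u = - word [:: y, x & t] u.
  rewrite /= (act_odd (word t u) (gm_odd (subvsP x)) (gm_odd (subvsP y))).
  by rewrite gm_gm ?subvsP // act0l sub0r.
have wls : linear (word s) by move=> c z z'; apply: wl.
exact: (linNf wls).
Qed.

(** The words in [gm] applied to [N] span a [g]-submodule, hence all of [L]; nonempty words lie in
    [gm L]. *)
Lemma full_split (N : Res0 L -> Prop) : is_subsupermodule N -> (forall u, N u -> gpinv u) ->
  (exists u, N u /\ u <> 0) -> forall u : L, exists2 n : L, N n & gmL (u - n).
Proof.
move=> Ns Ni [n0 [Nn0 n00]] u.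
pose B : L -> Prop := N; pose Z := gen B (fun y => y \in gm).
have Nl : linset B by exact: subsup_linset Ns.
have NE x n : x \in even -> N n -> N (act x (n : L)).
  by move=> xe Nn; rewrite -Res0_act //; apply: subsup_act.
have Zl : linset Z by exact: gen_linset.
have ZE : forall x w, x \in even -> Z w -> Z (act x w).
  apply: gen_stable => [x n xe Nn|x y w xe ym Zw Xw]; first by apply: gen_base; apply: NE.
  rewrite act_even //; apply: (linset_add Zl); first by apply: gen_act => //; apply: even_gm.
  by apply: gen_act => //; apply: Xw.
have ZP : forall x w, x \in gp -> Z w -> Z (act x w).
  apply: gen_stable => [x n xp Nn|x y w xp ym Zw Xw]; first by rewrite Ni //; case: Zl.
  rewrite (act_odd w (gp_odd xp) (gm_odd ym)); apply: (linset_sub Zl).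
    by apply: ZE => //; apply: br_oo; [apply: gp_odd|apply: gm_odd].
  by apply: gen_act => //; apply: Xw.
have Zs : is_subsupermodule Z.
  split; try by case: Zl.
  - move=> x w Zw; rewrite smod_actE; have [x0 [xp [xm [e0 ep em ->]]]] := typeI_split (vsval x).
    by rewrite !actDl; apply: (linset_add Zl); [apply: (linset_add Zl); [apply: ZE|apply: ZP]|apply: gen_act].
  - move=> v0 v1 e0 e1; apply: (gen_graded (j := true)) e0 e1 => [y ym|n Nn]; first by rewrite memvf gm_odd.
    have [w0 [w1 [f0 f1 e]]] := smod_full n; exists w0, w1; have [_ _ _ Ng] := Ns.
    by have [|? ?] := Ng w0 w1 f0 f1; [rewrite -e|split].
have Zall : Z u.
  case: sL => _ /(_ Z Zs)[/(_ n0)|]; last exact.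
  by move=> H; case: n00; apply: H; apply: gen_base.
apply: (Zall (fun u => exists2 n : L, N n & gmL (u - n))).
- split; first by exists 0; [case: Nl|rewrite subr0; case: gmL_linset].
  move=> c u1 u2 [n1 N1 G1] [n2 N2 G2]; exists (c *: n1 + n2); first by case: Nl => _; apply.
  have -> : c *: u1 + u2 - (c *: n1 + n2) = c *: (u1 - n1) + (u2 - n2) by lin K L.
  by case: gmL_linset => _; apply.
- by move=> n Nn; exists n => //; rewrite subrr; case: gmL_linset.
- move=> y w ym _; exists 0; first by case: Nl.
  by rewrite subr0; apply: gmL_act.
Qed.

(** A nonzero intersection would be a submodule to which [full_split] applies, giving [gm L = L]. *)
Lemma gpinv_gmL u : gpinv u -> gmL u -> u = 0.
Proof.
move=> iu gu; apply: contrapT => u0; apply: gmL_proper => w.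
have [|||n [_ gn] gw] := @full_split (fun u => gpinv u /\ gmL u) _ _ _ w.
- have [i0 iD] := gpinv_linset; have [g0 gD] := gmL_linset.
  split=> //.
  + by move=> c x y [ix gx] [iy gy]; split; [apply: iD|apply: gD].
  + move=> x v [iv gv]; rewrite smod_actE Res0_act ?subvsP //.
    by split; [apply: gpinv_even|apply: gmL_even]; rewrite ?subvsP.
  + move=> v0 v1 e0 e1 [iv gv]; have [? ?] := gpinv_graded e0 e1 iv.
    by have [? ?] := gmL_graded e0 e1 gv.
- by move=> v [].
- by exists u.
by rewrite -(subrK n w); apply: (linset_add gmL_linset).
Qed.

(** By the splitting, an invariant vector differs from some [n] in [N] by an invariant lying in
    [gm L], which is 0. Thus the invariants form a simple module for the even part. *)
Lemma gpinv_sub (N : Res0 L -> Prop) (v : L) : is_subsupermodule N -> (forall u, N u -> gpinv u) ->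
  (exists u, N u /\ u <> 0) -> gpinv v -> N v.
Proof.
move=> Ns Ni Nn iv; have [n Nv gv] := full_split Ns Ni Nn v.
suff -> : v = n by [].
apply/eqP; rewrite -subr_eq0; apply/eqP/gpinv_gmL => //.
by apply: (linset_sub gpinv_linset) => //; apply: Ni.
Qed.

End TypeI.

(** * Injective envelopes and parity shift *)

Section SimpleCatO.

Variables (K : fieldType) (g : lieSuperalgebra K) (a h p : {vspace g}).
Hypotheses (ha : (h <= a)%VS) (he : (h <= even_part g)%VS) (ga : graded a) (as_ : ad_ss h a).
Implicit Types M : supermodule a.

Lemma par_split0 M j (u0 u1 : M) : smod_par j u0 -> smod_par (~~ j) u1 -> u0 + u1 = 0 ->
  u0 = 0 /\ u1 = 0.
Proof.
move=> e0 e1 e; have z i := smod_par0 M i.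
by apply: (smod_par_uniq e0 e1 (z j) (z (~~ j))); rewrite addr0.
Qed.

Lemma kill_homog M j x (v0 v1 : M) : x \in a -> x \in lsa_par g j ->
  smod_par false v0 -> smod_par true v1 -> act x (v0 + v1) = 0 -> act x v0 = 0 /\ act x v1 = 0.
Proof.
move=> xa xj e0 e1; rewrite linearD /= => e.
have := act_graded xa xj e1; rewrite addbT => p1.
have := act_graded xa xj e0; rewrite addbF => p0.
exact: (par_split0 p0 p1 e).
Qed.

Lemma weight_homog M (la : hdual h) (v0 v1 : M) : smod_par false v0 -> smod_par true v1 ->
  is_weight_vector la (v0 + v1) -> is_weight_vector la v0 /\ is_weight_vector la v1.
Proof.
move=> e0 e1 wv; suff H t : act (vsval t) v0 = (la t : K) *: v0 /\ act (vsval t) v1 = (la t : K) *: v1.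
  by split=> t; case: (H t).
have te : vsval t \in lsa_par g false by apply: (subvP he) (subvsP t).
have ta : vsval t \in a by apply: (subvP ha) (subvsP t).
have p0 := act_graded ta te e0; have p1 := act_graded ta te e1.
apply: (smod_par_uniq (b := false) p0 p1); [exact: smod_parZ|exact: smod_parZ|].
by have := wv t; rewrite linearD scalerDr.
Qed.

Lemma hssv_graded M (v0 v1 : M) : smod_par false v0 -> smod_par true v1 ->
  hssv h (v0 + v1) -> hssv h v0 /\ hssv h v1.
Proof.
move=> e0 e1 [s [sw es]]; have hl := hssv_linset h M.
have [u0 [u1 [d0 d1 [h0 h1] e]]] : exists u0 u1 : M,
    [/\ smod_par false u0, smod_par true u1, hssv h u0 /\ hssv h u1 & v0 + v1 = u0 + u1].
  rewrite es; elim: s sw {es} => [|w s IH] sw.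
    exists 0, 0; rewrite big_nil addr0; split=> //; try exact: smod_par0.
    by split; case: hl.
  have [z zs|u0 [u1 [d0 d1 [h0 h1] e]]] := IH; first by apply: sw; rewrite inE zs orbT.
  have [|la wla] := sw w; first exact: mem_head.
  have [w0 [w1 [f0 f1 ew]]] := smod_full w.
  rewrite ew in wla; have [/weight_hssv k0 /weight_hssv k1] := weight_homog f0 f1 wla.
  exists (w0 + u0), (w1 + u1); rewrite big_cons e ew addrACA.
  by split=> //; [exact: smod_parA|exact: smod_parA|split; exact: linset_add].
by have [-> ->] := smod_par_uniq e0 (e1 : smod_par (~~ false) v1) d0 d1 e.
Qed.

Lemma simple_hss M (la : hdual h) (v : M) : simple_smod M -> v <> 0 -> is_weight_vector la v ->
  h_semisimple h M.
Proof.
move=> [_ sM] v0 wv u; have hl := hssv_linset h M.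
have [|/(_ v) H|] := sM (@hssv _ _ a h M); last by apply.
  have [h0 hD] := hl; split=> // [x w hw|w0 w1]; last exact: hssv_graded.
  by rewrite smod_actE; apply: (hssv_act ha he ga as_) => //; apply: subvsP.
by case: v0; apply: H; apply: weight_hssv wv.
Qed.

Lemma simple_fg M : simple_smod M -> finitely_generated M.
Proof.
move=> [[v v0] sM]; exists [:: v] => N Ns Nv; case: (sM N Ns) => // H.
by case: v0; apply: H; apply: Nv; rewrite mem_head.
Qed.

Lemma lspan_subspace M (s : seq M) (Q : M -> Prop) : linset Q ->
  (forall u, Q u -> in_lspan s u) ->
  exists t, (forall u, u \in t -> Q u) /\ forall u, Q u -> in_lspan t u.
Proof.
elim: s Q => [|x s IH] Q Ql Qs; first by exists [::].
have [sl0 slD] := lspan_linset s; have [Q0 QD] := Ql.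
have [|u|t [tQ Qt]] := IH (fun u => Q u /\ in_lspan s u).
- by split=> // c u v [Qu su] [Qv sv]; split; [apply: QD|apply: slD].
- by case.
have [[w [Qw ws]]|no] := pselect (exists w, Q w /\ ~ in_lspan s w).
  exists (w :: t); split=> [u|u Qu]; first by rewrite inE => /orP[/eqP->|/tQ[]].
  have [c [w' [sw' ew]]] := (lspan_cons _ _ _).1 (Qs _ Qw).
  have [d [u' [su' eu]]] := (lspan_cons _ _ _).1 (Qs _ Qu).
  have c0 : c != 0 by apply/eqP => c0; apply: ws; rewrite ew c0 scale0r add0r.
  apply/lspan_cons; exists (d / c), (u - (d / c) *: w); split; last by rewrite addrC subrK.
  apply: Qt; split; first by apply: (linset_sub Ql) => //; apply: linset_scale.
  have -> : u - (d / c) *: w = - (d / c) *: w' + u'.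
    rewrite ew scalerDr scalerA divfK // eu opprD addrACA subrr add0r scaleNr.
    by rewrite addrC.
  exact: slD.
exists t; split=> [u /tQ[]//|u Qu]; apply: Qt; split=> //.
by apply: contrapT => us; apply: no; exists u.
Qed.

(** The stable span of [f v] is cut down to its intersection with the image of [f]; that subspace
    has a finite spanning list, which is pulled back. *)
Lemma lfinv_inj M M' (f : M -> M') v : smod_hom f -> injective f -> lfinv p (f v) -> lfinv p v.
Proof.
move=> fh fi [s [sv sp]]; have fl : linear f by case: fh.
have sl := lspan_linset s; have [sl0 slD] := sl.
pose Q w := in_lspan s w /\ exists u, f u = w.
have Ql : linset Q.
  split=> [|c w1 w2 [s1 [u1 e1]] [s2 [u2 e2]]]; first by split=> //; exists 0; exact: lin0f fl.
  by split; [apply: slD|exists (c *: u1 + u2); rewrite fl e1 e2].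
have [|t0 [tQ Qt]] := lspan_subspace (s := s) Ql; first by move=> u [].
have [t et] : exists t, map f t = t0.
  elim: t0 tQ {Qt} => [|x t0 IH] tQ; first by exists [::].
  have [|t et] := IH; first by move=> u ut; apply: tQ; rewrite inE ut orbT.
  by have [|_ [u eu]] := tQ x; [exact: mem_head|exists (u :: t); rewrite /= et eu].
have back u : Q (f u) -> in_lspan t u.
  by move=> /Qt; rewrite -et => /(lspan_mapV fl)[u' u't /fi <-].
exists t; split; first by apply: back; split=> //; exists v.
move=> x w xp wt; apply: back; split; last by exists (act x w).
rewrite (hom_act fh); apply: sp => //.
have [] // : Q (f w).
by apply: (lspan_sub Ql tQ); rewrite -et; apply: lspan_map.
Qed.

(** Local finiteness is inherited from the ambient module; the weight vector and simplicity give the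
    other two conditions. *)
Lemma simple_catO M M' (f : M -> M') (la : hdual h) (v : M) : simple_smod M -> v <> 0 ->
  is_weight_vector la v -> smod_hom f -> injective f -> catO h p M' -> catO h p M.
Proof.
move=> sM v0 wv fh fi [_ _ lf]; split; [exact: simple_fg|exact: simple_hss sM v0 wv|].
by move=> u; apply: (lfinv_inj fh fi); apply: lf.
Qed.

(** The extension of [f] to [I] has a kernel that misses the essential submodule [M], so it is
    injective; injectivity of [I] then splits it. *)
Lemma envelope_retract M (I J : supermodule a) (f : M -> J) : catO h p M -> injective_envelope (catO h p) M I ->
  injective_object (catO h p) J -> smod_hom f -> injective f ->
  exists (i : I -> J) (r : J -> I), [/\ smod_hom i, smod_hom r & forall v, r (i v) = v].
Proof.
move=> AM [[AI II] [j [jh ji jess]]] [AJ IJ] fh fi.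
have [i [ih ij]] := IJ _ _ j f AM AI jh ji fh.
have iinj : injective i.
  apply: (hom_inj ih) => v iv; apply: contrapT => v0.
  have [|w [iw jw]] := jess _ (ker_subsupermodule ih); first by exists v.
  apply: jw; have -> : w = 0; last by case: jh => jl _ _; exact: lin0f jl.
  apply: fi; have [fl _ _] := fh; rewrite (lin0f fl); by rewrite -ij.
have [r [rh ri]] := II _ _ i id AI AJ ih iinj (hom_id I).
by exists i, r.
Qed.

End SimpleCatO.

Section ParityShift.

Variables (K : numClosedFieldType) (g : lieSuperalgebra K) (h p : {vspace g}).
Hypotheses (he : (h <= even_part g)%VS) (pe : (p <= even_part g)%VS).
Local Notation even := (even_part g).
Local Notation A := (@catO _ g even h p).
Implicit Types M N : supermodule even.

Lemma zero_chil (c : K) (x y : g) : 0 = c * 0 + 0 :> K. Proof. by rewrite mulr0 addr0. Qed.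
Lemma zero_chi0 (i : bool) (x y : g) : x \in even -> y \in even ->
  x \in lsa_par g i -> y \in lsa_par g i -> 0 = 0 :> K.
Proof. by []. Qed.

(** Needed because morphisms are even: simple modules of the same highest weight can differ by a
    parity change, which leaves projective dimension unaffected. *)
Definition shift M : supermodule even :=
  @twist_smod K g even (fun=> 0) 1 true zero_chil zero_chi0 (mulr1 1) (@even_subalg K g) M.

Lemma shift_act M x (v : M) : x \in even -> act x (v : shift M) = act x v.
Proof. by move=> xe; rewrite twist_even // scale0r addr0. Qed.

Lemma shift_hom M N (f : M -> N) : smod_hom f -> smod_hom (f : shift M -> shift N).
Proof. by apply: twist_hom; apply: even_graded. Qed.

Lemma shift_adjr M N (f : M -> N) : smod_hom (f : shift M -> N) -> smod_hom (f : M -> shift N).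
Proof. by apply: twist_adjr; [move=> _; rewrite oppr0|apply: even_graded]. Qed.

Lemma shift_adjl M N (f : M -> N) : smod_hom (f : M -> shift N) -> smod_hom (f : shift M -> N).
Proof. by apply: twist_adjl; [move=> _; rewrite oppr0|apply: even_graded]. Qed.

Lemma shift_catO M : A M -> A (shift M).
Proof. by apply: twist_catO => //; apply: even_graded. Qed.

Lemma shift_subsup M (N : M -> Prop) : is_subsupermodule (N : shift M -> Prop) ->
  is_subsupermodule N.
Proof.
move=> [N0 ND NA Ng]; split=> // [x v Nv|v0 v1 e0 e1 Nv].
  by rewrite smod_actE -shift_act ?subvsP // -smod_actE; apply: NA.
have [|//] := Ng v1 v0 e1 e0; first by rewrite addrC.
Qed.

Lemma shift_simple M : simple_smod M -> simple_smod (shift M).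
Proof. by move=> [M0 sM]; split=> // N Ns; apply: sM; apply: shift_subsup. Qed.

Lemma shift_projective P : projective A P -> projective A (shift P).
Proof.
move=> [AP PP]; split=> [|M N f k AM AN fh fs kh]; first exact: shift_catO.
have [k' [k'h e]] := PP (shift M) (shift N) f k (shift_catO AM) (shift_catO AN) (shift_hom fh) fs (shift_adjr kh).
by exists k'; split=> //; apply: shift_adjl.
Qed.

Lemma shift_injective I : injective_object A I -> injective_object A (shift I).
Proof.
move=> [AI II]; split=> [|M N f k AM AN fh fi kh]; first exact: shift_catO.
have [k' [k'h e]] := II (shift M) (shift N) f k (shift_catO AM) (shift_catO AN) (shift_hom fh) fi (shift_adjl kh).
by exists k'; split=> //; apply: shift_adjr.
Qed.

Lemma shift_envelope M I : injective_envelope A M I -> injective_envelope A (shift M) (shift I).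
Proof.
move=> [II [f [fh fi fe]]]; split; first exact: shift_injective.
exists f; split=> //; first exact: shift_hom.
by move=> N Ns; apply: fe; apply: shift_subsup.
Qed.

Lemma shift_pdle n M : pdle A n M -> pdle A n (shift M).
Proof.
apply: (exact_functor_pdle (F := shift)) => [P|X Y Z i q [ih qh ii qs ex]].
  exact: shift_projective.
by exists i, q; split=> //; apply: shift_hom.
Qed.

Lemma shift_pdleE n M : pdle A n (shift M) <-> pdle A n M.
Proof.
split; last exact: shift_pdle.
move=> /shift_pdle.
apply: (pdle_retract _ _ (M := M) (X := shift (shift M)) (i := id) (r := id)) => //.
- by move=> X Y f; apply: catO_quo.
- by move=> X Y; apply: catO_prod.
- by apply: shift_adjr; apply: hom_id.
- by apply: shift_adjl; apply: hom_id.
Qed.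

End ParityShift.

(** * Comparison of projective dimensions *)

Section Main.

Variables (K : numClosedFieldType) (g : lieSuperalgebra K) (gm gp h p0 : {vspace g}).
Variables (Phi : seq (hdual h)) (la : hdual h).
Hypotheses (cl : classical g) (ti : type_I_grading gm gp) (ec : even_cartan h).
Hypotheses (ps : positive_system Phi) (ep : even_parabolic Phi p0).
Local Notation even := (even_part g).
Local Notation full := (fullv : {vspace g}).

Let he : (h <= even_part g)%VS. Proof. by case: ec. Qed.
Let pe : (p0 <= even)%VS. Proof. by case: ep. Qed.

Lemma stage_gm : stage 0 gm even (even + gm).
Proof.
split=> //; rewrite ?addv0 ?sub0v ?cap0v //.
- by apply/subvP => x; apply: (gm_odd ti).
- by move=> x y _; rewrite memv0 => /eqP->; rewrite br0r mem0v.
- by move=> x y; apply: (even_gm ti).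
- by move=> x y; rewrite memv0 => /eqP->; rewrite br0l.
- by move=> x y; apply: (gm_gm ti).
Qed.

Lemma stage_gp : stage gm gp (even + gm) full.
Proof.
have [[s c] _ _ _ _] := ti; split=> //.
- by rewrite -addvA [(gm + gp)%VS]addvC s -lsa_full.
- by apply/subvP => x; apply: (gm_odd ti).
- by apply/subvP => x; apply: (gp_odd ti).
- by rewrite capvC.
- by move=> x y; apply: (even_gm ti).
- by move=> x y; apply: (even_gp ti).
- by move=> x y; apply: (gm_gm ti).
- by move=> x y; apply: (gp_gp ti).
Qed.

Lemma ss_gm : ad_ss h gm.
Proof. by apply: (ad_ss_stable cl ec) => t x th; apply: (even_gm ti); apply: (subvP he). Qed.
Lemma ss_gp : ad_ss h gp.
Proof. by apply: (ad_ss_stable cl ec) => t x th; apply: (even_gp ti); apply: (subvP he). Qed.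
Lemma ss_full : ad_ss h full.
Proof. by apply: (ad_ss_stable cl ec) => t x _ _; apply: memvf. Qed.
Lemma ss_even : ad_ss h even.
Proof. by apply: (ad_ss_stable cl ec) => t x th; apply: br_ee; apply: (subvP he). Qed.

Lemma even_n_even x : x \in even_n Phi -> x \in even.
Proof.
move: x; apply/subvP; rewrite /even_n; elim: Phi => [|al s IH]; first by rewrite big_nil sub0v.
by rewrite big_cons subv_add IH andbT; apply/subvP => x; apply: root_even.
Qed.

(** A given highest weight vector may be inhomogeneous, but the conditions on it are homogeneous and
    pass to its components, one of which is nonzero. *)
Lemma hw_homog (a : {vspace g}) (M : supermodule a) (X : g -> Prop) (v : M) : (h <= a)%VS ->
  (forall x, X x -> x \in a /\ exists i, x \in lsa_par g i) -> v <> 0 -> is_weight_vector la v ->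
  (forall x, X x -> act x v = 0) ->
  exists i (u : M), [/\ smod_par i u, u <> 0, is_weight_vector la u & forall x, X x -> act x u = 0].
Proof.
move=> ha Xh v0 wv Xv; have [v1 [v2 [e1 e2 ev]]] := smod_full v; rewrite ev in wv Xv v0.
have [w1 w2] := weight_homog ha he e1 e2 wv.
have Xk x : X x -> act x v1 = 0 /\ act x v2 = 0.
  by move=> Xx; have [xa [i xi]] := Xh x Xx; apply: (kill_homog xa xi e1 e2); apply: Xv.
have [v10|v10] := pselect (v1 = 0); last by exists false, v1; split=> // x /Xk[].
exists true, v2; split=> // [v20|x /Xk[] //]; by apply: v0; rewrite v10 v20 addr0.
Qed.

Notation R2 := (res_smod (stage_bs stage_gp) (stage_ba stage_gp)).
Notation R1 := (res_smod (stage_bs stage_gm) (stage_ba stage_gm)).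

Lemma res_res_hom (L : supermodule full) : smod_hom (id : Res0 L -> R1 (R2 L)).
Proof.
split=> // x v; have xe := subvsP x.
have xb : vsval x \in (even + gm)%VS by apply: (subvP (addvSl _ _)).
by rewrite !smod_actE Res0_act // !res_act.
Qed.

Lemma res_hom_fun (L M : supermodule full) (f : L -> M) : smod_hom f ->
  smod_hom (f : R1 (R2 L) -> R1 (R2 M)).
Proof. by move=> fh; do 2 apply: res_hom. Qed.

Lemma pdle_envelopes (L I : supermodule full) (L0 I0 : supermodule even) (v : L) (v0 : L0) i :
  simple_smod L -> simple_smod L0 -> v <> 0 -> v0 <> 0 -> smod_par i v -> smod_par i v0 ->
  is_weight_vector la v -> hwv Phi la v0 ->
  (forall x, x \in even_n Phi -> act x v = 0) -> gpinv gp v ->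
  injective_envelope (catO h (p0 + gp)%VS) L I -> injective_envelope (catO h p0) L0 I0 ->
  forall n, pdle (catO h (p0 + gp)%VS) n I <-> pdle (catO h p0) n I0.
Proof.
move=> sL sL0 vn v0n vi v0i wv hv0 nv iv eI eI0 n.
have pg : (p0 <= p0 + gp)%VS := addvSl _ _.
have p0g : (p0 <= p0 + gm)%VS := addvSl _ _.
have AL : catO h (p0 + gp)%VS L.
  have [[AI _] [j [jh ji _]]] := eI.
  exact: (simple_catO (subvf h) he (@full_graded _ g) ss_full sL vn wv jh ji AI).
have AL0 : catO h p0 L0.
  have [[AI _] [j [jh ji _]]] := eI0; have [wv0 _] := hv0.
  exact: (simple_catO he he (@even_graded _ g) ss_even sL0 v0n wv0 jh ji AI).
have hv : hwv Phi la (v : Res0 L).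
  split=> [t|x xn]; first by rewrite Res0_act ?wv //; apply: (subvP he) (subvsP t).
  by rewrite Res0_act ?nv // even_n_even.
(* Submodules of the cyclic module of [v] consist of [gp]-invariants, so a nonzero one contains [v]
   by [gpinv_sub], as [hw_embed] requires. *)
have [f [fh fi]] : exists f : L0 -> Res0 L, smod_hom f /\ injective f.
  have H := @hw_embed K g h cl ec Phi ps L0 (Res0 L) la v0 v i sL0 v0n vn v0i vi hv0 hv.
  apply: H.
  move=> N Ns Ng Nn; apply: (gpinv_sub ti sL Ns _ Nn iv) => u /Ng gu.
  apply: (gu (@gpinv K g gp L)) => [|_ <- //|y w [al _ ya]]; first exact: gpinv_linset.
  have ye := root_even ya; rewrite (Res0_act _ ye); exact: (gpinv_even ti ye).
pose F : L0 -> R1 (R2 L) := f.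
have Fh : smod_hom F := hom_comp fh (res_res_hom L).
have resA (M : supermodule full) : catO h (p0 + gp)%VS M -> catO h p0 (R1 (R2 M)).
  move=> AM; apply: (res_catO stage_gm he pe (subvv p0)).
  exact: (res_catO stage_gp he pe pg).
have [II [j [jh ji _]]] := eI; have [II0 [j0 [j0h j0i _]]] := eI0.
have quo (X Y : supermodule even) (k : X -> Y) : catO h p0 X -> smod_hom k -> (forall w, exists u, k u = w) -> catO h p0 Y.
  exact: catO_quo.
split=> [pI|pI0].
  (* The restriction of [I] is injective and contains [L0] by way of [L], so [I0] is a direct
     summand of it. *)
  have J0 : injective_object (catO h p0) (R1 (R2 I)).
    apply: (res_injective stage_gm he pe (subvv p0) p0g ss_gm).
    exact: (res_injective stage_gp he pe pg (subvv _) ss_gp).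
  have kh : smod_hom (fun u => j (F u) : R1 (R2 I)) := hom_comp Fh (res_hom_fun jh).
  have [|k [r [kh' rh rk]]] := envelope_retract AL0 eI0 J0 kh; first by move=> x y /ji/fi.
  apply: (pdle_retract _ _ kh' rh rk); [exact: quo|by move=> X Y; apply: catO_prod|].
  apply: (res_pdle stage_gm he pe (subvv p0) p0g ss_gm).
  exact: (res_pdle stage_gp he pe pg (subvv _) ss_gp).
pose J := coind stage_gp (coind stage_gm I0).
have IJ : injective_object (catO h (p0 + gp)%VS) J.
  apply: (coind_injective stage_gp he pe pg (subvv _) ss_gp).
  exact: (coind_injective stage_gm he pe (subvv p0) p0g ss_gm).
have [_ ext] := II0.
(* Injectivity of [I0] extends its inclusion of [L0] to the restriction of [L]; the two adjunctions
   turn this into a map from [L] to [J]. *)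
have [k [kh kF]] := ext _ _ F j0 AL0 (resA L AL) Fh fi j0h.
pose k1 := coind_lift kh; have k1h := coind_lift_hom kh.
pose k2 := coind_lift k1h; have k2h := coind_lift_hom k1h.
(* [L] is simple, so the kernel is 0 or everything; in the latter case the two counits would give
   [j0 v0 = 0]. *)
have k2i : injective k2.
  apply: (hom_inj k2h); have [_ sub] := sL.
  case: (sub _ (ker_subsupermodule k2h)) => // k20.
  have [e1 _ _] := coind_eps_hom stage_gp (coind stage_gm I0).
  have [e2 _ _] := coind_eps_hom stage_gm I0; have [j0l _ _] := j0h.
  have k10 : k1 (F v0) = 0.
    rewrite -[LHS](coind_lift_eps k1h (F v0)); have -> : coind_lift k1h (F v0) = 0 by exact: k20.
    exact: lin0f e1.
  case: v0n; apply: j0i; rewrite -kF (lin0f j0l) -[LHS](coind_lift_eps kh (F v0)).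
  have -> : coind_lift kh (F v0) = 0 by exact: k10.
  exact: lin0f e2.
have [i' [r [ih rh ri]]] := envelope_retract AL eI IJ k2h k2i.
apply: (pdle_retract _ _ ih rh ri).
- by move=> X Y q; apply: catO_quo.
- by move=> X Y; apply: catO_prod.
apply: (coind_pdle stage_gp he pe pg (subvv _) ss_gp).
exact: (coind_pdle stage_gm he pe (subvv p0) p0g ss_gm).
Qed.

Lemma pd_envelopes (L I : supermodule full) (L0 I0 : supermodule even) :
  simple_of_highest_weight (even_n Phi + gp)%VS la L ->
  injective_envelope (catO h (p0 + gp)%VS) L I ->
  simple_of_highest_weight (even_n Phi) la L0 ->
  injective_envelope (catO h p0) L0 I0 ->
  pd (catO h (p0 + gp)%VS) I = pd (catO h p0) I0.
Proof.
move=> [sL [v [v0 wv nv]]] eI [sL0 [w [w0 ww nw]]] eI0.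
have [||i [u [ui u0 wu nu]]] := @hw_homog _ L (fun x => x \in even_n Phi \/ x \in gp) v (subvf _) _ v0 wv.
- by move=> x [/even_n_even xe|/(gp_odd ti) xo]; split; rewrite ?memvf //; [exists false|exists true].
- by move=> x [xn|xg]; apply: nv; [apply: (subvP (addvSl _ _))|apply: (subvP (addvSr _ _))].
have [|i0 [u' [u'i u'0 wu' nu']]] := @hw_homog _ L0 (fun x => x \in even_n Phi) w he _ w0 ww nw.
  by move=> x /even_n_even xe; split=> //; exists false.
have nu1 x : x \in even_n Phi -> act x u = 0 by move=> xn; apply: nu; left.
have iu : gpinv gp u by move=> x xg; apply: nu; right.
have E n : pdle (catO h (p0 + gp)%VS) n I <-> pdle (catO h p0) n I0.
  (* When the highest weight vectors have different parities, [L0] and [I0] are replaced by their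
     shifts. *)
  have [ii|ii] := eqVneq i i0.
    rewrite -ii in u'i.
    exact: (pdle_envelopes sL sL0 u0 u'0 ui u'i wu (conj wu' nu') nu1 iu eI eI0).
  rewrite -(shift_pdleE he pe n I0).
  have e0 := shift_envelope he pe eI0; have s0 := shift_simple sL0.
  have u'i' : smod_par i (u' : shift L0).
    have ei : i0 = i (+) true by case: (i) (i0) ii => [] [].
    by have := u'i; rewrite ei.
  apply: (pdle_envelopes sL s0 u0 u'0 ui u'i' wu _ nu1 iu eI e0).
  split=> [t|x xn]; first by rewrite shift_act ?wu' //; apply: (subvP he) (subvsP t).
  by rewrite shift_act ?nu' // even_n_even.
have [[AI _] _] := eI; have [[AI0 _] _] := eI0.
by apply: eq_pd => n; rewrite !proj_resolution_pdle //; move=> X Y q; apply: catO_quo.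
Qed.

End Main.

Theorem proposition19 (R : realType) (g : lieSuperalgebra R[i])
    (gm gp h p0 : {vspace g}) (Phi : seq (hdual h)) (la : hdual h)
    (L I : supermodule (fullv : {vspace g}))
    (L0 I0 : supermodule (even_part g)) :
  classical g ->
  type_I_grading gm gp ->
  even_cartan h ->
  positive_system Phi ->
  even_parabolic Phi p0 ->
  levi_dominant Phi p0 la ->
  simple_of_highest_weight (even_n Phi + gp)%VS la L ->
  injective_envelope (catO h (p0 + gp)%VS) L I ->
  simple_of_highest_weight (even_n Phi) la L0 ->
  injective_envelope (catO h p0) L0 I0 ->
  pd (catO h (p0 + gp)%VS) I = pd (catO h p0) I0.
Proof.
move=> cl ti ec ps ep _; exact: (pd_envelopes cl ti ec ps ep).
Qed.
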